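(* Let $d\in\mathbb{N}$, $s>0$ and $p\in[1,\infty]$. There exist constants $L_0>1$ and $c_0>0$ depending on $s,p,d$ such that the following holds. For $L_0\le L\le(n\ln n)^{s/d}$ let $$R_n=\Big(\inf_{\hat H}\sup_{f\in\mathrm{Lip}_{s,p,d}(L)}\mathbb{E}_f(\hat H-H(f))^2\Big)^{\frac12}.$$ Then: (i) if $p\in[1,\infty)$, $R_n\ge c_0\big((n\ln n)^{-\frac s{s+d}}L^{\frac d{s+d}}+n^{-\frac12}\ln L\big)$; (ii) if $p=\infty$, $R_n\ge c_0\big(n^{-\frac s{s+d}}(\ln n)^{-\frac{s+2d}{s+d}}L^{\frac d{s+d}}+n^{-\frac12}\ln L\big)$.
   Context: $|\cdot|$ is the Euclidean norm on $\mathbb{R}^d$ and $\|\cdot\|_p$ is the $L_p$ norm on $\mathbb{R}^d$. For $s>0$ put $r=\lceil s\rceil$ and $$\Delta_h^r f(x)=\sum_{k=0}^r(-1)^{r-k}\binom rk f\big(x+(k-\tfrac r2)h\big),\quad \omega_r(f,t)_p=\sup_{e\in\mathbb{R}^d,|e|\le1}\|\Delta_{te}^r f\|_p,$$ $$\|f\|_{\mathrm{Lip}_{s,p,d}}=\|f\|_p+\sup_{t>0}t^{-s}\omega_r(f,t)_p .$$ $\mathrm{Lip}_{s,p,d}(L)$ is the set of $f$ with $\|f\|_{\mathrm{Lip}_{s,p,d}}\le L$ and $\mathrm{supp}(f)\subseteq[0,1]^d$; the supremum is over the probability densities in this set. $H(f)=\int-f\ln f$ (with $0\ln0=0$). $\mathbb{E}_f$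 is expectation when $X_1,\dots,X_n$ are i.i.d. with density $f$, and $\inf_{\hat H}$ is over all measurable functions $\hat H=\hat H(X_1,\dots,X_n)$. *)

(* Defs.v *)
From HB Require Import structures.
From mathcomp Require Import all_boot all_order all_algebra.
From mathcomp Require Import all_classical all_reals all_analysis.
From mathcomp Require Import measurable_realfun.

Set Implicit Arguments.
Unset Strict Implicit.
Unset Printing Implicit Defensive.

Import Order.TTheory GRing.Theory Num.Theory.
Import numFieldNormedType.Exports.

Local Open Scope classical_set_scope.
Local Open Scope ring_scope.

Section image_measure.
Context d d' (T : measurableType d) (T' : measurableType d') (R : realType).
Variables (mu : {measure set T -> \bar R}) (X : {mfun T >-> T'}).

Definition image_measure : set T' -> \bar R := pushforward mu X.

Let image_measure0 : image_measure set0 = 0%E.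
Proof. exact: measure0. Qed.

Let image_measure_ge0 A : (0 <= image_measure A)%E.
Proof. exact: measure_ge0. Qed.

Let image_measure_sigma_additive : semi_sigma_additive image_measure.
Proof. exact: measure_semi_sigma_additive. Qed.

HB.instance Definition _ := isMeasure.Build _ _ _ image_measure
  image_measure0 image_measure_ge0 image_measure_sigma_additive.

End image_measure.

Section power_measure.
Context d (T : measurableType d) (R : realType).

Definition cons_pair n (x : T * n.-tuple T) : n.+1.-tuple T :=
  [the n.+1.-tuple T of x.1 :: x.2].

Let measurable_cons_pair n : measurable_fun [set: _] (@cons_pair n).
Proof. exact: measurable_cons. Qed.

HB.instance Definition _ n := @isMeasurableFun.Build _ _ _ _ (@cons_pair n)
  (@measurable_cons_pair n).

Section cons_measure.
Variables (mu : {sigma_finite_measure set T -> \bar R}) (n : nat).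
Variable nu : {sigma_finite_measure set (n.-tuple T) -> \bar R}.

Definition cons_measure : set (n.+1.-tuple T) -> \bar R :=
  image_measure (mu \x nu)%E (@cons_pair n).

HB.instance Definition _ := Measure.on cons_measure.

Let cons_measure_sigma_finite : sigma_finite setT cons_measure.
Proof.
have /sigma_finiteP[F [TF ndF Foo]] := sigma_finiteT mu.
have /sigma_finiteP[G [TG ndG Goo]] := sigma_finiteT nu.
pose g (t : n.+1.-tuple T) := (thead t, [tuple of behead t]).
have cK x : g (cons_pair x) = x.
  by case: x => x t; congr pair; apply/val_inj.
have mg : measurable_fun setT g.
  apply/measurable_fun_pair; first exact: measurable_tnth.
  exact: measurable_behead.
exists (fun k => g @^-1` (F k `*` G k)).
  rewrite -preimage_bigcup -[LHS](preimage_setT g); congr (_ @^-1` _).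
  rewrite -setXTT TF TG predeqE => -[x y]; split.
    move=> [/= [i _ Fx] [j _ Gy]]; exists (maxn i j) => //; split.
    - by move: x Fx; exact/subsetPset/ndF/leq_maxl.
    - by move: y Gy; exact/subsetPset/ndG/leq_maxr.
  by move=> [i _ []/= ? ?]; split; exists i.
move=> k; have [mF oF] := Foo k; have [mG oG] := Goo k; split.
  by rewrite -[X in measurable X]setTI; apply: mg => //; exact: measurableX.
rewrite /cons_measure /image_measure /pushforward -comp_preimage.
rewrite (_ : g \o _ = id) ?preimage_id; last exact/funext.
have := product_measure1E mu nu mF mG; rewrite /= => ->.
by rewrite lte_mul_pinfty// ge0_fin_numE.
Qed.

HB.instance Definition _ := Measure_isSigmaFinite.Build _ _ _ cons_measure
  cons_measure_sigma_finite.

End cons_measure.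

(* The n-fold product measure, transported from T * (T * ...) to n-tuples; its
   values on boxes are given by [power_measureE]. *)
Fixpoint power_measure (mu : {sigma_finite_measure set T -> \bar R}) n :
    {sigma_finite_measure set (n.-tuple T) -> \bar R} :=
  if n is n'.+1 then cons_measure mu (power_measure mu n')
  else \d_([tuple] : 0.-tuple T).

End power_measure.

Section power_measure_theory.
Context d (T : measurableType d) (R : realType).
Local Open Scope ereal_scope.

Lemma power_measureE (mu : {sigma_finite_measure set T -> \bar R}) n
    (A : 'I_n -> set T) : (forall i, measurable (A i)) ->
  power_measure mu n [set t | forall i, A i (tnth t i)] = \prod_(i < n) mu (A i).
Proof.
elim: n A => [|n IHn] A mA.
  by rewrite big_ord0 /= diracE mem_set// => -[].
have mB : measurable [set t : n.-tuple T | forall i, A (lift ord0 i) (tnth t i)].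
  rewrite (_ : [set _ | _] =
    \bigcap_i ((fun t => tnth t i) @^-1` A (lift ord0 i))).
    apply: fin_bigcap_measurable => // i _.
    by rewrite -[X in measurable X]setTI; exact: measurable_tnth.
  by apply/seteqP; split => [t At i _|t At i]; [exact: At|exact: (At i I)].
rewrite big_ord_recl -IHn//= /cons_measure /image_measure /pushforward.
rewrite (_ : _ @^-1` _ =
  A ord0 `*` [set t : n.-tuple T | forall i, A (lift ord0 i) (tnth t i)]).
  exact: product_measure1E.
apply/seteqP; split => -[x t] /=.
  move=> At; split; first exact: (At ord0).
  by move=> i; have := At (lift ord0 i); rewrite tnthS.
move=> [Ax At] i; case: (unliftP ord0 i) => [j|] ->; last exact: Ax.
by rewrite tnthS; exact: At.
Qed.

End power_measure_theory.

Section iid.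
Context d (T : measurableType d) (R : realType) (P : probability T R) (n : nat).

(* The joint law of [n] independent random variables with common law [P]. *)
Definition iid : set (n.-tuple T) -> \bar R := power_measure P n.

HB.instance Definition _ := Measure.on iid.

Let iid_setT : iid setT = 1%E.
Proof.
have -> : [set: n.-tuple T] = [set t | forall i : 'I_n, setT (tnth t i)].
  exact/seteqP.
rewrite /iid (power_measureE P (A := fun=> setT))// big1// => i _; exact: probability_setT.
Qed.

HB.instance Definition _ := Measure_isProbability.Build _ _ _ iid iid_setT.

End iid.
Arguments iid {d T R} P n.

Section euclidean_space.
Context (R : realType) (d : nat).

Let coord (i : 'I_d) (x : 'rV[R]_d) : measurableTypeR R := x ord0 i.

Let rV_set0 : g_sigma_preimage coord set0.
Proof. exact: sigma_algebra0. Qed.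

Let rV_setC A : g_sigma_preimage coord A -> g_sigma_preimage coord (~` A).
Proof. exact: sigma_algebraC. Qed.

Let rV_bigcup (F : _^nat) : (forall i, g_sigma_preimage coord (F i)) ->
  g_sigma_preimage coord (\bigcup_i (F i)).
Proof. exact: sigma_algebra_bigcup. Qed.

(* The Borel sigma-algebra of R^d, generated by the coordinates. *)
HB.instance Definition _ := @isMeasurable.Build (measure_tuple_display
  R.-ocitv.-measurable.-sigma)
  'rV[R]_d (g_sigma_preimage coord) rV_set0 rV_setC rV_bigcup.

Definition row_of_tuple (t : d.-tuple (measurableTypeR R)) : 'rV[R]_d :=
  \row_i tnth t i.

Let measurable_row_of_tuple : measurable_fun [set: _] row_of_tuple.
Proof.
move=> _ A mA; rewrite setTI.
suff: preimage_set_system setT row_of_tuple (g_sigma_preimage coord)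
    (row_of_tuple @^-1` A).
  rewrite -g_sigma_preimage_comp.
  congr (g_sigma_preimage _ _).
  by apply/funext => i; apply/funext => t; rewrite /coord /= mxE.
by exists A => //; rewrite setTI.
Qed.

HB.instance Definition _ := @isMeasurableFun.Build _ _ _ _ row_of_tuple
  measurable_row_of_tuple.

(* Lebesgue measure on R^d: the product measure seen on row vectors. *)
Definition leb : set 'rV[R]_d -> \bar R :=
  image_measure (power_measure lebesgue_measure d) row_of_tuple.

HB.instance Definition _ := Measure.on leb.

End euclidean_space.

Arguments leb {R} d.

Lemma leb_box (R : realType) (d : nat) (A : 'I_d -> set (measurableTypeR R)) :
  (forall i, measurable (A i)) ->
  leb d [set x : 'rV[R]_d | forall i, A i (x ord0 i)] =
  (\prod_(i < d) lebesgue_measure (A i))%E.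
Proof.
move=> mA; rewrite -(power_measureE lebesgue_measure mA).
congr (power_measure _ _ _); apply/seteqP.
by split => t At i; have := At i; rewrite mxE.
Qed.

Section density.
Context (R : realType) (d : nat).

(* Probability densities with respect to Lebesgue measure. *)
Record density := Density {
  pdf :> 'rV[R]_d -> R ;
  measurable_pdf : measurable_fun [set: 'rV[R]_d] pdf ;
  pdf_ge0 : forall x, 0 <= pdf x ;
  integral_pdf : (\int[leb d]_x (pdf x)%:E = 1)%E }.

Variable f : density.

Definition law : set 'rV[R]_d -> \bar R :=
  fun A => (\int[leb d]_(x in A) (f x)%:E)%E.

Let law0 : law set0 = 0%E.
Proof. exact: integral_set0. Qed.

Let law_ge0 A : (0 <= law A)%E.
Proof. by apply: integral_ge0 => x _; rewrite lee_fin pdf_ge0. Qed.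

Let law_sigma_additive : semi_sigma_additive law.
Proof.
apply: semi_sigma_additive_nng_induced => [|x]; last by rewrite lee_fin pdf_ge0.
by apply/measurable_EFinP; exact: measurable_pdf.
Qed.

HB.instance Definition _ := isMeasure.Build _ _ _ law
  law0 law_ge0 law_sigma_additive.

Let law_setT : law setT = 1%E.
Proof. exact: integral_pdf. Qed.

HB.instance Definition _ := Measure_isProbability.Build _ _ _ law law_setT.

End density.

Section lipschitz_ball.
Context (R : realType) (d : nat).
Implicit Types (x h e : 'rV[R]_d) (f : 'rV[R]_d -> R) (s t L : R) (p : \bar R).

(* The library's norm [`|x|] on 'rV[R]_d is the sup norm. *)
Definition enorm x : R := Num.sqrt (\sum_(i < d) x ord0 i ^+ 2).

Definition finite_diff (r : nat) h f x : R :=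
  \sum_(k < r.+1)
    (-1) ^+ (r - k) * 'C(r, k)%:R * f (x + (k%:R - r%:R / 2) *: h).

Definition modulus (r : nat) f t p : \bar R :=
  ereal_sup [set 'N[leb d]_p [EFin \o finite_diff r (t *: e) f]%E
            | e in [set e | enorm e <= 1]].

Definition lip_norm s p f : \bar R :=
  let r := `|Num.ceil s|%N in
  ('N[leb d]_p [EFin \o f] +
   ereal_sup [set (t `^ (- s))%:E * modulus r f t p | t in [set t | (0 < t)%R]])%E.

Definition unit_cube : set 'rV[R]_d :=
  [set x | forall i, 0 <= x ord0 i <= 1].

Definition lip_ball s p L : set ('rV[R]_d -> R) :=
  [set f | [/\ measurable_fun [set: 'rV[R]_d] f,
               (lip_norm s p f <= L%:E)%E &
               closure [set x | f x != 0] `<=` unit_cube]].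

End lipschitz_ball.

Section risk.
Context (R : realType) (d n : nat).

(* The integrand vanishes where [f] does. [Rintegral] returns 0 on an infinite
   integral; this never occurs on a Lipschitz ball: there -f ln f <= 1/e on the
   cube, and f is in L_q for some q > 1 (by the Besov embedding if p = 1). *)
Definition entropy (f : 'rV[R]_d -> R) : R :=
  \int[leb d]_x (- f x * ln (f x)).

Definition mse (Hhat : n.-tuple 'rV[R]_d -> R) (f : density R d) : \bar R :=
  'E_(iid (law f) n) [fun X => (Hhat X - entropy f) ^+ 2].

Definition minimax_mse (s : R) (p : \bar R) (L : R) : \bar R :=
  ereal_inf
    [set ereal_sup [set mse Hhat f | f in [set f : density R d | lip_ball s p L f]]
    | Hhat in [set Hhat | measurable_fun [set: n.-tuple 'rV[R]_d] Hhat]].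

Definition minimax_rmse (s : R) (p : \bar R) (L : R) : \bar R :=
  sqrte (minimax_mse s p L).

End risk.

(* Main.v *)
(* Fill the cube with disjoint smooth bumps: N^d small ones in [0, 1/2]^d and a
   large one in [1/2, 1]^d that carries the remaining mass. Give the i-th small
   bump the mass a u_i, where the u_i are i.i.d. under one of two priors on
   [0, K^2], K ~ 3 ln n, whose moments of order < K agree while the means of
   u ln u differ by a constant; the entropies then differ by about N^d a. The
   probability of a test is a polynomial in the mass of each single cell, so
   exchanging the priors one cell at a time only leaves the terms of degree at
   least K, of total size N^d e^(-K) if a = e^(-2) / (2 n K). Chebyshev's
   inequality and Le Cam's method give the first term, with N the largest size
   that the Lipschitz constraint allows: for p = oo the masses are bounded by
   a K^2, for p < oo it is enough that the mean of u^m is bounded for some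
   m >= p. For the second term, moving a mass of order n^(-1/2) between one small
   bump and the large one changes the entropy by n^(-1/2) ln N ~ n^(-1/2) ln L. *)

Require Import Defs.
From HB Require Import structures.
From mathcomp Require Import all_boot all_order all_algebra.
From mathcomp Require Import all_classical all_reals all_analysis.
From mathcomp Require Import measurable_realfun ess_sup_inf ring lra zify.

Import Order.TTheory GRing.Theory Num.Theory.
Import numFieldNormedType.Exports.

Local Open Scope classical_set_scope.
Local Open Scope ring_scope.

Set Implicit Arguments.
Unset Strict Implicit.
Unset Printing Implicit Defensive.

(** * Moment-matched priors *)

(** The priors are not obtained by dualizing the best approximation of x ln x: they are the
    normalized positive and negative parts of an explicit divided difference, so the gap and the
    moment bounds can be computed. Its nodes 1, 4, ..., K^2 are spread near 0 like Chebyshev nodes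
    of [0, K^2], which keeps the gap and the total weight bounded independently of K; finitely many
    further nodes near 0 make the weights decay fast enough for any prescribed number of bounded
    moments, as finite p demands. The sample size is fixed and the cell counts are dependent. In
    place of Poissonization, the large bump loses exactly what a cell gains: the masses then move
    along a line, and a test is a polynomial in one cell mass. The obstacle is that an unlucky draw
    can exceed the total mass 1 or leave the Lipschitz ball. Draws are cut off to an event that
    couples the cells, so independence has to be restored at each exchange, at the price of a
    probability that must be of order one over the number of cells. *)

Section interpolation.
Variables (F : fieldType) (J : finType) (u : J -> F).
Hypothesis u_inj : injective u.

(** The coefficients of a divided difference: [\sum_j dd_weight j * f (u j)] is the divided
    difference of f at all the nodes. *)
Definition dd_weight (j : J) : F := (\prod_(i | i != j) (u j - u i))^-1.

Let node_prod_neq0 j : \prod_(i | i != j) (u j - u i) != 0.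
Proof.
by apply/prodf_neq0 => i ij; rewrite subr_eq0 (inj_eq u_inj) eq_sym.
Qed.

Let size_node_prod (j : J) : size (\prod_(i | i != j) ('X - (u i)%:P)) = #|J|.
Proof.
rewrite -big_filter size_prod_XsubC -[RHS](cardC (pred1 j)) card1; congr (_.+1).
by rewrite size_filter -sum1_count -sum1_card; apply: eq_bigl.
Qed.

(** The difference of the two sides has degree below [#|J|] and vanishes at [#|J|] distinct
    nodes. *)
Lemma lagrange_interp (P : {poly F}) : (size P <= #|J|)%N ->
  P = \sum_j P.[u j] *: (dd_weight j *: \prod_(i | i != j) ('X - (u i)%:P)).
Proof.
move=> sP; apply/eqP; rewrite -subr_eq0; set D := _ - _.
apply: contraT => D0.
have sD : (size D <= #|J|)%N.
  rewrite (leq_trans (size_polyD _ _))// geq_max sP size_polyN.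
  rewrite (leq_trans (size_sum _ _ _))//; apply/bigmax_leqP => j _.
  by rewrite (leq_trans (size_scale_leq _ _))// (leq_trans (size_scale_leq _ _))// size_node_prod.
have rD : all (root D) (codom u).
  apply/allP => _ /codomP[k ->]; rewrite /root /D hornerD hornerN subr_eq0.
  rewrite horner_sum (bigD1 k)//= [X in _ + X]big1 ?addr0.
    rewrite !hornerZ horner_prod.
    under eq_bigr do rewrite hornerXsubC.
    by rewrite mulVf// mulr1.
  move=> j jk; rewrite !hornerZ horner_prod (bigD1 k) 1?eq_sym//=.
  by rewrite hornerXsubC subrr mul0r !mulr0.
have := max_poly_roots D0 rD; rewrite map_inj_uniq// enum_uniq => /(_ isT).
by rewrite size_map -cardE ltnNge sD.
Qed.

(** Compare the coefficients of degree [#|J|.-1] in [lagrange_interp]: the node products are monic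
    of that degree, and [P] has no such term. *)
Lemma sum_dd_weight_poly (P : {poly F}) : (size P < #|J|)%N ->
  \sum_j dd_weight j * P.[u j] = 0.
Proof.
move=> sP; have := lagrange_interp (ltnW sP).
move=> /(congr1 (fun Q : {poly F} => Q`_(#|J|.-1))).
have Jgt0 : (0 < #|J|)%N by exact: leq_ltn_trans sP.
rewrite nth_default; last by rewrite -ltnS prednK.
rewrite coef_sum => S0; rewrite [RHS]S0; apply: eq_bigr => j _.
rewrite !coefZ -[in X in _`_X](size_node_prod j) -/(lead_coef _).
by rewrite (monicP _) ?monic_prod_XsubC// mulr1 mulrC.
Qed.

Lemma sum_dd_weight_exp m : (m < #|J|.-1)%N ->
  \sum_j dd_weight j * u j ^+ m = 0.
Proof.
move=> mJ; rewrite -[RHS](@sum_dd_weight_poly 'X^m) ?size_polyXn; last first.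
  by move: mJ; case: #|J|.
by apply: eq_bigr => j _; rewrite hornerXn.
Qed.

(** Lagrange interpolation of the constant 1, evaluated at [- t]. This closed form of the divided
    difference of 1 / (t + x) is what makes the logarithmic sums below explicit. *)
Lemma sum_dd_weight_inv t : (0 < #|J|)%N -> (forall j, t + u j != 0) ->
  \sum_j dd_weight j / (t + u j) =
  (-1) ^+ #|J|.-1 / \prod_j (t + u j).
Proof.
move=> J0 tu; have : (size (1%R : {poly F}) <= #|J|)%N by rewrite size_poly1.
move/lagrange_interp/(congr1 (fun Q : {poly F} => Q.[- t])).
rewrite hornerE horner_sum => S1; rewrite -[X in X / _]mulr1 [X in _ * X / _]S1.
rewrite mulr_sumr mulr_suml.
apply: eq_bigr => j _; rewrite !hornerZ horner_prod -polyC1 hornerC /=.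
under [in RHS]eq_bigr do rewrite hornerXsubC -opprD -mulN1r.
rewrite big_split/= prodr_const.
have -> : #|[pred i | i != j]| = #|J|.-1.
  by rewrite -(cardC (pred1 j)) card1; apply: eq_card.
rewrite mul1r [\prod_k (t + u k)](bigD1 j)//=; set e := (-1) ^+ #|J|.-1; set P := \prod_(i | _) _.
have P0 : P != 0 by apply/prodf_neq0 => i _.
have ee : e * e = 1 by rewrite -expr2 sqrr_sign.
rewrite (_ : e * _ = e * e * (dd_weight j * P)); last by ring.
by rewrite ee mul1r invfM mulrACA mulfV// mulr1.
Qed.

End interpolation.

Section real_calculus.
Variable R : realType.
Implicit Types (f df : R -> R) (a b x : R).

Lemma MVT_closed f df a b : a < b ->
  (forall x, a <= x <= b -> is_derive x 1 f (df x)) ->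
  exists2 c, a < c < b & f b - f a = df c * (b - a).
Proof.
move=> ab fdf; have [||c] := @MVT R f df a b ab.
- by move=> x; rewrite in_itv/= => /andP[ax xb]; apply: fdf; rewrite !ltW.
- apply: derivable_within_continuous => x; rewrite in_itv/= => xab.
  by have [] := fdf x xab.
by rewrite in_itv/= => cab ->; exists c.
Qed.

Lemma is_derive_big (I : Type) (r : seq I) (P : pred I) (h : I -> R -> R)
    (dh : I -> R) x : (forall i, P i -> is_derive x 1 (h i) (dh i)) ->
  is_derive x 1 (fun t => \sum_(i <- r | P i) h i t) (\sum_(i <- r | P i) dh i).
Proof.
move=> hdh; rewrite (_ : (fun t => _) = \sum_(i <- r | P i) h i); last first.
  by apply/funext => t; rewrite fct_sumE.
elim/big_rec2 : _ => [|i f df Pi fdf]; first exact: is_derive_cst.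
by have := hdh i Pi => hi; apply: is_deriveD.
Qed.

Lemma ln_le_subr1 x : 0 < x -> ln x <= x - 1.
Proof.
move=> x0; have := @le_ln1Dx R (x - 1).
rewrite (_ : 1 + (x - 1) = x); last by ring.
by apply; lra.
Qed.

End real_calculus.

(** * The gap of x ln x under a divided difference *)

Section entropy_gap.
Variables (R : realType) (J : finType) (u : J -> R) (j0 : J).
Hypotheses (u_inj : injective u) (u0 : u j0 = 0) (u_ge0 : forall j, 0 <= u j).
Hypothesis J2 : (2 < #|J|)%N.

(** Scaled to give the node 0 the weight 1: the sign in [sum_dd_weight_inv] disappears, and for the
    nodes chosen below the total weight stays bounded. *)
Definition dd_ratio j := dd_weight u j / dd_weight u j0.
Local Notation w := dd_ratio.

Lemma dd_ratio_exp m : (m < #|J|.-1)%N -> \sum_j w j * u j ^+ m = 0.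
Proof.
move=> mJ; transitivity ((\sum_j dd_weight u j * u j ^+ m) / dd_weight u j0); last first.
  by rewrite (sum_dd_weight_exp u_inj mJ) mul0r.
by rewrite mulr_suml; apply: eq_bigr => j _; rewrite mulrAC.
Qed.

Lemma node_gt0 j : j != j0 -> 0 < u j.
Proof. by move=> jj0; rewrite lt0r u_ge0 andbT -u0 (inj_eq u_inj). Qed.

Let sum_dd_ratio_inv (t : R) : 0 < t ->
  \sum_j w j / (t + u j) = t^-1 * \prod_(j | j != j0) (u j / (u j + t)).
Proof.
move=> t0; under [LHS]eq_bigr do rewrite /dd_ratio mulrAC.
rewrite -mulr_suml sum_dd_weight_inv//; last 2 first.
- by rewrite (leq_trans _ J2).
- by move=> j; rewrite gt_eqF// ltr_wpDr.
rewrite /dd_weight invrK u0.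
under [X in _ * X = _]eq_bigr do rewrite sub0r -mulN1r.
rewrite big_split/= prodr_const.
have -> : #|[pred i | i != j0]| = #|J|.-1.
  by rewrite -(cardC (pred1 j0)) card1; apply: eq_card.
rewrite (bigD1 j0)//= u0 addr0.
rewrite big_split/= prodfV.
under [X in _ = _ * (_ * X^-1)]eq_bigr do rewrite addrC.
set e := (-1) ^+ _; set P := \prod_(i | _) (t + u i); set Q := \prod_(i | _) _.
have ee : e * e = 1 by rewrite -expr2 sqrr_sign.
transitivity (e * e * (t^-1 * (Q / P))); last by rewrite ee mul1r.
by rewrite invfM; ring.
Qed.

(** Since u / (u + t) = 1 - t / (u + t) and the weights sum to 0, this is [- t] times
    [sum_dd_ratio_inv]. *)
Let sum_dd_ratio_frac (t : R) : 0 < t ->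
  \sum_(j | j != j0) w j * u j / (u j + t) =
  - \prod_(j | j != j0) (u j / (u j + t)).
Proof.
move=> t0.
have : \sum_j (w j * u j / (u j + t) + t * (w j / (t + u j))) = 0.
  rewrite -[RHS](@dd_ratio_exp 0); last by move: J2; case: #|J| => [|[]].
  apply: eq_bigr => j _; rewrite expr0 mulr1.
  have tu : t + u j != 0 by rewrite gt_eqF// ltr_wpDr.
  have ut : u j + t != 0 by rewrite addrC.
  by field; rewrite ?tu ?ut.
rewrite big_split/= -mulr_sumr sum_dd_ratio_inv// mulVKf ?gt_eqF//.
by rewrite (bigD1 j0)//= u0 mulr0 mul0r add0r => /eqP; rewrite addr_eq0 => /eqP.
Qed.

(* The derivative of [Phi] is an explicit positive product and [Phi] tends to 0
   at infinity, so the gap [- Phi 0] is at least [Phi 1 - Phi 0]. *)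
Let Phi t := - \sum_(j | j != j0) w j * u j * ln (u j + t).

Let is_derive_Phi (t : R) : 0 <= t ->
  is_derive t 1 Phi (- \sum_(j | j != j0) w j * u j / (u j + t)).
Proof.
move=> t0; apply: is_deriveN.
apply: is_derive_big => j jj0.
have ut : 0 < u j + t by rewrite ltr_pwDl// node_gt0.
apply: is_deriveZ.
have := is_derive1_ln ut => dl.
have := @is_derive1_comp R (@ln R) (fun t => u j + t) t (u j + t)^-1 1.
rewrite mulr1; apply => //.
rewrite -[X in is_derive _ _ _ X]add0r.
by apply: (@is_deriveD _ _ _ (cst (u j)) id).
Qed.

Let Phi_le (t1 t2 : R) : 0 < t1 -> t1 < t2 -> Phi t1 <= Phi t2.
Proof.
move=> t10 t12.
have [|c /andP[c1 c2]] := MVT_closed t12 (f := Phi) (df := fun t => - \sum_(j | j != j0) w j * u j / (u j + t)).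
  by move=> x /andP[x1 x2]; apply: is_derive_Phi; rewrite ltW// (lt_le_trans t10).
have c0 := lt_trans t10 c1.
rewrite sum_dd_ratio_frac// => E; rewrite -subr_ge0 E opprK mulr_ge0//; last lra.
by apply: prodr_ge0 => j _; rewrite divr_ge0// addr_ge0// ltW.
Qed.

(** With at least three nodes the first moment vanishes, so ln t can be subtracted from each
    logarithm; then ln (1 + x) <= x. *)
Let Phi_infty (t : R) : 0 < t -> Phi t <= (\sum_j `|w j| * u j ^+ 2) / t.
Proof.
move=> t0.
have -> : Phi t = - \sum_j w j * u j * ln (u j / t + 1).
  have -> : Phi t = - \sum_j w j * u j * ln (u j + t).
    by rewrite [in RHS](bigD1 j0)//= u0 mulr0 mul0r add0r.
  congr (- _); apply/eqP; rewrite -subr_eq0 -sumrB.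
  under eq_bigr => j _.
    rewrite -mulrBr -ln_div ?posrE; last 2 first.
    - by rewrite ltr_wpDl.
    - by rewrite ltr_wpDl// divr_ge0// ltW.
    have -> : (u j + t) / (u j / t + 1) = t.
      by field; rewrite !gt_eqF// ltr_wpDl.
    over.
  rewrite -mulr_suml.
  have := @dd_ratio_exp 1; under eq_bigr do rewrite expr1.
  by move=> ->; rewrite ?mul0r//; move: J2; case: #|J| => [|[|[]]].
rewrite -sumrN mulr_suml; apply: ler_sum => j _.
have utp : 0 <= u j / t by rewrite divr_ge0// ltW.
rewrite -mulNr -mulNr (le_trans (ler_norm _))// normrM normrM normrN (ger0_norm (u_ge0 j)).
rewrite ger0_norm ?ln_ge0 ?lerDr// expr2 -!mulrA ler_wpM2l// ler_wpM2l//.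
by have := @ln_le_subr1 R (u j / t + 1); rewrite addrK; apply; lra.
Qed.

Lemma entropy_gap :
  \prod_(j | j != j0) (u j / (u j + 1)) <= \sum_j w j * u j * ln (u j).
Proof.
(* Otherwise monotonicity keeps [Phi] above [Phi 1] on the right of 1, against its decay: at t = 2 +
   M / Phi 1 the bound M / t is already below [Phi 1]. *)
have Phi1 : Phi 1 <= 0.
  rewrite leNgt; apply/negP => P1.
  pose M := \sum_j `|w j| * u j ^+ 2.
  have M0 : 0 <= M by apply: sumr_ge0 => j _; rewrite mulr_ge0// exprn_ge0.
  pose t := 2 + M / Phi 1.
  have MP : 0 <= M / Phi 1 by apply: divr_ge0 => //; exact: ltW.
  have t1 : 1 < t by rewrite /t; lra.
  have := le_trans (Phi_le ltr01 t1) (Phi_infty (lt_trans ltr01 t1)).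
  rewrite -/M ler_pdivlMr ?(lt_trans ltr01 t1)// /t mulrDr mulrCA mulfV ?gt_eqF//.
  by rewrite mulr1; lra.
have [|c /andP[c0 c1]] := MVT_closed (@ltr01 R) (f := Phi) (df := fun t => - \sum_(j | j != j0) w j * u j / (u j + t)).
  by move=> x /andP[x0 _]; exact: is_derive_Phi.
rewrite sum_dd_ratio_frac// subr0 mulr1 => E.
have -> : \sum_j w j * u j * ln (u j) = - Phi 0.
  rewrite /Phi opprK (bigD1 j0)//= u0 mulr0 mul0r add0r.
  by apply: eq_bigr => j _; rewrite addr0.
apply: (@le_trans _ _ (Phi 1 - Phi 0)); last lra.
(* The increment over [0, 1] is the product at some c < 1, and each factor decreases in c. *)
rewrite E opprK; apply: ler_prod => j jj0; have uj := node_gt0 jj0.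
rewrite divr_ge0 ?addr_ge0//=.
by rewrite ler_wpM2l// lef_pV2 ?posrE; lra.
Qed.

End entropy_gap.

Lemma leq_sqr_fact (K a : nat) : (a <= K)%N ->
  (K`! * K`! <= (K - a)`! * (K + a)`!)%N.
Proof.
elim: a => [|a IH] aK; first by rewrite subn0 addn0.
rewrite (leq_trans (IH (ltnW aK)))// addnS (factS (K + a)).
have -> : (K - a = (K - a.+1).+1)%N by lia.
by rewrite factS -mulnA mulnCA leq_mul2l leq_mul2r; apply/orP; right; apply/orP; right; lia.
Qed.

(** * Weights of the square nodes, uniformly in [K] *)

Section nodes.
Variables (R : realType).

Let sq_factor (j i : nat) : R :=
  i.+1%:R ^+ 2 / `|j.+1%:R ^+ 2 - i.+1%:R ^+ 2|.

Let natF_neq0 n : n`!%:R != 0 :> R.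
Proof. by rewrite pnatr_eq0 -lt0n fact_gt0. Qed.

Let factSR n : n.+1`!%:R = n.+1%:R * n`!%:R :> R.
Proof. by rewrite factS natrM. Qed.

Let prod_sq_low j k : (k <= j)%N ->
  \prod_(0 <= i < k | i != j) sq_factor j i =
  k`!%:R ^+ 2 * (j - k)`!%:R * j.+1`!%:R / (j`!%:R * (j.+1 + k)`!%:R) :> R.
Proof.
elim: k => [|k IH] kj.
  by rewrite big_nil subn0 addn0 fact0 expr1n mul1r mulfV ?mulf_neq0.
rewrite big_mkcond big_nat_recr// -big_mkcond IH 1?ltnW// ltn_eqF//.
rewrite -[LHS]/(_ * sq_factor j k).
have -> : (j - k = (j - k.+1).+1)%N by lia.
rewrite addnS (factSR (j.+1 + k)) (factSR k) (factSR (j - k.+1)).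
have -> : sq_factor j k = k.+1%:R ^+ 2 / ((j - k.+1).+1%:R * (j.+1 + k).+1%:R).
  rewrite /sq_factor subr_sqr ger0_norm; last first.
    by rewrite mulr_ge0// subr_ge0 ler_nat ltnS ltnW.
  congr (_ / (_ * _)); last by rewrite -natrD; congr _%:R; lia.
  by rewrite -natrB; [congr _%:R; lia|lia].
move: (natF_neq0 (j.+1 + k)); set x0 := (j.+1 + k)`!%:R => x00.
move: (natF_neq0 (j - k.+1)); set x1 := (j - k.+1)`!%:R => x10.
move: (natF_neq0 (k)); set x2 := (k)`!%:R => x20.
move: (natF_neq0 (j.+1)); set x3 := (j.+1)`!%:R => x30.
move: (natF_neq0 (j)); set x4 := (j)`!%:R => x40.
have y00 : (j.+1 + k).+1%:R != 0 :> R by rewrite pnatr_eq0.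
set y0 := (j.+1 + k).+1%:R in y00 *.
have y10 : (j - k.+1).+1%:R != 0 :> R by rewrite pnatr_eq0.
set y1 := (j - k.+1).+1%:R in y10 *.
have y20 : (k).+1%:R != 0 :> R by rewrite pnatr_eq0.
set y2 := (k).+1%:R in y20 *.
clearbody x0 x1 x2 x3 x4 y0 y1 y2.
by field; rewrite ?x00 ?x10 ?x20 ?x30 ?x40 ?y00 ?y10 ?y20.
Qed.

(** Past the omitted index [j] the sign of j - i changes, so the induction restarts from
    [prod_sq_low] at [k = j]. *)
Let prod_sq_high j k : (j < k)%N ->
  \prod_(0 <= i < k | i != j) sq_factor j i =
  2 * k`!%:R ^+ 2 / ((k - j.+1)`!%:R * (k + j.+1)`!%:R) :> R.
Proof.
elim: k => // k IH jk; rewrite big_mkcond big_nat_recr// -big_mkcond.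
have [kj|kj] := eqVneq k j.
  rewrite -[LHS]/(_ * 1) mulr1.
  rewrite kj prod_sq_low// subnn subSS subnn fact0 mulr1.
  have -> : (j.+1 + j.+1 = (j.+1 + j).+1)%N by lia.
  rewrite (factSR (j.+1 + j)) (factSR j).
  move: (natF_neq0 (j.+1 + j)) (natF_neq0 j).
  have -> : (j.+1 + j).+1%:R = 2 * j.+1%:R :> R by rewrite -natrM; congr _%:R; lia.
  have : j.+1%:R != 0 :> R by rewrite pnatr_eq0.
  move: (_`!%:R) (_`!%:R) (j.+1%:R) => x y z z0 x0 y0.
  by field; rewrite ?x0 ?y0 ?z0.
have {jk kj}jk : (j < k)%N by lia.
rewrite IH// subSS -[LHS]/(_ * sq_factor j k).
have -> : (k - j = (k - j.+1).+1)%N by lia.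
rewrite addSn (factSR (k + j.+1)) (factSR k) (factSR (k - j.+1)).
have -> : sq_factor j k = k.+1%:R ^+ 2 / ((k - j.+1).+1%:R * (k + j.+1).+1%:R).
  rewrite /sq_factor distrC subr_sqr ger0_norm; last first.
    by rewrite mulr_ge0// subr_ge0 ler_nat ltnS ltnW.
  congr (_ / (_ * _)); last by rewrite -natrD; congr _%:R; lia.
  by rewrite -natrB; [congr _%:R; lia|lia].
move: (natF_neq0 (k + j.+1)); set x0 := (k + j.+1)`!%:R => x00.
move: (natF_neq0 (k - j.+1)); set x1 := (k - j.+1)`!%:R => x10.
move: (natF_neq0 (k)); set x2 := (k)`!%:R => x20.
have y00 : (k + j.+1).+1%:R != 0 :> R by rewrite pnatr_eq0.
set y0 := (k + j.+1).+1%:R in y00 *.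
have y10 : (k - j.+1).+1%:R != 0 :> R by rewrite pnatr_eq0.
set y1 := (k - j.+1).+1%:R in y10 *.
have y20 : (k).+1%:R != 0 :> R by rewrite pnatr_eq0.
set y2 := (k).+1%:R in y20 *.
clearbody x0 x1 x2 y0 y1 y2.
by field; rewrite ?x00 ?x10 ?x20 ?y00 ?y10 ?y20.
Qed.

(** The product equals 2 K!^2 / ((K - j - 1)! (K + j + 1)!), and [leq_sqr_fact] applies. Squares are
    chosen as nodes for the sake of this uniform bound. *)
Lemma prod_sq_le2 (K : nat) (j : 'I_K) :
  \prod_(i < K | i != j) (i.+1%:R ^+ 2 / `|j.+1%:R ^+ 2 - i.+1%:R ^+ 2|) <= 2 :> R.
Proof.
have := prod_sq_high (ltn_ord j); rewrite big_mkord => /= E.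
rewrite (_ : \prod_(i < K | _) _ = \prod_(i < K | i != j :> nat) sq_factor j i)//.
rewrite E ler_pdivrMr ?mulr_gt0 ?ltr0n ?fact_gt0// ler_pM2l//.
by rewrite -natrX -natrM ler_nat -mulnn leq_sqr_fact.
Qed.

Lemma sum_inv_sq_le2 (K : nat) : \sum_(i < K) (i.+1%:R ^+ 2)^-1 <= 2 :> R.
Proof.
(* Strengthened so that the induction telescopes: 1 / (x + 1)^2 <= 1 / x - 1 / (x + 1). *)
suff H : forall K, \sum_(i < K.+1) (i.+1%:R ^+ 2)^-1 <= 2 - K.+1%:R^-1 :> R.
  case: K => [|K]; first by rewrite big_ord0.
  by rewrite (le_trans (H K))// lerBlDr lerDl.
elim=> [|k IH]; first by rewrite big_ord1 expr1n !invr1; lra.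
rewrite big_ord_recr/= (le_trans (lerD IH (lexx _)))//.
have k0 : k.+1%:R > 0 :> R by [].
rewrite -lerBrDl (_ : _ - _ = k.+1%:R^-1 - k.+2%:R^-1); last by ring.
rewrite -(natr1 k.+1); set x := k.+1%:R in k0 *; clearbody x.
have x1 : x + 1 != 0 by lra.
rewrite (_ : x^-1 - _ = (x * (x + 1))^-1); last by field; rewrite ?x1 ?gt_eqF ?addr_gt0.
rewrite lef_pV2 ?posrE ?exprn_gt0 ?mulr_gt0 ?addr_gt0//.
by rewrite expr2 ler_wpM2r; lra.
Qed.

End nodes.

Section matching_nodes.
Variables (R : realType) (r K : nat).
Hypotheses (r0 : (0 < r)%N) (K0 : (0 < K)%N).

(* Square nodes balance [K] moments; the extra nodes in [0, 1/4] make the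
   weight of the node [j ^ 2] decay like [j ^ (- 2 r)]. *)
Definition node (x : 'I_r.+1 + 'I_K) : R :=
  match x with inl i => i%:R / (4 * r%:R) | inr j => j.+1%:R ^+ 2 end.

Let four_r : 0 < 4 * r%:R :> R.
Proof. by rewrite mulr_gt0// ltr0n. Qed.

Let small_node (i : 'I_r.+1) : 0 <= node (inl i) <= 4^-1.
Proof.
rewrite /= divr_ge0 ?(ltW four_r)//= ler_pdivrMr// mulKf// ler_nat.
by rewrite -ltnS ltn_ord.
Qed.

Let square_node (j : 'I_K) : 1 <= node (inr j).
Proof. by rewrite /= expr_ge1// ler1n. Qed.

Lemma node_inj : injective node.
Proof.
move=> [i|j] [i'|j'] /= E.
- congr inl; apply/val_inj => /=; move/mulIf: E => /(_ _)/eqP; rewrite eqr_nat.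
  by move=> /(_ _)/eqP; apply; rewrite invr_neq0 ?gt_eqF.
- by exfalso; have := small_node i; have := square_node j'; rewrite /= E; lra.
- by exfalso; have := small_node i'; have := square_node j; rewrite /= E; lra.
- congr inr; apply/val_inj => /=.
  by move/eqP: E; rewrite eqrXn2// eqr_nat => /eqP [].
Qed.

Lemma node_ge0 x : 0 <= node x.
Proof.
case: x => [i|j]; first by have /andP[] := small_node i.
exact: le_trans (square_node j).
Qed.

Lemma node_le x : node x <= K%:R ^+ 2.
Proof.
case: x => [i|j].
  have /andP[_ /le_trans] := small_node i; apply.
  have K1 : 1 <= K%:R ^+ 2 :> R by rewrite expr_ge1// ler1n.
  by rewrite (le_trans _ K1)//; lra.
by rewrite /= lerXn2r ?nnegrE// ler_nat.
Qed.

Lemma node0 : node (inl ord0) = 0. Proof. by rewrite /= mul0r. Qed.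

Let prod_ord_neq0 (f : 'I_r.+1 -> R) :
  \prod_(i | i != ord0) f i = \prod_(i < r) f (lift ord0 i).
Proof. by rewrite big_mkcond big_ord_recl/= mul1r. Qed.

Local Notation w := (dd_ratio node (inl ord0)).

Let prod_neq_base (f : 'I_r.+1 + 'I_K -> R) : \prod_(x | x != inl ord0) f x =
  (\prod_(i < r) f (inl (lift ord0 i))) * \prod_j f (inr j).
Proof. by rewrite big_sumType/= -(prod_ord_neq0 (fun i => f (inl i))). Qed.

Let normw x : `|w x| =
  \prod_(y | y != inl ord0) node y / \prod_(y | y != x) `|node x - node y|.
Proof.
rewrite /dd_ratio /dd_weight invrK normrM normfV !normr_prod mulrC.
congr (_ / _); apply: eq_bigr => y _.
by rewrite node0 sub0r normrN ger0_norm// node_ge0.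
Qed.

(** The factor x of the node itself cancels against its distance to the node 0. Each of the [r]
    positive small nodes contributes v / (x - v) <= 1 / x, as v <= 1/4 and x >= 1, and the other
    squares at most 2 in all. *)
Lemma norm_dd_ratio_square j : `|w (inr j)| <= 2 / (j.+1%:R ^+ 2) ^+ r.
Proof.
have /= x1 := square_node j; set x := _ ^+ 2 in x1 *; rewrite normw prod_neq_base.
have x0 : 0 < x by exact: lt_le_trans x1.
have -> : \prod_(y | y != inr j) `|node (inr j) - node y| =
    x * (\prod_(i < r) `|x - node (inl (lift ord0 i))|) *
      \prod_(i < K | i != j) `|x - i.+1%:R ^+ 2|.
  rewrite big_sumType; congr (_ * _); rewrite big_ord_recl node0 subr0.
  by rewrite ger0_norm// ltW.
rewrite (bigD1 j)//= -/x mulrCA -(mulrA x) -mulf_div mulfV ?gt_eqF// mul1r -mulf_div.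
rewrite -!prodf_div mulrC; apply: ler_pM.
- by apply: prodr_ge0 => i _; rewrite divr_ge0.
- by apply: prodr_ge0 => i _; rewrite divr_ge0// divr_ge0// ltW.
- exact: prod_sq_le2.
rewrite -exprVn -[X in _ ^+ X]card_ord -prodr_const.
apply: ler_prod => i _.
have /= := small_node (lift ord0 i); set v := _ / _ => /andP[v0 v4].
rewrite divr_ge0//= ler_pdivrMr; last by rewrite normr_gt0 gt_eqF//; lra.
by rewrite ger0_norm 1?mulrC ?ler_pdivlMr//; [nra|lra].
Qed.

(** (4 r)^r comes from the spacing 1 / (4 r) of the small nodes, and e from the squares: each factor
    x / (x - v) is at most exp (1 / (2 x)). *)
Definition small_weight_bound : R := (4 * r%:R) ^+ r * expR 1.

Lemma norm_dd_ratio_small i : `|w (inl i)| <= small_weight_bound.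
Proof.
rewrite normw prod_neq_base big_sumType/= -mulf_div; apply: ler_pM.
- by rewrite divr_ge0//; apply: prodr_ge0 => k _ //=; rewrite divr_ge0// ltW.
- by rewrite divr_ge0//; apply: prodr_ge0 => k _ //=; rewrite divr_ge0// ltW.
- have H : (4 * r%:R)^-1 ^+ r <= \prod_(k | inl k != inl i :> 'I_r.+1 + 'I_K)
      `|i%:R / (4 * r%:R) - k%:R / (4 * r%:R)| :> R.
    have -> : (4 * r%:R)^-1 ^+ r = \prod_(k : 'I_r.+1 | k != i) (4 * r%:R)^-1 :> R.
      rewrite prodr_const; congr (_ ^+ _).
      have := cardC (pred1 i); rewrite card1 card_ord => -[E]; rewrite -[LHS]E.
      by apply: eq_card.
    apply: ler_prod => k ki; rewrite invr_ge0 ltW//=.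
    rewrite -mulrBl normrM [`|_^-1|]ger0_norm ?invr_ge0 ?(ltW four_r)// ler_peMl// ?invr_ge0 ?(ltW four_r)//.
    have : (k : nat) != i by [].
    rewrite neq_ltn => /orP[] lt; rewrite ?(distrC i%:R).
      by rewrite distrC -natrB ?ger0_norm ?ler1n ?subn_gt0// ltnW.
    by rewrite -natrB ?ger0_norm ?ler1n ?subn_gt0// ltnW.
  rewrite ler_pdivrMr; last first.
    by apply: lt_le_trans H; rewrite exprn_gt0// invr_gt0.
  apply: (@le_trans _ _ 1).
    apply: prodr_ile1 => k _; have /= /andP[-> h] := small_node (lift ord0 k).
    by apply: (le_trans h); lra.
  rewrite (le_trans _ (ler_wpM2l _ H))// ?exprn_ge0 ?(ltW four_r)//.
  by rewrite -exprMn mulfV ?expr1n// gt_eqF.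
- rewrite -prodf_div.
  have /= /andP[v0 v4] := small_node i; set v := _ / _ in v0 v4 *.
  apply: (@le_trans _ _ (\prod_(j < K) expR (2^-1 * (j.+1%:R ^+ 2)^-1))).
    apply: ler_prod => j _; have /= x1 := square_node j; set x := _ ^+ 2 in x1 *.
    rewrite divr_ge0//=; last lra.
    have := expR_ge1Dx (2^-1 * x^-1); apply: le_trans.
    rewrite distrC ger0_norm; last lra.
    rewrite ler_pdivrMr; last lra.
    rewrite mulrDl mul1r mulrBr -mulrA mulVf ?gt_eqF//; last lra.
    have : x^-1 <= 1 by rewrite invf_le1//; lra.
    have : 0 <= x^-1 by rewrite invr_ge0; lra.
    by nra.
  rewrite -expR_sum ler_expR -mulr_sumr.
  by have := @sum_inv_sq_le2 R K; lra.
Qed.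

(** At a square x the term is at most 2 x^(q - r) <= 2 / x, which is summable; at a small node the
    power is at most 1. *)
Lemma norm_dd_ratio_moment q : (q < r)%N ->
  \sum_x `|w x| * node x ^+ q <= r.+1%:R * small_weight_bound + 4.
Proof.
move=> qr; rewrite big_sumType/=; apply: lerD.
  apply: (@le_trans _ _ (\sum_(i < r.+1) small_weight_bound)); last first.
    by rewrite sumr_const card_ord mulr_natl.
  apply: ler_sum => i _.
  have /= /andP[v0 v4] := small_node i.
  rewrite (le_trans _ (norm_dd_ratio_small i))// ler_piMr// exprn_ile1//; lra.
apply: (@le_trans _ _ (\sum_(j < K) 2 * (j.+1%:R ^+ 2)^-1)); last first.
  by rewrite -mulr_sumr; have := @sum_inv_sq_le2 R K; lra.
apply: ler_sum => j _; have /= x1 := square_node j.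
rewrite (le_trans (ler_wpM2r _ (norm_dd_ratio_square j)))// ?exprn_ge0//.
set x := _ ^+ 2 in x1 *.
have x0 : 0 < x by lra.
rewrite -mulrA ler_pM2l// mulrC ler_pdivrMr ?exprn_gt0//.
rewrite -(subnK qr) exprD exprS mulrCA mulKf ?gt_eqF//.
by rewrite ler_peMl ?exprn_ege1 ?exprn_ge0 ?ler1n ?(ltW x0).
Qed.

(** In the product of [entropy_gap] a positive small node gives at least 1 / (8 r), as v >= 1 / (4
    r) and v + 1 <= 2; a square x gives at least exp (- 1 / x), and these exponents sum to at least
    - 2. *)
Lemma dd_ratio_gap : ((8 * r%:R) ^+ r)^-1 * expR (- 2) <=
  \sum_x w x * node x * ln (node x).
Proof.
apply: le_trans (entropy_gap node_inj node0 node_ge0 _); last first.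
  by rewrite card_sum !card_ord; lia.
rewrite prod_neq_base; apply: ler_pM; rewrite ?invr_ge0 ?exprn_ge0 ?mulr_ge0 ?expR_ge0//.
  rewrite -exprVn -[X in _ ^+ X]card_ord -prodr_const.
  apply: ler_prod => i _; rewrite invr_ge0 mulr_ge0//=.
  have /= /andP[v0 v4] := small_node (lift ord0 i).
  have : (4 * r%:R)^-1 <= (bump 0 i)%:R / (4 * r%:R) :> R.
    by rewrite ler_peMl ?invr_ge0 ?(ltW four_r)// ler1n.
  set v := _ / _ in v0 v4 *.
  have -> : 8 * r%:R = 2 * (4 * r%:R) :> R by ring.
  rewrite invfM; have : 0 < (4 * r%:R)^-1 :> R by rewrite invr_gt0.
  set y := (4 * r%:R)^-1 => y0 yv.
  by rewrite ler_pdivlMr; [nra|lra].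
apply: (@le_trans _ _ (\prod_(j < K) expR (- (j.+1%:R ^+ 2)^-1))).
  rewrite -expR_sum ler_expR sumrN lerN2.
  exact: sum_inv_sq_le2.
apply: ler_prod => j _; rewrite expR_ge0/=; have /= x1 := square_node j.
set x := _ ^+ 2 in x1 *.
have x0 : 0 < x by lra.
rewrite expRN -[leRHS]invrK lef_pV2 ?posrE ?expR_gt0 ?invr_gt0 ?divr_gt0//; last lra.
by rewrite invfM invrK mulrC mulrDl mulfV ?gt_eqF// mul1r addrC addrC expR_ge1Dx.
Qed.

End matching_nodes.

Record matched_pair (R : realType) (J : finType) (u nu0 nu1 : J -> R)
    (K q : nat) (C gap : R) : Prop := MatchedPair {
  matched_ge0 : forall j, 0 <= u j ;
  matched_le : forall j, u j <= K%:R ^+ 2 ;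
  matched_nu0_ge0 : forall j, 0 <= nu0 j ;
  matched_nu1_ge0 : forall j, 0 <= nu1 j ;
  matched_nu0_sum : \sum_j nu0 j = 1 ;
  matched_nu1_sum : \sum_j nu1 j = 1 ;
  matched_moment : forall m, (m < K)%N ->
    \sum_j nu0 j * u j ^+ m = \sum_j nu1 j * u j ^+ m ;
  matched_nu0_bound : forall m, (m <= q)%N -> \sum_j nu0 j * u j ^+ m <= C ;
  matched_nu1_bound : forall m, (m <= q)%N -> \sum_j nu1 j * u j ^+ m <= C ;
  matched_gap : gap <= \sum_j (nu0 j - nu1 j) * (u j * ln (u j)) }.

(** The priors are twice the positive and negative parts of the weights, divided by their total
    variation [V]. Since [V] lies between 1, the weight of the node 0, and [B], neither the moment
    bound nor the gap depends on [K]. *)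
Lemma exists_matched_pair (R : realType) (q : nat) :
  exists C gap : R, 0 < gap /\ forall K, (0 < K)%N ->
  exists (J : finType) (u nu0 nu1 : J -> R), matched_pair u nu0 nu1 K q C gap.
Proof.
pose B : R := q.+2%:R * small_weight_bound R q.+1 + 4.
pose g : R := ((8 * q.+1%:R) ^+ q.+1)^-1 * expR (- 2).
have B0 : 0 < B by rewrite /B ltr_wpDl// !mulr_ge0 ?exprn_ge0 ?mulr_ge0// expR_ge0.
have g0 : 0 < g by rewrite /g mulr_gt0 ?expR_gt0// invr_gt0 exprn_gt0// mulr_gt0.
exists (2 * B), (2 * g / B); split; first by rewrite divr_gt0// mulr_gt0.
move=> K K0; pose u := @node R q.+1 K.
pose w := dd_ratio u (inl ord0).
have r0 : (0 < q.+1)%N by [].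
have u0 x : 0 <= u x := node_ge0 R r0 x.
pose V := \sum_x `|w x|.
have V1 : 1 <= V.
  rewrite /V (bigD1 (inl ord0))//= {1}/w /dd_ratio mulfV ?normr1 ?lerDl ?sumr_ge0//.
  rewrite invr_eq0; apply/prodf_neq0 => i i0.
  by rewrite subr_eq0 (inj_eq (node_inj _)) // eq_sym.
have VB : V <= B.
  rewrite /V (le_trans _ (norm_dd_ratio_moment R K r0 r0))//.
  by apply: ler_sum => x _; rewrite expr0 mulr1.
have V0 : 0 < V by lra.
have w0 m : (m < K)%N -> \sum_x w x * u x ^+ m = 0.
  move=> mK; apply: dd_ratio_exp; first exact: node_inj.
  by rewrite card_sum !card_ord addSn/=; lia.
have sw : \sum_x w x = 0.
  by rewrite -[RHS](w0 0 K0); apply: eq_bigr => x _; rewrite expr0 mulr1.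
pose nu (e : R) x := (`|w x| + e * w x) / V.
have nu_sum e (f : _ -> R) : \sum_x nu e x * f x =
    (\sum_x `|w x| * f x + e * \sum_x w x * f x) / V.
  rewrite mulr_sumr -big_split mulr_suml; apply: eq_bigr => x _ /=.
  by rewrite /nu; ring.
have nu_bound e m : `|e| <= 1 -> (m <= q)%N ->
    \sum_x nu e x * u x ^+ m <= 2 * B.
  move=> e1 mq; rewrite nu_sum ler_pdivrMr//.
  have M : \sum_x `|w x| * u x ^+ m <= B by apply: norm_dd_ratio_moment.
  have : e * \sum_x w x * u x ^+ m <= B.
    rewrite (le_trans (ler_norm _))// normrM (le_trans _ M)//.
    rewrite (le_trans (ler_wpM2r _ e1))// mul1r (le_trans (ler_norm_sum _ _ _))//.
    by apply: ler_sum => x _; rewrite normrM [X in _ * X]ger0_norm ?exprn_ge0.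
  move=> h; rewrite (le_trans (lerD M h))//.
  by rewrite (le_trans (_ : _ <= 2 * B * 1)) ?ler_wpM2l//; lra.
have sum1 : \sum_x `|w x| * 1 = V by apply: eq_bigr => x _; rewrite mulr1.
have sw1 : \sum_x w x * 1 = 0 by rewrite -[RHS]sw; apply: eq_bigr => x _; rewrite mulr1.
exists _, u, (nu 1), (nu (-1)); split.
- exact: u0.
- exact: node_le.
- by move=> x; rewrite /nu mul1r divr_ge0 ?(ltW V0)// -[X in _ + X]opprK subr_ge0 -normrN ler_norm.
- by move=> x; rewrite /nu mulN1r divr_ge0 ?(ltW V0)// subr_ge0 ler_norm.
- transitivity (\sum_x nu 1 x * 1); first by apply: eq_bigr => x _; rewrite mulr1.
  by rewrite nu_sum sum1 sw1 mulr0 addr0 mulfV ?gt_eqF.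
- transitivity (\sum_x nu (-1) x * 1); first by apply: eq_bigr => x _; rewrite mulr1.
  by rewrite nu_sum sum1 sw1 mulr0 addr0 mulfV ?gt_eqF.
- by move=> m mK; rewrite !nu_sum w0// !mulr0.
- by move=> m mq; apply: nu_bound; rewrite ?normr1.
- by move=> m mq; apply: nu_bound; rewrite ?normrN ?normr1.
have -> : \sum_x (nu 1 x - nu (-1) x) * (u x * ln (u x)) =
    2 * (\sum_x w x * u x * ln (u x)) / V.
  rewrite mulr_sumr mulr_suml; apply: eq_bigr => x _.
  by rewrite /nu; ring.
have G : g <= \sum_x w x * u x * ln (u x) by apply: dd_ratio_gap.
apply: ler_pM; rewrite ?ler_pM2l ?invr_ge0 ?mulr_ge0 ?(ltW g0) ?(ltW B0)//.
by rewrite lef_pV2.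
Qed.

(** * Exchanging the priors *)

Section product_prior.
Variables (R : realType) (I J : finType).
Implicit Types (rho sigma : I -> J -> R) (F G : {ffun I -> J} -> R).

(** An expectation over independent coordinates when each [rho i] is a probability. Signed weights
    are allowed as well, for differences of priors and for the expansion [pexp_line]. *)
Definition pexp rho F : R := \sum_(w : {ffun I -> J}) (\prod_i rho i (w i)) * F w.

Definition pprob rho (A : pred {ffun I -> J}) : R := pexp rho (fun w => (A w)%:R).

Lemma eq_pexp rho F G : F =1 G -> pexp rho F = pexp rho G.
Proof. by move=> FG; apply: eq_bigr => w _; rewrite FG. Qed.

Lemma eq_pexpl rho sigma F : (forall i, rho i =1 sigma i) ->
  pexp rho F = pexp sigma F.
Proof.
move=> rs; apply: eq_bigr => w _; congr (_ * _).
by apply: eq_bigr => i _; exact: rs.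
Qed.

Lemma pexp_sum rho (T : Type) (r : seq T) (P : pred T) (F : T -> {ffun I -> J} -> R) :
  pexp rho (fun w => \sum_(k <- r | P k) F k w) =
  \sum_(k <- r | P k) pexp rho (F k).
Proof. by rewrite /pexp exchange_big; apply: eq_bigr => w _; rewrite mulr_sumr. Qed.

Lemma pexpD rho F G : pexp rho (fun w => F w + G w) = pexp rho F + pexp rho G.
Proof. by rewrite /pexp -big_split; apply: eq_bigr => w _; rewrite mulrDr. Qed.

Lemma pexpB rho F G : pexp rho (fun w => F w - G w) = pexp rho F - pexp rho G.
Proof. by rewrite /pexp -sumrB; apply: eq_bigr => w _; rewrite mulrBr. Qed.

Lemma pexpZ rho c F : pexp rho (fun w => c * F w) = c * pexp rho F.
Proof. by rewrite /pexp mulr_sumr; apply: eq_bigr => w _; rewrite mulrCA. Qed.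

Lemma pexp_prod rho (phi : I -> J -> R) :
  pexp rho (fun w => \prod_i phi i (w i)) = \prod_i \sum_y rho i y * phi i y.
Proof.
by rewrite bigA_distr_bigA; apply: eq_bigr => w _; rewrite -big_split.
Qed.

Lemma norm_pexp_le rho F c : (forall w, `|F w| <= c) ->
  `|pexp rho F| <= c * \prod_i \sum_y `|rho i y|.
Proof.
move=> Fc; rewrite (le_trans (ler_norm_sum _ _ _))//.
rewrite bigA_distr_bigA mulr_sumr; apply: ler_sum => w _.
by rewrite normrM normr_prod mulrC ler_wpM2r// prodr_ge0.
Qed.

Lemma pexp_ge0 rho F : (forall i y, 0 <= rho i y) -> (forall w, 0 <= F w) ->
  0 <= pexp rho F.
Proof.
by move=> r0 F0; apply: sumr_ge0 => w _; rewrite mulr_ge0// prodr_ge0.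
Qed.

Lemma ler_pexp rho F G : (forall i y, 0 <= rho i y) -> (forall w, F w <= G w) ->
  pexp rho F <= pexp rho G.
Proof.
by move=> r0 FG; apply: ler_sum => w _; rewrite ler_wpM2l// prodr_ge0.
Qed.

Definition upd (w : {ffun I -> J}) (t : I) (y : J) : {ffun I -> J} :=
  [ffun i => if i == t then y else w i].

Lemma upd_id w t y : upd w t y t = y. Proof. by rewrite ffunE eqxx. Qed.

Lemma upd_neq w t y i : i != t -> upd w t y i = w i.
Proof. by move=> /negbTE it; rewrite ffunE it. Qed.

Lemma sum_upd (t : I) F :
  \sum_w \sum_(y : J) F (upd w t y) = #|J|%:R * \sum_w F w.
Proof.
rewrite mulr_natl -sumr_const exchange_big/=.
rewrite [RHS](eq_bigl xpredT)// !pair_big/=.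
(* Swapping the new value with the old one at [t] is an involution, so each configuration is counted
   [#|J|] times. *)
pose h (p : J * {ffun I -> J}) := (p.2 t, upd p.2 t p.1).
have hK : involutive h.
  move=> [y w]; rewrite /h /= upd_id; congr (_, _); apply/ffunP => i.
  by rewrite !ffunE; case: eqVneq => [->|].
rewrite (reindex_inj (inv_inj hK)) /=; apply: eq_bigr => -[y w] _ /=.
congr F; apply/ffunP => i; rewrite !ffunE; by case: eqVneq => [->|].
Qed.

(** Given the other coordinates, [G] is constant and the mean over the coordinate [t] is 0.
    Resampling that coordinate through [sum_upd] carries out the conditioning. *)
Lemma pexp_coord0 rho t (phi : J -> R) G :
  (forall w y, G (upd w t y) = G w) -> \sum_y rho t y * phi y = 0 ->
  pexp rho (fun w => phi (w t) * G w) = 0.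
Proof.
move=> Gt phi0.
have [J0|J0] := posnP #|J|.
  by rewrite /pexp big1// => w _; have := fintype0 (w t); rewrite J0.
have : #|J|%:R * pexp rho (fun w => phi (w t) * G w) = 0.
  rewrite -(sum_upd t); apply: big1 => w _.
  transitivity ((\prod_(i | i != t) rho i (w i)) * G w * \sum_y rho t y * phi y).
    rewrite mulr_sumr; apply: eq_bigr => y _.
    rewrite (bigD1 t)//= upd_id Gt (eq_bigr (fun i => rho i (w i))); first by ring.
    by move=> i it; rewrite upd_neq.
  by rewrite phi0 mulr0.
by move/eqP; rewrite mulf_eq0 pnatr_eq0 -[#|J| == 0%N]negbK -lt0n J0 /= => /eqP.
Qed.

Lemma pexp_diff rho sigma t G : (forall i, i != t -> rho i =1 sigma i) ->
  pexp rho G - pexp sigma G =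
  pexp (fun i y => if i == t then rho i y - sigma i y else rho i y) G.
Proof.
move=> rs; rewrite /pexp -sumrB; apply: eq_bigr => w _.
rewrite -mulrBl; congr (_ * _).
rewrite (bigD1 t)//= [X in _ - X](bigD1 t)//= [RHS](bigD1 t)//= eqxx mulrBl.
congr (_ * _ - _ * _); apply: eq_bigr => i it; rewrite (negbTE it)//.
by rewrite rs.
Qed.

Section independence.
Variable rho : I -> J -> R.
Hypothesis rho1 : forall i, \sum_y rho i y = 1.
Hypothesis rho0 : forall i y, 0 <= rho i y.

Lemma pexp1 : pexp rho (fun=> 1) = 1.
Proof.
transitivity (pexp rho (fun w => \prod_(i : I) 1)).
  by apply: eq_pexp => w; rewrite big1.
rewrite (pexp_prod rho (fun _ _ => 1)) big1// => i _; rewrite -[RHS](rho1 i).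
by apply: eq_bigr => y _; rewrite mulr1.
Qed.

Lemma pexp_coord (t : I) (phi : J -> R) :
  pexp rho (fun w => phi (w t)) = \sum_y rho t y * phi y.
Proof.
transitivity (pexp rho (fun w => \prod_i (if i == t then phi (w i) else 1))).
  by apply: eq_pexp => w; rewrite -big_mkcond big_pred1_eq.
rewrite (pexp_prod rho (fun i y => if i == t then phi y else 1)).
rewrite (bigD1 t)//= [X in _ * X]big1 ?mulr1; first by rewrite eqxx.
move=> i /negbTE it; by rewrite -[RHS](rho1 i); apply: eq_bigr => y _; rewrite it mulr1.
Qed.

Lemma pexp_sqr_sum (f : I -> J -> R) : (forall i, \sum_y rho i y * f i y = 0) ->
  pexp rho (fun w => (\sum_i f i (w i)) ^+ 2) = \sum_i \sum_y rho i y * f i y ^+ 2.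
Proof.
move=> f0.
under eq_pexp do rewrite expr2 mulr_suml.
rewrite pexp_sum; apply: eq_bigr => i _.
under eq_pexp do rewrite mulr_sumr.
rewrite pexp_sum (bigD1 i)//= big1 ?addr0; last first.
  move=> j ji; apply: pexp_coord0 (f0 i) => w y; rewrite upd_neq//.
under eq_pexp do rewrite -expr2.
exact: (pexp_coord i (fun y => f i y ^+ 2)).
Qed.

Lemma pprob_chebyshev (f : I -> J -> R) (v tau : R) (A : pred {ffun I -> J}) :
  (forall i, \sum_y rho i y * f i y = 0) ->
  (forall i, \sum_y rho i y * f i y ^+ 2 <= v) -> 0 < tau ->
  (forall w, A w -> tau <= `|\sum_i f i (w i)|) ->
  pprob rho A <= #|I|%:R * v / tau ^+ 2.
Proof.
move=> f0 fv tau0 At.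
rewrite ler_pdivlMr ?exprn_gt0// mulrC -pexpZ.
apply: (@le_trans _ _ (pexp rho (fun w => (\sum_i f i (w i)) ^+ 2))).
  apply: ler_pexp => // w; have [Aw|_] := boolP (A w); last by rewrite mulr0 sqr_ge0.
  by rewrite mulr1 -[leRHS]real_normK ?num_real// lerXn2r ?nnegrE ?(ltW tau0)// At.
rewrite pexp_sqr_sum// mulr_natl -sumr_const; apply: ler_sum => i _.
exact: fv.
Qed.

Lemma pprob_chebyshev_mean (f : I -> J -> R) (v tau : R) (A : pred {ffun I -> J}) :
  (forall i, \sum_y rho i y * f i y ^+ 2 <= v) -> 0 < tau ->
  (forall w, A w ->
    tau <= `|\sum_i f i (w i) - \sum_i \sum_y rho i y * f i y|) ->
  pprob rho A <= #|I|%:R * v / tau ^+ 2.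
Proof.
move=> fv tau0 At; pose m i := \sum_y rho i y * f i y.
apply: (@pprob_chebyshev (fun i y => f i y - m i)) => //.
- move=> i; under eq_bigr do rewrite mulrBr.
  by rewrite sumrB -mulr_suml rho1 mul1r subrr.
- move=> i; apply: le_trans (fv i).
  apply: (@le_trans _ _ (\sum_y rho i y * f i y ^+ 2 - m i ^+ 2)).
    rewrite le_eqVlt; apply/orP; left; apply/eqP.
    transitivity (\sum_y (rho i y * f i y ^+ 2 - 2 * m i * (rho i y * f i y)
        + m i ^+ 2 * rho i y)); first by apply: eq_bigr => y _; ring.
    by rewrite big_split sumrB -!mulr_sumr rho1 -/(m i)/=; ring.
  by rewrite lerBlDr lerDl sqr_ge0.
- by move=> w /At; rewrite sumrB.
Qed.

Lemma pprobU (A B : pred {ffun I -> J}) :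
  pprob rho (predU A B) <= pprob rho A + pprob rho B.
Proof.
rewrite -pexpD; apply: ler_pexp => // w /=.
by case: (A w); case: (B w) => /=; rewrite ?addr0 ?add0r ?lexx ?lerDl.
Qed.

Lemma pprob_le (A B : pred {ffun I -> J}) : (forall w, A w -> B w) ->
  pprob rho A <= pprob rho B.
Proof.
move=> AB; apply: ler_pexp => // w.
by have [/AB ->|_] := boolP (A w); rewrite ?lexx ?ler0n.
Qed.

End independence.
End product_prior.

(** A Chernoff bound: theta^(|D| - K) is at least 1 on the sum, and the sum of (z theta)^|D| over
    all subsets is (1 + z theta)^n. *)
Lemma sum_exp_card_ge (R : realType) (n K : nat) (z theta : R) :
  0 <= z -> 1 <= theta ->
  \sum_(D : {set 'I_n} | (K <= #|D|)%N) z ^+ #|D| <=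
  theta ^- K * expR (n%:R * (z * theta)).
Proof.
move=> z0 th1; have th0 : 0 < theta by lra.
rewrite mulrC ler_pdivlMr ?exprn_gt0// mulr_suml expRM_natl.
apply: (@le_trans _ _ (\prod_(i < n) (z * theta + 1))); last first.
  rewrite prodr_const card_ord lerXn2r ?nnegrE ?expR_ge0//.
    by rewrite addr_ge0// mulr_ge0// ltW.
  by rewrite addrC expR_ge1Dx.
rewrite bigA_distr big_mkcond; apply: ler_sum => D _.
have -> : \prod_i (if i \in D then z * theta else 1) = (z * theta) ^+ #|D|.
  by rewrite -big_mkcond prodr_const.
case: ifPn => KD; last by rewrite exprn_ge0// mulr_ge0// ltW.
by rewrite exprMn ler_wpM2l ?exprn_ge0// ler_weXn2l.
Qed.

(** [D] collects the observations for which the increment [delta] is chosen: along an affine path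
    the product law is a polynomial in [y], graded by [#|D|]. *)
Lemma pexp_line (R : realType) (O : finType) (n : nat) (A delta : O -> R) (y : R)
    (kappa : {ffun 'I_n -> O} -> R) :
  pexp (fun _ o => y * delta o + A o) kappa =
  \sum_(D : {set 'I_n}) y ^+ #|D| *
    pexp (fun l o => if l \in D then delta o else A o) kappa.
Proof.
rewrite /pexp; under eq_bigr do rewrite bigA_distr mulr_suml.
rewrite exchange_big; apply: eq_bigr => D _; rewrite mulr_sumr.
apply: eq_bigr => c _; rewrite mulrA; congr (_ * _).
rewrite -prodr_const [X in X * _]big_mkcond -big_split; apply: eq_bigr => l _ /=.
by case: ifP => _; rewrite ?mul1r.
Qed.

Lemma sum_option (V : nmodType) (I : finType) (f : option I -> V) :
  \sum_o f o = f None + \sum_i f (Some i).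
Proof.
rewrite (bigD1 None)//=; congr (_ + _).
rewrite (reindex_omap Some id) => [|[i|]//]; apply: eq_bigl => i /=.
by rewrite eqxx.
Qed.

(** * One-cell exchanges under the constraint of total mass 1 *)

Section fuzzy_hypotheses.
Variables (R : realType) (I J : finType) (n : nat).
Variables (u nu0 nu1 g : J -> R) (K q : nat) (C gap a T eta : R).
Variable kappa : {ffun 'I_n -> option I} -> R.
Hypothesis matched : matched_pair u nu0 nu1 K q C gap.
Hypothesis kappa01 : forall c, 0 <= kappa c <= 1.
Hypothesis a_ge0 : 0 <= a.
Hypothesis g_ge0 : forall j, 0 <= g j.

(** [None] is the large bump. Its mass is only the remainder and becomes negative when the draw is
    too large, hence the restriction to [tame] draws. *)
Definition masses (w : {ffun I -> J}) (o : option I) : R :=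
  if o is Some i then a * u (w i) else 1 - a * \sum_i u (w i).

(** Later [g] is a power of [u], so that one event controls both the sign of the remaining mass and,
    for finite p, the Lipschitz norm. *)
Definition tame (w : {ffun I -> J}) : bool := \sum_i g (w i) <= T.

Let tame_but (t : I) (w : {ffun I -> J}) : bool := \sum_(i | i != t) g (w i) <= T.

Hypothesis room : forall t w, tame_but t w ->
  a * (\sum_(i | i != t) u (w i) + K%:R ^+ 2) <= 1.

Hypothesis tame_prob : forall rho : I -> J -> R,
  (forall i, rho i = nu0 \/ rho i = nu1) -> pprob rho (predC tame) <= eta.

(** [kappa c] stands for the probability that a test accepts when each observation [l] is drawn from
    the bump [c l]; averaging over the labels gives its acceptance probability under the mixture. *)
Definition mixture_prob (w : {ffun I -> J}) : R :=
  pexp (fun=> masses w) kappa.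

Definition tame_mixture (w : {ffun I -> J}) : R :=
  (tame w)%:R * mixture_prob w.

Lemma masses_sum w : \sum_o masses w o = 1.
Proof. by rewrite sum_option/= -mulr_sumr subrK. Qed.

Let u_ge0 := matched_ge0 matched.

Let masses_ge0 t w o : tame_but t w -> 0 <= masses w o.
Proof.
move=> /room h; case: o => [i|] /=; first by rewrite mulr_ge0.
rewrite subr_ge0 (le_trans _ h)// ler_wpM2l// (bigD1 t)//= addrC lerD2l.
exact: matched_le matched _.
Qed.

Let mixture_prob_01 t w : tame_but t w -> 0 <= mixture_prob w <= 1.
Proof.
move=> tw; rewrite pexp_ge0/=; last 2 first.
- by move=> _ o; exact: masses_ge0 tw.
- by move=> c; have /andP[] := kappa01 c.
rewrite (le_trans (ler_norm _))//.
have k1 c : `|kappa c| <= 1 by have /andP[k0 k1] := kappa01 c; rewrite ger0_norm.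
rewrite (le_trans (norm_pexp_le _ k1))// mul1r big1// => _ _.
by rewrite -[RHS](masses_sum w); apply: eq_bigr => o _; rewrite ger0_norm// (masses_ge0 _ tw).
Qed.

Lemma tame_tame_but t w : tame w -> tame_but t w.
Proof.
rewrite /tame /tame_but (bigD1 t)//=; apply: le_trans.
by rewrite lerDr.
Qed.

Lemma mixture_prob_tame (t : I) w : tame w -> 0 <= mixture_prob w <= 1.
Proof. by move/(tame_tame_but t)/mixture_prob_01. Qed.

(** 2 is the total variation of [shift_mass], and [a * K%:R ^+ 2] bounds the mass of a cell. *)
Let tail := \sum_(D : {set 'I_n} | (K <= #|D|)%N) (2 * (a * K%:R ^+ 2)) ^+ #|D|.

Let rest (t : I) (w : {ffun I -> J}) (o : option I) : R :=
  if o is Some i then (if i == t then 0 else a * u (w i))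
  else 1 - a * \sum_(i | i != t) u (w i).

Let shift_mass (t : I) (o : option I) : R :=
  if o is Some i then (i == t)%:R else -1.

Let masses_line (t : I) (w : {ffun I -> J}) o : masses w o = a * u (w t) * shift_mass t o + rest t w o.
Proof.
case: o => [i|] /=; first by case: eqVneq => [->|_]; rewrite ?mulr1 ?addr0 ?mulr0 ?add0r.
by rewrite (bigD1 t)//=; ring.
Qed.

Let rest_abs t w : tame_but t w -> \sum_o `|rest t w o| = 1.
Proof.
move=> /room h; rewrite sum_option/= ger0_norm; last first.
  by rewrite subr_ge0 (le_trans _ h)// ler_wpM2l// lerDl sqr_ge0.
rewrite [X in _ + X](bigD1 t)//= eqxx normr0 add0r mulr_sumr addrAC -addrA -sumrB big1 ?addr0//.
by move=> i it; rewrite (negbTE it) ger0_norm ?subrr// mulr_ge0.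
Qed.

Let shift_abs (t : I) : \sum_o `|shift_mass t o| = 2.
Proof.
rewrite sum_option/= normrN1 (bigD1 t)//= eqxx normr1 big1 ?addr0//.
by move=> i /negbTE ->; rewrite normr0.
Qed.

Let rest_upd t w y : rest t (upd w t y) =1 rest t w.
Proof.
case=> [i|] /=; first by case: eqVneq => // it; rewrite upd_neq.
by congr (_ - _ * _); apply: eq_bigr => i it; rewrite upd_neq.
Qed.

Let tame_but_upd t w y : tame_but t (upd w t y) = tame_but t w.
Proof.
by rewrite /tame_but; congr (_ <= _); apply: eq_bigr => i it; rewrite upd_neq.
Qed.

(** Degrees below [K] in the mass of the cell [t] cancel by the matched moments. For a set [D] of
    higher degree, the [#|D|] increments and the powers of the mass give (2 a K^2)^|D|, the other
    observations total mass 1, and the difference of the priors a factor 2. *)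
Lemma swap_one t (rho sigma : I -> J -> R) :
  (forall i, rho i = nu0 \/ rho i = nu1) -> (forall i, sigma i = nu0 \/ sigma i = nu1) ->
  (forall i, i != t -> rho i = sigma i) -> rho t = nu0 -> sigma t = nu1 ->
  `|pexp rho tame_mixture - pexp sigma tame_mixture| <= 2 * tail + eta.
Proof.
move=> rho01 sigma01 rs rt st; pose F := tame_mixture.
have prior_ge0 (r : I -> J -> R) : (forall i, r i = nu0 \/ r i = nu1) ->
    forall i y, 0 <= r i y.
  move=> r01 i y; have [->|->] := r01 i.
  - exact: matched_nu0_ge0 matched _.
  - exact: matched_nu1_ge0 matched _.
(* [tame_but t], unlike [tame], does not depend on the cell [t]: this is what
   lets the moments of order below [K] cancel, at the price of [eta]. *)
pose F1 w := (tame_but t w)%:R * mixture_prob w.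
pose F2 w := (tame_but t w && ~~ tame w)%:R * mixture_prob w.
have FE w : F w = F1 w - F2 w.
  rewrite /F /tame_mixture /F1 /F2 -mulrBl; congr (_ * _).
  have := @tame_tame_but t w; case: (tame w); case: (tame_but t w) => //=;
    rewrite ?subr0 ?subrr// => /(_ isT)//.
have F2b (r : I -> J -> R) : (forall i, r i = nu0 \/ r i = nu1) ->
    0 <= pexp r F2 <= eta.
  move=> r01; apply/andP; split.
    apply: pexp_ge0; first exact: prior_ge0.
    move=> w; rewrite /F2; have [/= tw|] := boolP (tame_but t w); last by rewrite mul0r.
    by have /andP[m0 _] := mixture_prob_01 tw; rewrite mulr_ge0.
  apply: le_trans (tame_prob r01); apply: ler_pexp; first exact: prior_ge0.
  move=> w; rewrite /F2 /=; have [/= tw|_] := boolP (tame_but t w); last by rewrite mul0r ler0n.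
  by have /andP[_ m1] := mixture_prob_01 tw; rewrite ler_piMr.
rewrite !(eq_pexp _ FE) !pexpB.
have -> : pexp rho F1 - pexp rho F2 - (pexp sigma F1 - pexp sigma F2) =
  (pexp rho F1 - pexp sigma F1) - (pexp rho F2 - pexp sigma F2) by ring.
(* Both corrections lie in [0, eta], so their difference costs [eta] once and not twice. *)
rewrite (le_trans (ler_normB _ _))//; apply: lerD; last first.
  have /andP[? ?] := F2b _ rho01; have /andP[? ?] := F2b _ sigma01.
  by rewrite ler_norml; lra.
rewrite (@pexp_diff _ _ _ _ _ t); last by move=> i it; rewrite rs.
set tau := (fun i y => _).
pose H (D : {set 'I_n}) w : R := (tame_but t w)%:R *
  pexp (fun l o => if l \in D then shift_mass t o else rest t w o) kappa.
have F1E w : F1 w = \sum_(D : {set 'I_n}) (a * u (w t)) ^+ #|D| * H D w.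
  rewrite /F1 /mixture_prob (eq_pexpl _ (fun _ => masses_line t w)) pexp_line.
  by rewrite mulr_sumr; apply: eq_bigr => D _; rewrite mulrCA.
have tau_abs : \prod_i \sum_y `|tau i y| <= 2.
  rewrite (bigD1 t)//= [X in _ * X]big1 ?mulr1; last first.
    move=> i it; rewrite /tau (negbTE it).
    rewrite (eq_bigr (rho i)) => [|y _]; last by rewrite ger0_norm ?prior_ge0.
    by have [->|->] := rho01 i; [exact: matched_nu0_sum matched|exact: matched_nu1_sum matched].
  rewrite /tau eqxx rt st.
  rewrite (le_trans (ler_sum _ (fun y _ => ler_normB _ _)))// big_split/=.
  rewrite (eq_bigr nu0) => [|y _]; last by rewrite ger0_norm// (matched_nu0_ge0 matched).
  rewrite [X in _ + X](eq_bigr nu1) => [|y _]; last by rewrite ger0_norm// (matched_nu1_ge0 matched).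
  by rewrite (matched_nu0_sum matched) (matched_nu1_sum matched).
rewrite (eq_pexp _ F1E) pexp_sum (bigID (fun D : {set 'I_n} => (K <= #|D|)%N))/=.
rewrite [X in _ + X]big1 ?addr0; last first.
  move=> D; rewrite -ltnNge => DK.
  apply: (@pexp_coord0 _ _ _ tau t (fun y => (a * u y) ^+ #|D|)).
    move=> w y; rewrite /H tame_but_upd; congr (_ * _).
    by apply: eq_pexpl => l o; rewrite rest_upd.
  rewrite /tau eqxx rt st.
  under eq_bigr do rewrite exprMn mulrCA mulrBl.
  rewrite -mulr_sumr sumrB (matched_moment matched)// subrr mulr0//.
rewrite (le_trans (ler_norm_sum _ _ _))// mulr_sumr; apply: ler_sum => D KD.
apply: le_trans (@norm_pexp_le _ _ _ tau _ ((2 * (a * K%:R ^+ 2)) ^+ #|D|) _) _.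
  move=> w; rewrite normrM [leRHS]exprMn mulrC; apply: ler_pM => //.
    rewrite /H; have [tw|_] := boolP (tame_but t w); last by rewrite mul0r normr0 exprn_ge0.
    rewrite mul1r (le_trans (@norm_pexp_le _ _ _ _ _ 1 _))//.
      by move=> c; have /andP[k0 k1] := kappa01 c; rewrite ger0_norm.
    rewrite mul1r -prodr_const [X in _ <= X]big_mkcond/=.
    apply: ler_prod => l _; rewrite sumr_ge0//=.
    by case: ifP => _; rewrite ?shift_abs// rest_abs.
  have au : 0 <= a * u (w t) by rewrite mulr_ge0.
  rewrite normrX ger0_norm// lerXn2r ?nnegrE//; first by rewrite mulr_ge0// sqr_ge0.
  by rewrite ler_wpM2l// (matched_le matched).
by rewrite mulrC ler_wpM2r// exprn_ge0// !mulr_ge0// sqr_ge0.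
Qed.

(** A hybrid argument: under [rho m] the first [m] cells follow [nu0] and the others [nu1], and
    consecutive hybrids differ in one cell. These hybrids are the reason why [tame_prob] speaks of
    mixed priors. *)
Lemma mixture_prob_close :
  `|pexp (fun=> nu0) tame_mixture - pexp (fun=> nu1) tame_mixture| <= #|I|%:R * (2 * tail + eta).
Proof.
pose F := tame_mixture; pose rho m (i : I) := if (enum_rank i < m)%N then nu0 else nu1.
have -> : pexp (fun=> nu0) F = pexp (rho #|I|) F.
  by apply: eq_pexpl => i y; rewrite /rho ltn_ord.
have -> : pexp (fun=> nu1) F = pexp (rho 0%N) F by exact: eq_pexpl.
rewrite -(telescope_sumr (fun m => pexp (rho m) F))// big_mkord.
rewrite (le_trans (ler_norm_sum _ _ _))// mulr_natl -[X in _ *+ X]card_ord -sumr_const.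
apply: ler_sum => m _; pose t := enum_val (cast_ord (esym erefl) m).
have tm : enum_rank t = m :> nat by rewrite /t enum_valK.
have rho01 k i : rho k i = nu0 \/ rho k i = nu1.
  by rewrite /rho; case: ifP; [left|right].
apply: (@swap_one t) => //.
- move=> i it; rewrite /rho ltnS leq_eqVlt.
  case: eqVneq => //= im; case/eqP: it.
  by apply: enum_rank_inj; apply/val_inj; rewrite /= tm im.
- by rewrite /rho tm ltnSn.
- by rewrite /rho tm ltnn.
Qed.

End fuzzy_hypotheses.

(** * Mixtures of smooth bumps *)

Section smooth_bump.
Variable R : realType.
Implicit Types (x y delta : R) (a b j k : nat).

(* [posX 0] is the constant 1, also on the negative axis. *)
Definition posX a x : R := Num.max x 0 ^+ a.

Lemma posX_ge0 a x : 0 <= posX a x.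
Proof. by rewrite exprn_ge0// le_max lexx orbT. Qed.

(** The exponent is at least 2, so the difference quotient at 0 is at most |h| for small h. *)
Lemma is_derive_posX a x : is_derive x 1 (posX a.+2) (a.+2%:R * posX a.+1 x).
Proof.
have [x0|x0|->] := ltgtP x 0.
- have -> : a.+2%:R * posX a.+1 x = 0.
    by rewrite /posX max_r ?expr0n ?mulr0// ltW.
  apply: (near_eq_is_derive (f := cst 0)).
  near=> y; rewrite /posX max_r ?expr0n//.
  by apply: ltW; near: y; exact: lt_nbhsl.
- have -> : a.+2%:R * posX a.+1 x = (a.+2%:R * x ^+ a.+1) *: (1 : R).
    by rewrite /posX max_l ?ltW// [RHS]mulr1.
  apply: (near_eq_is_derive (f := (id : R -> R) ^+ a.+2)).
  near=> y; rewrite exprfctE /posX max_l//.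
  by apply: ltW; near: y; exact: lt_nbhsr.
have -> : a.+2%:R * posX a.+1 0 = 0 :> R by rewrite /posX maxxx expr0n mulr0.
have H : (fun h : R => h^-1 *: ((posX a.+2 \o shift 0) (h *: 1) - posX a.+2 0))
    @ 0^' --> (0 : R).
  apply/cvgrPdist_le => e e0; near=> h.
  rewrite sub0r normrN /= addr0 [h *: 1]mulr1.
  rewrite {2}/posX maxxx expr0n subr0 /posX normrM normfV.
  have h0 : h != 0 by near: h; exact: nbhs_dnbhs_neq.
  rewrite mulrC ler_pdivrMr ?normr_gt0//.
  have m0 : `|Num.max h 0| <= `|h|.
    by case: (leP h 0) => // hle; rewrite normr0.
  rewrite normrX exprS mulrC; apply: ler_pM; rewrite ?exprn_ge0//.
  have he : `|h| <= e.
    by near: h; apply: dnbhs0_le.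
  have h1 : `|h| <= 1.
    by near: h; apply: dnbhs0_le.
  rewrite (le_trans _ he)// (le_trans _ m0)// exprS ler_piMr//.
  by rewrite exprn_ile1// (le_trans m0).
by split; [apply/cvg_ex; exists 0|exact/cvg_lim].
Unshelve. all: by end_near. Qed.

(** For positive exponents, x^a (1 - x)^b cut off to [0, 1]. It has finite smoothness only, but
    differentiation stays within the family, which drives [fdiff_bump1]. *)
Definition bump1 a b x : R := posX a x * posX b (1 - x).

Lemma is_derive_bump1 a b x : is_derive x 1 (bump1 a.+2 b.+2)
  (a.+2%:R * bump1 a.+1 b.+2 x - b.+2%:R * bump1 a.+2 b.+1 x).
Proof.
have d1 := is_derive_posX a x.
have d2 : is_derive x 1 (fun y => posX b.+2 (1 - y)) (b.+2%:R * posX b.+1 (1 - x) * (- 1)).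
  apply: (@is_derive1_comp R (posX b.+2) (fun y => 1 - y)); first exact: is_derive_posX.
  rewrite -[X in is_derive _ _ _ X]sub0r.
  have := @is_deriveB R R R (cst 1) id x 1 0 1 (is_derive_cst _ _ _) (is_derive_id _ _).
  by [].
have := is_deriveM d1 d2; rewrite (_ : posX _ * _ = bump1 a.+2 b.+2)//.
by rewrite (_ : _ *: _ + _ = a.+2%:R * bump1 a.+1 b.+2 x - b.+2%:R * bump1 a.+2 b.+1 x)// /bump1 /GRing.scale/=; ring.
Qed.

Lemma bump1_ge0 a b x : 0 <= bump1 a b x.
Proof. by rewrite mulr_ge0// posX_ge0. Qed.

Lemma bump1_neq0 a b x : bump1 a.+1 b.+1 x != 0 -> 0 < x < 1.
Proof.
rewrite /bump1 /posX mulf_eq0 negb_or !expf_eq0/= => /andP[].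
case: (ltP 0 x) => [x0 _|x0]; last by rewrite eqxx.
case: (ltP 0 (1 - x)) => [x1 _|x1]; last by rewrite eqxx.
by rewrite -subr_gt0.
Qed.

Lemma bump1_le1 a b x : bump1 a.+1 b.+1 x <= 1.
Proof.
have [->//|/bump1_neq0/andP[x0 x1]] := eqVneq (bump1 a.+1 b.+1 x) 0.
rewrite /bump1 /posX !max_l ?subr_ge0 ?(ltW x0) ?(ltW x1)//.
by rewrite mulr_ile1 ?exprn_ge0 ?exprn_ile1 ?subr_ge0 ?gerBl ?(ltW x0) ?(ltW x1).
Qed.

Lemma bump1_middle m x : 4^-1 <= x <= 3 / 4 -> 16^-1 ^+ m <= bump1 m m x.
Proof.
move=> /andP[x0 x1]; rewrite /bump1 /posX !max_l; [|lra|lra].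
by rewrite -exprMn lerXn2r ?nnegrE//; nra.
Qed.

Definition fdiff (v : nat -> R) k := v k.+1 - v k.

Lemma fdiff_sum r (v : nat -> R) m : iter r fdiff v m =
  \sum_(k < r.+1) (-1) ^+ (r - k) * 'C(r, k)%:R * v (m + k)%N.
Proof.
elim: r m => [|r IH] m; first by rewrite big_ord1 /= expr0 !mul1r addn0.
pose c k : R := (-1) ^+ (r - k) * 'C(r, k)%:R.
(* Pascal's rule; the index [k = r.+1] falls under it because ['C(r, r.+1)] is 0. *)
have E k : (k <= r.+1)%N -> (-1) ^+ (r.+1 - k) * 'C(r.+1, k)%:R * v (m + k)%N =
    (if k is k'.+1 then c k' * v (m + k)%N else 0) - c k * v (m + k)%N.
  rewrite /c; case: k => [|k] kr.
    by rewrite !subn0 !bin0 exprS; ring.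
  rewrite binS natrD subSS; move: kr; rewrite ltnS leq_eqVlt => /predU1P[->|kr].
    by rewrite (bin_small (ltnSn r)); ring.
  by rewrite (_ : (r - k = (r - k.+1).+1)%N) ?exprS; [ring|lia].
rewrite iterS /fdiff !IH (eq_bigr _ (fun (k : 'I_r.+2) _ => E k (leq_ord k))) sumrB.
rewrite [X in _ = X - _]big_ord_recl [X in _ = _ - X]big_ord_recr/= add0r.
rewrite [c r.+1]/c bin_small// mulr0 mul0r addr0; congr (_ - _); apply: eq_bigr => k _.
by rewrite /c /bump/= add1n addnS addSn.
Qed.

Lemma fdiffD j (v w : nat -> R) k :
  iter j fdiff (fun i => v i + w i) k = iter j fdiff v k + iter j fdiff w k.
Proof. by elim: j k => // j IH k; rewrite !iterS /fdiff !IH; ring. Qed.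

Lemma fdiffZ j c (v : nat -> R) k :
  iter j fdiff (fun i => c * v i) k = c * iter j fdiff v k.
Proof. by elim: j k => // j IH k; rewrite !iterS /fdiff !IH; ring. Qed.

Lemma eq_fdiff j (v w : nat -> R) k : v =1 w -> iter j fdiff v k = iter j fdiff w k.
Proof. by move=> /funext ->. Qed.

Lemma fdiff_shift j (v : nat -> R) k : iter j fdiff (fun i => v i.+1) k = iter j fdiff v k.+1.
Proof. by elim: j k => // j IH k; rewrite !iterS /fdiff !IH. Qed.

Lemma is_derive_fdiff (f df : R -> R) j k delta y :
  (forall x, is_derive x 1 f (df x)) ->
  is_derive y 1 (fun z => iter j fdiff (fun i => f (z + i%:R * delta)) k)
    (iter j fdiff (fun i => df (y + i%:R * delta)) k).
Proof.
move=> fdf; elim: j k => [|j IH] k; last exact: is_deriveB (IH _) (IH _).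
rewrite /= -[X in is_derive _ _ _ X]mulr1.
apply: (@is_derive1_comp R f (fun z => z + k%:R * delta)).
rewrite -[X in is_derive _ _ _ X]addr0.
by apply: (@is_deriveD _ _ _ id (cst (k%:R * delta))).
Qed.

Lemma lipschitz_derive (f df : R -> R) M x delta :
  (forall y, is_derive y 1 f (df y)) -> (forall y, `|df y| <= M) ->
  `|f (x + delta) - f x| <= M * `|delta|.
Proof.
move=> fdf dM; have [d0|d0|->] := ltgtP delta 0.
- have [|c _ E] := @MVT_closed R f df (x + delta) x _ (fun y _ => fdf y).
    by rewrite gtrDl.
  rewrite distrC E normrM opprD addrA subrr sub0r normrN.
  by rewrite ler_wpM2r.
- have [|c _ E] := @MVT_closed R f df x (x + delta) _ (fun y _ => fdf y).
    by rewrite ltrDl.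
  by rewrite E normrM addrAC subrr add0r ler_wpM2r.
by rewrite addr0 subrr normr0 mulr0.
Qed.

(** One more difference is an increment over [delta] of the previous one, which the mean value
    theorem trades for a derivative. A derivative lowers an exponent by 1, so [j] must stay below
    both exponents, and its coefficients add up to a + b. *)
Lemma fdiff_bump1 j a b k y delta : (j < a)%N -> (j < b)%N ->
  `|iter j fdiff (fun i => bump1 a b (y + i%:R * delta)) k| <=
  ((a + b)%:R * `|delta|) ^+ j.
Proof.
elim: j a b k y => [|j IH] [|a] [|b] k y // ja jb.
  by rewrite expr0 ger0_norm ?bump1_ge0 ?bump1_le1.
case: a b ja jb => [|a] [|b]// ja jb.
rewrite iterS {1}/fdiff.
set G := (fun z => iter j fdiff (fun i => bump1 a.+2 b.+2 (z + i%:R * delta)) k).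
have -> : iter j fdiff (fun i => bump1 a.+2 b.+2 (y + i%:R * delta)) k.+1 = G (y + delta).
  rewrite -fdiff_shift /G; apply: eq_fdiff => i; congr bump1.
  by rewrite -natr1; ring.
have -> : iter j fdiff (fun i => bump1 a.+2 b.+2 (y + i%:R * delta)) k = G y by [].
pose M := (a.+2 + b.+2)%:R * ((a.+2 + b.+2)%:R * `|delta|) ^+ j.
apply: le_trans (@lipschitz_derive G _ M y delta _ _) _.
- by move=> z; apply: is_derive_fdiff => x; exact: is_derive_bump1.
- move=> z; cbv beta.
  rewrite (eq_fdiff _ _ (w := fun i => a.+2%:R * bump1 a.+1 b.+2 (z + i%:R * delta) +
      - b.+2%:R * bump1 a.+2 b.+1 (z + i%:R * delta))); last by move=> i; rewrite mulNr.
  rewrite fdiffD !fdiffZ (le_trans (ler_normD _ _))// !normrM normrN !normr_nat.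
  rewrite /M natrD [leRHS]mulrDl -natrD; apply: lerD; rewrite ler_wpM2l//.
  - rewrite (le_trans (IH _ _ _ _ _ _))// ?(ltnW jb)// lerXn2r ?nnegrE ?mulr_ge0//.
    by rewrite ler_wpM2r// ler_nat addSn.
  - rewrite (le_trans (IH _ _ _ _ _ _))// ?(ltnW ja)// lerXn2r ?nnegrE ?mulr_ge0//.
    by rewrite ler_wpM2r// ler_nat leq_add2l.
by rewrite /M exprSr; rewrite le_eqVlt; apply/orP; left; apply/eqP; ring.
Qed.

Definition fdiff_bounded r M theta (v : nat -> R) :=
  forall j k, (j <= r)%N -> `|iter j fdiff v k| <= M * theta ^+ j.

Lemma fdiff_bounded1 r theta : 0 <= theta -> fdiff_bounded r 1 theta (fun=> 1).
Proof.
move=> th0 [|j] k _; first by rewrite expr0 mulr1 normr1.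
suff -> : iter j.+1 fdiff (fun=> 1) k = 0.
  by rewrite normr0 mul1r exprn_ge0.
by elim: j k => [|j IH] k; rewrite iterS /fdiff ?subrr// !IH subrr.
Qed.

Lemma fdiff_boundedM r M N theta v w : 0 <= M -> 0 <= N -> 0 <= theta ->
  fdiff_bounded r M theta v -> fdiff_bounded r N theta w ->
  fdiff_bounded r (2 ^+ r * M * N) theta (fun i => v i * w i).
Proof.
move=> M0 N0 th0 vM wN.
suff H j : forall M' N' v w, 0 <= M' -> 0 <= N' ->
    fdiff_bounded j M' theta v -> fdiff_bounded j N' theta w -> forall k,
    `|iter j fdiff (fun i => v i * w i) k| <= 2 ^+ j * M' * N' * theta ^+ j.
  move=> j k jr; apply: (@le_trans _ _ (2 ^+ j * M * N * theta ^+ j)).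
    by apply: H => // i k' ij; [apply: vM|apply: wN]; exact: leq_trans jr.
  rewrite !(ler_wpM2r, exprn_ge0)// ler_weXn2l//; lra.
elim: j {M N M0 N0 v w vM wN} => [|j IH] M N v w M0 N0 vM wN k.
  rewrite /= !expr0 mul1r mulr1 normrM; apply: ler_pM => //.
    by have := vM 0%N k isT; rewrite expr0 mulr1.
  by have := wN 0%N k isT; rewrite expr0 mulr1.
(* The discrete product rule, with one factor shifted; its two terms double the constant at each
   order. *)
rewrite iterSr (eq_fdiff _ _ (w := fun i => fdiff v i * w i.+1 + v i * fdiff w i)); last first.
  by move=> i; rewrite /fdiff; ring.
rewrite fdiffD (le_trans (ler_normD _ _))//.
apply: (@le_trans _ _ (2 ^+ j * (M * theta) * N * theta ^+ j + 2 ^+ j * M * (N * theta) * theta ^+ j)).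
  apply: lerD; apply: IH; rewrite ?mulr_ge0//.
  - move=> i k' ij; have := vM i.+1 k' ij.
    by rewrite iterSr -mulrA -exprS.
  - by move=> i k' ij; rewrite fdiff_shift; apply: wN; exact: leq_trans (leqnSn _).
  - by move=> i k' ij; apply: vM; exact: leq_trans (leqnSn _).
  - move=> i k' ij; have := wN i.+1 k' ij.
    by rewrite iterSr -mulrA -exprS.
by rewrite !exprS; rewrite le_eqVlt; apply/orP; left; apply/eqP; ring.
Qed.

End smooth_bump.

(** * Samples from a mixture *)

Section iid_mixture.
Context {dd : measure_display} {X : measurableType dd} {R : realType}.
Variables (O : finType) (Q : O -> probability X R).

(** The law of a sample whose observation [i] comes from the component [c i], built by the recursion
    of [power_measure] so that the two can be compared by induction. *)
Fixpoint independent_law n :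
    ('I_n -> O) -> {sigma_finite_measure set (n.-tuple X) -> \bar R} :=
  match n return ('I_n -> O) -> {sigma_finite_measure set (n.-tuple X) -> \bar R} with
  | 0%N => fun=> \d_([tuple] : 0.-tuple X)
  | n'.+1 => fun c => cons_measure (Q (c ord0))
      (@independent_law n' (fun i => c (lift ord0 i)))
  end.

Lemma independent_law_setT n (c : 'I_n -> O) : independent_law c setT = 1%E.
Proof.
elim: n c => [|n IH] c; first by rewrite /= diracT.
rewrite /= /cons_measure /image_measure /pushforward preimage_setT -setXTT.
rewrite [LHS]product_measure1E//= probability_setT IH mule1//.
Qed.

Lemma independent_law_fin n (c : 'I_n -> O) (A : set (n.-tuple X)) :
  measurable A -> 0 <= fine (independent_law c A) <= 1 /\
  independent_law c A = (fine (independent_law c A))%:E.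
Proof.
move=> mA; have l1 : (independent_law c A <= 1)%E.
  by rewrite -(independent_law_setT c) le_measure ?inE.
have fA : independent_law c A \is a fin_num.
  by rewrite ge0_fin_numE// (le_lt_trans l1)// ltry.
by split; [rewrite fine_ge0//= -lee_fin fineK|rewrite fineK].
Qed.

Variables (P : probability X R) (q : O -> R).
Hypothesis q0 : forall o, 0 <= q o.
Hypothesis PQ : forall A, measurable A -> P A = (\sum_o (q o)%:E * Q o A)%E.

Lemma integral_mixture (g : X -> \bar R) : measurable_fun setT g ->
  (forall x, 0 <= g x)%E ->
  (\int[P]_x g x = \sum_o (q o)%:E * \int[Q o]_x g x)%E.
Proof.
move=> mg g0; have [x0 _|O0] := pickP (fun _ : O => true); last first.
  have := PQ measurableT; rewrite probability_setT big_pred0// => /eqP.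
  by rewrite onee_eq0.
(* The sum over [O] as a sum of measures indexed by numbers. The default [x0] of [nth] exists
   because [P] has mass 1, which excludes an empty [O]. *)
pose m_ k : {measure set X -> \bar R} :=
  mscale (NngNum (q0 (nth x0 (enum O) k))) (Q (nth x0 (enum O) k)).
transitivity (\int[msum m_ #|O|]_x g x)%E.
  apply: eq_measure_integral => A mA _ /=.
  rewrite /msum PQ// -(big_enum _ _ _ (fun o => (q o)%:E * Q o A)%E)/= (big_nth x0) -cardE big_mkord.
  exact: eq_bigr.
rewrite ge0_integral_measure_sum//.
rewrite -[RHS](big_enum _ _ _ (fun o => (q o)%:E * \int[Q o]_x g x)%E)/= (big_nth x0) -cardE big_mkord.
by apply: eq_bigr => k _; rewrite ge0_integral_mscale.
Qed.

Let ext n (o : O) (c : {ffun 'I_n -> O}) : {ffun 'I_n.+1 -> O} :=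
  [ffun i => if unlift ord0 i is Some j then c j else o].

Let sum_ext (V : nmodType) n (F : {ffun 'I_n.+1 -> O} -> V) :
  \sum_c F c = \sum_o \sum_(c : {ffun 'I_n -> O}) F (ext o c).
Proof.
rewrite pair_bigA /= (reindex (fun p : O * {ffun 'I_n -> O} => ext p.1 p.2)) //=.
exists (fun c : {ffun 'I_n.+1 -> O} => (c ord0, [ffun j => c (lift ord0 j)])).
  move=> [y c] _ /=; congr (_, _); first by rewrite ffunE unlift_none.
  by apply/ffunP => j; rewrite !ffunE liftK.
move=> c _ /=; apply/ffunP => i; rewrite !ffunE.
by case: unliftP => [j ->|->]; rewrite ?ffunE.
Qed.

(** Sampling a mixture amounts to drawing a label and then sampling its component. The induction
    splits off the first observation by sections. *)
Lemma power_measure_mixture n (A : set (n.-tuple X)) : measurable A ->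
  power_measure P n A =
  (\sum_(c : {ffun 'I_n -> O}) (\prod_l q (c l))%:E * independent_law c A)%E.
Proof.
elim: n A => [|n IH] A mA.
  rewrite (bigD1 [ffun i : 'I_0 => False_rect O (notF (ltn_ord i))])//=.
  rewrite big_ord0 mul1e big1 ?adde0// => c /eqP; case.
  by apply/ffunP => -[].
set B := @cons_pair dd X n @^-1` A.
have mB : measurable B.
  by rewrite -[B]setTI; apply: measurable_funP.
transitivity (\int[P]_x (power_measure P n \o xsection B) x)%E; first by [].
have mx c : measurable_fun setT (independent_law c \o xsection B).
  exact: measurable_fun_xsection.
rewrite integral_mixture//; last exact: measurable_fun_xsection.
rewrite sum_ext; apply: eq_bigr => o _.
transitivity ((q o)%:E * \int[Q o]_x
   \sum_(c : {ffun 'I_n -> O}) (\prod_l q (c l))%:E * independent_law c (xsection B x))%E.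
  congr (_ * _)%E; apply: eq_integral => x _ /=; apply: IH.
  exact: measurable_xsection.
have p0 (c : {ffun 'I_n -> O}) : 0 <= \prod_l q (c l) by exact: prodr_ge0.
rewrite ge0_integral_sum//; last 2 first.
- by move=> c; apply: measurable_funeM; exact: mx.
- by move=> c x _; rewrite mule_ge0// lee_fin.
rewrite ge0_sume_distrr; last first.
  by move=> c _; apply: integral_ge0 => x _; rewrite mule_ge0// lee_fin.
apply: eq_bigr => c _; rewrite ge0_integralZl_EFin//; last exact: mx.
rewrite muleA -EFinM big_ord_recl; congr ((_ * _)%:E * _)%E.
- by rewrite ffunE unlift_none.
- by apply: eq_bigr => l _; rewrite ffunE liftK.
rewrite /= /cons_measure /image_measure /pushforward.
rewrite [X in _ = (product_measure1 (Q X) _ _)](_ : _ = o); last first.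
  by rewrite ffunE unlift_none.
rewrite (_ : (fun i => ext o c (lift ord0 i)) = c)//.
by apply/funext => i; rewrite ffunE liftK.
Qed.

(** The probability of an event becomes a polynomial in the masses [q], with coefficients in [0, 1]
    that depend only on the components: these are the [kappa] of the exchange argument. *)
Lemma iid_mixture n (A : set (n.-tuple X)) : measurable A ->
  iid P n A =
  (pexp (fun=> q) (fun c : {ffun 'I_n -> O} => fine (independent_law c A)))%:E.
Proof.
move=> mA; rewrite /iid power_measure_mixture// /pexp -sumEFin.
apply: eq_bigr => c _; rewrite EFinM.
by have [_ {1}->] := independent_law_fin c mA.
Qed.

End iid_mixture.

Lemma measurable_coord (R : realType) (d : nat) (i : 'I_d) :
  measurable_fun [set: 'rV[R]_d] (fun x : 'rV[R]_d => (x ord0 i : R)).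
Proof.
move=> _ Y mY; rewrite setTI; apply: sub_sigma_algebra => /=.
rewrite -bigcup_seq/=; exists i => /=; first by rewrite mem_index_enum.
by exists Y => //; rewrite setTI.
Qed.

Lemma enorm_coord (R : realType) (d : nat) (e : 'rV[R]_d) (i : 'I_d) :
  `|e ord0 i| <= enorm e.
Proof.
rewrite -sqrtr_sqr /enorm; apply: ler_wsqrtr; rewrite (bigD1 i)//= lerDl.
by apply: sumr_ge0 => j _; exact: sqr_ge0.
Qed.

(** * Masses and finite differences of bumps on cubes *)

Section cube_bumps.
Variables (R : realType) (d r : nat).
Implicit Types (tau : 'I_d -> R) (h : R) (x e : 'rV[R]_d).

Definition cube tau h : set 'rV[R]_d :=
  [set x | forall i, tau i < x ord0 i < tau i + h].

(** The exponent [r.+1] is the smallest that [fdiff_bump1] accepts for differences of order [r]. *)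
Definition cube_bump tau h x : R :=
  \prod_(i < d) bump1 r.+1 r.+1 ((x ord0 i - tau i) / h).

Lemma cube_bump_ge0 tau h x : 0 <= cube_bump tau h x.
Proof. by apply: prodr_ge0 => i _; exact: bump1_ge0. Qed.

Lemma cube_bump_le1 tau h x : cube_bump tau h x <= 1.
Proof. by apply: prodr_ile1 => i _; rewrite bump1_ge0 bump1_le1. Qed.

Lemma cube_bump_support tau h x : 0 < h -> cube_bump tau h x != 0 -> cube tau h x.
Proof.
move=> h0 /prodf_neq0 x0 i; have /bump1_neq0 := x0 i isT.
by rewrite ltr_pdivlMr// ltr_pdivrMr// mul0r mul1r subr_gt0 ltrBlDl.
Qed.

Lemma measurable_cube_bump tau h : measurable_fun [set: 'rV[R]_d] (cube_bump tau h).
Proof.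
apply: measurable_prod => i _.
have mx : measurable_fun [set: 'rV[R]_d] (fun x : 'rV[R]_d => (x ord0 i - tau i) / h).
  apply: measurable_funM => //; apply: measurable_funB => //.
  exact: measurable_coord.
apply: measurable_funM; apply: measurable_funX; apply: measurable_maxr => //.
exact: measurable_funB.
Qed.

Lemma measurable_cube tau h : measurable (cube tau h).
Proof.
rewrite (_ : cube tau h = \bigcap_(i in [set: 'I_d])
    ((fun x : 'rV[R]_d => x ord0 i) @^-1` `]tau i, tau i + h[%classic)).
  apply: fin_bigcap_measurable => // i _.
  by rewrite -[X in measurable X]setTI; apply: measurable_coord.
by apply/seteqP; split => x /= xc => [i _|i]; [|have := xc i I];
  rewrite /= ?in_itv/=.
Qed.

Lemma leb_cube tau h : 0 < h -> leb d (cube tau h) = (h ^+ d)%:E.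
Proof.
move=> h0.
transitivity (leb d [set x : 'rV[R]_d | forall i, `]tau i, tau i + h[%classic (x ord0 i)]).
  by congr (leb d _); apply/seteqP; split => x /= xc i; have := xc i; rewrite /= in_itv.
rewrite (leb_box (A := fun i => `]tau i, tau i + h[%classic))//.
under eq_bigr do rewrite lebesgue_measure_itv/= lte_fin ltrDl h0 -EFinB addrAC subrr add0r.
by rewrite prodEFin prodr_const card_ord.
Qed.

Lemma leb_shifted_cube tau h (a : 'rV[R]_d) : 0 < h ->
  [set x | cube tau h (x + a)] = cube (fun i => tau i - a ord0 i) h.
Proof.
move=> h0; apply/seteqP; split => x xc i; have := xc i; rewrite mxE.
  by rewrite ltrBlDr addrAC ltrBrDr.
by rewrite ltrBlDr addrAC ltrBrDr.
Qed.

Lemma integral_bump_le tau h : 0 < h ->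
  (\int[leb d]_x (cube_bump tau h x)%:E <= (h ^+ d)%:E)%E.
Proof.
move=> h0; rewrite -(leb_cube tau h0) -[cube tau h]setIT.
rewrite -integral_indic//; last exact: measurable_cube.
apply: ge0_le_integral => //.
- by move=> x _; rewrite lee_fin cube_bump_ge0.
- by apply/measurable_EFinP; exact: measurable_cube_bump.
- by apply/measurable_EFinP; apply: measurable_indic; exact: measurable_cube.
move=> x _; rewrite lee_fin indicE.
have [->//|/(cube_bump_support h0) xc] := eqVneq (cube_bump tau h x) 0.
by rewrite mem_set// cube_bump_le1.
Qed.

(** From the concentric cube of half the side: there each factor is at least 16^(-(r+1)), and the
    volume is (h / 2)^d. *)
Definition bump_mass : R := (16^-1 ^+ r.+1 / 2) ^+ d.

Lemma bump_mass_gt0 : 0 < bump_mass.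
Proof. by rewrite exprn_gt0// divr_gt0// exprn_gt0. Qed.

Lemma integral_bump_ge tau h : 0 < h ->
  ((bump_mass * h ^+ d)%:E <= \int[leb d]_x (cube_bump tau h x)%:E)%E.
Proof.
move=> h0; pose c : R := (16^-1 ^+ r.+1) ^+ d.
have c0 : 0 <= c by rewrite !exprn_ge0.
pose A := cube (fun i => tau i + h / 4) (h / 2).
have mA : measurable A by exact: measurable_cube.
have -> : (bump_mass * h ^+ d)%:E = (\int[leb d]_x (c * \1_A x)%:E)%E.
  under eq_integral do rewrite EFinM.
  rewrite ge0_integralZl_EFin//; last by apply/measurable_EFinP; exact: measurable_indic.
  have -> : (\int[leb d]_x (\1_A x)%:E = ((h / 2) ^+ d)%:E)%E.
    by rewrite integral_indic// setIT; apply: leb_cube; rewrite divr_gt0.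
  rewrite -EFinM /bump_mass /c.
  by rewrite -!exprMn; congr (_ ^+ d)%:E; ring.
apply: ge0_le_integral => //.
- by move=> x _; rewrite lee_fin mulr_ge0.
- by apply/measurable_EFinP; apply: measurable_funM => //; exact: measurable_indic.
- by apply/measurable_EFinP; exact: measurable_cube_bump.
move=> x _; rewrite lee_fin indicE.
have [xA|_] := boolP (x \in A); last by rewrite mulr0 cube_bump_ge0.
rewrite mulr1 /c -[X in _ ^+ X]card_ord -prodr_const.
apply: ler_prod => i _; rewrite exprn_ge0//=.
apply: bump1_middle; rewrite ler_pdivlMr// ler_pdivrMr//.
by have := set_mem xA i => /andP[]; lra.
Qed.

Definition bump_int tau h : R := fine (\int[leb d]_x (cube_bump tau h x)%:E)%E.

Lemma bump_intE tau h : 0 < h ->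
  (\int[leb d]_x (cube_bump tau h x)%:E)%E = (bump_int tau h)%:E.
Proof.
move=> h0; rewrite /bump_int fineK// ge0_fin_numE.
  by rewrite (le_lt_trans (integral_bump_le _ h0))// ltry.
by apply: integral_ge0 => x _; rewrite lee_fin cube_bump_ge0.
Qed.

Lemma bump_int_le tau h : 0 < h -> bump_int tau h <= h ^+ d.
Proof. by move=> h0; rewrite -lee_fin -bump_intE// integral_bump_le. Qed.

Lemma bump_int_ge tau h : 0 < h -> bump_mass * h ^+ d <= bump_int tau h.
Proof. by move=> h0; rewrite -lee_fin -bump_intE// integral_bump_ge. Qed.

Lemma bump_int_gt0 tau h : 0 < h -> 0 < bump_int tau h.
Proof.
move=> h0; apply: lt_le_trans (bump_int_ge _ h0).
by rewrite mulr_gt0 ?bump_mass_gt0// exprn_gt0.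
Qed.

Lemma fdiff_bounded_prod (I : Type) (s : seq I) M (theta : R) (v : I -> nat -> R) :
  0 <= M -> 0 <= theta -> (forall i, fdiff_bounded r M theta (v i)) ->
  fdiff_bounded r ((2 ^+ r * M) ^+ size s) theta (fun k => \prod_(i <- s) v i k).
Proof.
move=> M0 th0 vM; elim: s => [|i s IH].
  rewrite expr0 (_ : (fun k => _) = fun=> 1); first exact: fdiff_bounded1.
  by apply/funext => k; rewrite big_nil.
rewrite (_ : (fun k => _) = fun k => v i k * \prod_(j <- s) v j k); last first.
  by apply/funext => k; rewrite big_cons.
rewrite /= exprS; apply: fdiff_boundedM => //.
by rewrite exprn_ge0// mulr_ge0// exprn_ge0.
Qed.

Lemma finite_diffE x e f : finite_diff r e f x =
  iter r (@fdiff R) (fun k => f (x + (k%:R - r%:R / 2) *: e)) 0%N.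
Proof. by rewrite fdiff_sum; apply: eq_bigr. Qed.

Definition diff_const : R := (2 ^+ r * ((r.+1 + r.+1)%:R) ^+ r) ^+ d.

(** Along the line, the argument of the factor [i] advances by t e_i / h, at most t / h in absolute
    value. Each of the [d] factors costs 2^r by the product rule and (2 r + 2)^r by
    [fdiff_bump1]. *)
Lemma finite_diff_bump tau h t e x : 0 < h -> 0 < t -> enorm e <= 1 ->
  `|finite_diff r (t *: e) (cube_bump tau h) x| <= diff_const * (t / h) ^+ r.
Proof.
move=> h0 t0 e1; rewrite finite_diffE.
pose y i := (x ord0 i - r%:R / 2 * t * e ord0 i - tau i) / h.
pose delta i := t * e ord0 i / h.
rewrite (eq_fdiff _ _ (w := fun k => \prod_(i < d) bump1 r.+1 r.+1 (y i + k%:R * delta i))); last first.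
  move=> k; apply: eq_bigr => i _; congr bump1; rewrite !mxE /y /delta.
  by field; rewrite gt_eqF.
have th0 : 0 <= t / h by rewrite divr_ge0 ?ltW.
have H i : fdiff_bounded r ((r.+1 + r.+1)%:R ^+ r) (t / h)
    (fun k => bump1 r.+1 r.+1 (y i + k%:R * delta i)).
  move=> j k jr; rewrite (le_trans (fdiff_bump1 _ _ _ _ _))// exprMn.
  apply: ler_pM; rewrite ?exprn_ge0//.
    by rewrite ler_weXn2l// ler1n addSn.
  rewrite lerXn2r ?nnegrE// /delta !normrM normfV (gtr0_norm t0) (gtr0_norm h0) ler_wpM2r ?invr_ge0 ?(ltW h0)//.
  by rewrite ler_piMr ?(ltW t0)// (le_trans (enorm_coord _ _)).
have := fdiff_bounded_prod (index_enum 'I_d) _ th0 H; rewrite exprn_ge0// => /(_ isT).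
move=> /(_ r 0%N (leqnn r)) => /le_trans; apply.
by rewrite /diff_const /index_enum -enumT size_enum_ord.
Qed.

Lemma finite_diff_le1 (e : 'rV[R]_d) x f : (forall z, 0 <= f z <= 1) ->
  `|finite_diff r e f x| <= 2 ^+ r.
Proof.
move=> f01; rewrite (le_trans (ler_norm_sum _ _ _))//.
have -> : 2 ^+ r = \sum_(k < r.+1) 'C(r, k)%:R :> R.
  rewrite -natr_sum -[LHS]/(2%:R ^+ r) -natrX; congr (_%:R).
  rewrite -[2%N]/(1 + 1)%N expnDn; apply: eq_bigr => k _.
  by rewrite !exp1n !muln1.
apply: ler_sum => k _; have /andP[f0 f1] := f01 (x + (k%:R - r%:R / 2) *: e).
by rewrite !normrM normrX normrN1 expr1n mul1r normr_nat ger0_norm// ler_piMr.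
Qed.

(** The bound in (t / h)^r serves for t <= h and the trivial bound 2^r for t > h; as 0 <= s <= r,
    each is at most a multiple of (t / h)^s. The indicators record where the difference can be
    nonzero, for the L_p norms. *)
Lemma finite_diff_bump_support tau h t e x (s : R) :
  0 < h -> 0 < t -> enorm e <= 1 -> 0 <= s <= r%:R ->
  `|finite_diff r (t *: e) (cube_bump tau h) x| <= (diff_const + 2 ^+ r) * (t / h) `^ s *
    \sum_(k < r.+1) \1_(cube tau h) (x + (k%:R - r%:R / 2) *: (t *: e)).
Proof.
move=> h0 t0 e1 /andP[s0 sr].
have C0 : 0 <= diff_const by rewrite exprn_ge0// mulr_ge0// exprn_ge0.
have th0 : 0 < t / h by rewrite divr_gt0.
have i0 (k : 'I_r.+1) : true -> 0 <= \1_(cube tau h) (x + (k%:R - r%:R / 2) *: (t *: e)) :> R.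
  by rewrite indicE ler0n.
have [/existsP[k xk]|] := boolP [exists k : 'I_r.+1,
    x + (k%:R - r%:R / 2) *: (t *: e) \in cube tau h]; last first.
  rewrite negb_exists => /forallP xk.
  rewrite /finite_diff big1 ?normr0 ?mulr_ge0 ?powR_ge0 ?sumr_ge0 ?addr_ge0 ?exprn_ge0//.
  move=> k _; have [->|/(cube_bump_support h0) xc] := eqVneq (cube_bump tau h (x + (k%:R - r%:R / 2) *: (t *: e))) 0.
    by rewrite mulr0.
  by have := xk k; rewrite mem_set.
have S1 : 1 <= \sum_(k < r.+1) \1_(cube tau h) (x + (k%:R - r%:R / 2) *: (t *: e)) :> R.
  by rewrite (bigD1 k)//= indicE xk lerDl sumr_ge0.
rewrite (@le_trans _ _ ((diff_const + 2 ^+ r) * (t / h) `^ s))//; last first.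
  by rewrite ler_peMr// mulr_ge0 ?powR_ge0 ?addr_ge0 ?exprn_ge0.
have [th1|th1] := leP (t / h) 1.
  apply: le_trans (finite_diff_bump _ _ h0 t0 e1) _.
  apply: ler_pM; rewrite ?exprn_ge0 ?(ltW th0) ?lerDl ?mulr_ge0 ?powR_ge0 ?addr_ge0 ?exprn_ge0//.
  by rewrite -powR_mulrn ?(ltW th0)//; apply: ger_powR; rewrite ?th0.
apply: le_trans (@finite_diff_le1 _ x _ _) _.
  by move=> z; rewrite cube_bump_ge0 cube_bump_le1.
have p1 : 1 <= (t / h) `^ s.
  by rewrite -(powRr0 (t / h)); apply: ler_powR => //; exact: ltW.
by rewrite (@le_trans _ _ (diff_const + 2 ^+ r)) ?lerDr ?ler_peMr ?addr_ge0 ?exprn_ge0.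
Qed.

End cube_bumps.

(** * L_p norms of functions dominated by steps on disjoint cubes *)

Section disjoint_cubes.
Variables (R : realType) (d : nat) (O : finType).
Variables (tau : O -> 'I_d -> R) (h : O -> R).
Hypothesis h_gt0 : forall o, 0 < h o.
Hypothesis cube_disjoint : forall o1 o2 x,
  cube (tau o1) (h o1) x -> cube (tau o2) (h o2) x -> o1 = o2.

Definition steps (w : O -> R) (a : 'rV[R]_d) (x : 'rV[R]_d) : R :=
  \sum_o w o * \1_(cube (tau o) (h o)) (x + a).

Let shifted_cube o (a : 'rV[R]_d) := cube (fun i => tau o i - a ord0 i) (h o).

Let indic_shift o a x :
  \1_(cube (tau o) (h o)) (x + a) = \1_(shifted_cube o a) x :> R.
Proof.
rewrite !indicE; congr (_ : bool)%:R; apply/idP/idP => /set_mem H; apply/mem_set.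
  by rewrite -[shifted_cube o a](leb_shifted_cube (tau o) a (h_gt0 o)).
by move: H; rewrite -[shifted_cube o a](leb_shifted_cube (tau o) a (h_gt0 o)).
Qed.

Let measurable_shifted_cube o a : measurable (shifted_cube o a).
Proof. exact: measurable_cube. Qed.

Lemma measurable_steps w a : measurable_fun setT (steps w a).
Proof.
apply: measurable_sum => o; apply: measurable_funM => //.
rewrite (_ : (fun x => _) = \1_(shifted_cube o a)); first exact: measurable_indic.
by apply/funext => x; rewrite indic_shift.
Qed.

Lemma stepsE w a x o : cube (tau o) (h o) (x + a) -> steps w a x = w o.
Proof.
move=> xo; rewrite /steps (bigD1 o)//= indicE mem_set// mulr1 big1 ?addr0//.
move=> o' oo'; rewrite indicE memNset ?mulr0// => /(cube_disjoint xo) E.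
by rewrite E eqxx in oo'.
Qed.

Lemma steps_out w a x : (forall o, ~ cube (tau o) (h o) (x + a)) -> steps w a x = 0.
Proof.
by move=> xo; rewrite /steps big1// => o _; rewrite indicE memNset ?mulr0//; exact: xo.
Qed.

Lemma steps_ge0 w a x : (forall o, 0 <= w o) -> 0 <= steps w a x.
Proof. by move=> w0; apply: sumr_ge0 => o _; rewrite mulr_ge0// indicE. Qed.

Lemma steps_powR w a x (p : R) : 0 < p ->
  steps w a x `^ p = steps (fun o => w o `^ p) a x.
Proof.
move=> p0; have [[i xo]|xo] := pselect (exists o, cube (tau o) (h o) (x + a)).
  by rewrite !(stepsE _ xo).
have {}xo o : ~ cube (tau o) (h o) (x + a) by move=> H; apply: xo; exists o.
by rewrite !steps_out// powR0// gt_eqF.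
Qed.

Lemma integral_steps w a : (forall o, 0 <= w o) ->
  (\int[leb d]_x (steps w a x)%:E = (\sum_o w o * h o ^+ d)%:E)%E.
Proof.
move=> w0; under eq_integral do rewrite -sumEFin.
rewrite ge0_integral_sum//; last 2 first.
- move=> o; apply/measurable_EFinP; apply: measurable_funM => //.
  rewrite (_ : (fun x => _) = \1_(shifted_cube o a)); first exact: measurable_indic.
  by apply/funext => x; rewrite indic_shift.
- by move=> o x _; rewrite lee_fin mulr_ge0// indicE.
rewrite -sumEFin; apply: eq_bigr => o _.
under eq_integral do rewrite EFinM indic_shift.
rewrite ge0_integralZl_EFin//; last by apply/measurable_EFinP; exact: measurable_indic.
rewrite EFinM; congr (_ * _)%E; rewrite integral_indic// setIT.
exact: leb_cube.
Qed.

(* The case [p = -oo] is irrelevant, since [1 <= p]. *)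
Definition weights_le (p : \bar R) (w : O -> R) (B : R) : Prop :=
  match p with
  | q%:E => is_true (\sum_o w o `^ q * h o ^+ d <= B `^ q)
  | _ => forall o, w o <= B
  end.

(** Through the largest term, the p-th power of a sum of [m] translates is at most m^p times the sum
    of their p-th powers; integration then gives [m] equal terms, and m <= m^p. Each of the two
    steps costs one factor [m]. *)
Lemma Lnorm_le_steps (p : \bar R) (w : O -> R) (F : 'rV[R]_d -> R) (c B : R)
    (m : nat) (a : 'I_m -> 'rV[R]_d) :
  (1 <= p)%E -> measurable_fun setT F -> (forall o, 0 <= w o) -> 0 <= c -> 0 <= B ->
  (forall x, `|F x| <= c * \sum_k steps w (a k) x) ->
  weights_le p w B ->
  ('N[leb d]_p [EFin \o F] <= (c * m%:R ^+ 2 * B)%:E)%E.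
Proof.
move=> p1 mF w0 c0 B0 FS.
have cB0 : 0 <= c * m%:R ^+ 2 * B by rewrite !mulr_ge0// exprn_ge0.
case: p p1 => [p| |//]; rewrite unlock; last first.
  move=> _ wB; case: ifP => _; last by rewrite lee_fin.
  apply/ess_supP; apply: aeW => x /=; rewrite lee_fin (le_trans (FS x))//.
  rewrite -!mulrA ler_wpM2l//.
  apply: (@le_trans _ _ (m%:R * B)).
    rewrite mulr_natl -[X in _ *+ X]card_ord -sumr_const; apply: ler_sum => k _.
    have [[i xo]|xo] := pselect (exists o, cube (tau o) (h o) (x + a k)).
      by rewrite (stepsE _ xo).
    by rewrite steps_out// => o H; apply: xo; exists o.
  case: m {a FS cB0} => [|m]; first by rewrite !mul0r.
  by rewrite ler_peMl ?mulr_ge0// ler1n.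
rewrite lee_fin => p1 wB; have p0 : 0 < p by lra.
apply: (@le_trans _ _ (((c * m%:R ^+ 2 * B) `^ p)%:E `^ p^-1)%E); last first.
  by rewrite poweR_EFin -powRrM mulfV ?gt_eqF// powRr1.
apply: gt0_ler_poweR; rewrite ?invr_ge0 ?in_itv/= ?leey ?andbT ?(ltW p0)//.
- by apply: integral_ge0.
- by rewrite lee_fin powR_ge0.
apply: (@le_trans _ _ (\int[leb d]_x ((c * m%:R) `^ p * \sum_k steps (fun o => w o `^ p) (a k) x)%:E)%E).
  apply: ge0_le_integral => //.
  - apply/measurable_EFinP; apply: (measurableT_comp (measurable_powR _)).
    exact: measurableT_comp.
  - apply/measurable_EFinP; apply: measurable_funM => //.
    by apply: measurable_sum => k; exact: measurable_steps.
  move=> x _ /=; rewrite lee_fin.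
  have S0 : 0 <= \sum_k steps w (a k) x by apply: sumr_ge0 => k _; exact: steps_ge0.
  apply: (@le_trans _ _ ((c * \sum_k steps w (a k) x) `^ p)).
    by apply: ge0_ler_powR; rewrite ?nnegrE ?mulr_ge0 ?(ltW p0).
  rewrite !powRM// -mulrA ler_wpM2l ?powR_ge0//.
  have [k0 k0m|no] := pickP (fun _ : 'I_m => true); last first.
    rewrite !big_pred0 // powR0 ?gt_eqF// mulr0//.
  have [k _ kmax] := @Order.TotalTheory.arg_maxP _ _ _ k0 xpredT (fun k => steps w (a k) x) isT.
  apply: (@le_trans _ _ ((m%:R * steps w (a k) x) `^ p)).
    apply: ge0_ler_powR; rewrite ?nnegrE ?mulr_ge0 ?steps_ge0 ?(ltW p0)//.
    rewrite mulr_natl -[X in _ *+ X]card_ord -sumr_const; apply: ler_sum => j _.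
    exact: kmax.
  rewrite powRM ?steps_ge0// ler_wpM2l ?powR_ge0// steps_powR// (bigD1 k)//=.
  rewrite lerDl sumr_ge0// => j _; apply: steps_ge0 => o; exact: powR_ge0.
have wp0 o : 0 <= w o `^ p by exact: powR_ge0.
under eq_integral do rewrite EFinM -sumEFin.
rewrite ge0_integralZl_EFin ?powR_ge0//; last 2 first.
- by move=> x _; apply: sume_ge0 => k _; rewrite lee_fin steps_ge0.
- by apply: emeasurable_sum => k; apply/measurable_EFinP; exact: measurable_steps.
rewrite ge0_integral_sum//; last 2 first.
- by move=> k; apply/measurable_EFinP; exact: measurable_steps.
- by move=> k x _; rewrite lee_fin steps_ge0.
rewrite (eq_bigr (fun=> (\sum_o w o `^ p * h o ^+ d)%:E)); last first.
  by move=> k _; rewrite integral_steps.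
rewrite sumEFin sumr_const card_ord -EFinM lee_fin.
have -> : c * m%:R ^+ 2 * B = c * m%:R * (m%:R * B) by ring.
rewrite [leRHS]powRM ?mulr_ge0// ler_wpM2l ?powR_ge0// powRM// -[leLHS]mulr_natl.
apply: ler_pM => //; first by apply: sumr_ge0 => o _; rewrite mulr_ge0// exprn_ge0// ltW.
case: m {a FS cB0} => [|m]; first by rewrite powR_ge0.
by apply: le1r_powR => //; rewrite ler1n.
Qed.

End disjoint_cubes.

Lemma normr_xlnx (R : realType) (y : R) : 0 <= y -> `|y * ln y| <= 1 + y ^+ 2.
Proof.
rewrite le_eqVlt => /predU1P[<-|y0]; first by rewrite mul0r normr0 expr0n addr0.
rewrite ler_norml; apply/andP; split; last first.
  by have := ln_le_subr1 y0; nra.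
have : ln y^-1 <= y^-1 - 1 by apply: ln_le_subr1; rewrite invr_gt0.
rewrite lnV ?posrE// => /(ler_wpM2l (ltW y0)).
rewrite mulrN mulrBr mulfV ?gt_eqF// mulr1 => H.
by have := sqr_ge0 y; lra.
Qed.

(** * The entropy of bumps and of their mixtures *)

Section bump_family.
Variables (R : realType) (d r : nat) (O : finType).
Variables (tau : O -> 'I_d -> R) (h : O -> R).
Hypothesis h_gt0 : forall o, 0 < h o.
Hypothesis h_le1 : forall o, h o <= 1.
Hypothesis cube_disjoint : forall o1 o2 x,
  cube (tau o1) (h o1) x -> cube (tau o2) (h o2) x -> o1 = o2.

Local Notation Z o := (bump_int r (tau o) (h o)).

Let Z_gt0 o : 0 < Z o. Proof. exact: bump_int_gt0. Qed.

Definition bump_pdf (o : O) (x : 'rV[R]_d) : R := cube_bump r (tau o) (h o) x / Z o.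

Lemma measurable_bump_pdf o : measurable_fun setT (bump_pdf o).
Proof. by apply: measurable_funM => //; exact: measurable_cube_bump. Qed.

Lemma bump_pdf_ge0 o x : 0 <= bump_pdf o x.
Proof. by rewrite divr_ge0 ?cube_bump_ge0 ?ltW. Qed.

Lemma integral_bump_pdf o : (\int[leb d]_x (bump_pdf o x)%:E = 1)%E.
Proof.
under eq_integral do rewrite /bump_pdf mulrC EFinM.
rewrite ge0_integralZl_EFin ?invr_ge0 ?(ltW (Z_gt0 _))//.
- by rewrite bump_intE// -EFinM mulVf// gt_eqF.
- by move=> x _; rewrite lee_fin cube_bump_ge0.
- by apply/measurable_EFinP; exact: measurable_cube_bump.
Qed.

Definition bump_density (o : O) : density R d :=
  Density (@measurable_bump_pdf o) (@bump_pdf_ge0 o) (integral_bump_pdf o).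

Lemma bump_pdf_support o x : bump_pdf o x != 0 -> cube (tau o) (h o) x.
Proof.
by rewrite mulf_eq0 negb_or => /andP[b0 _]; exact: cube_bump_support b0.
Qed.

Lemma bump_pdf_le o x : bump_pdf o x <= (Z o)^-1 * \1_(cube (tau o) (h o)) x.
Proof.
rewrite indicE mulrC; have [->|b0] := eqVneq (bump_pdf o x) 0.
  by rewrite mulr_ge0 ?ler0n// invr_ge0 ltW.
rewrite mem_set ?mul1r; last exact: bump_pdf_support.
by rewrite /bump_pdf ler_piMl ?cube_bump_le1// invr_ge0 ltW.
Qed.

Let integral_cube o :
  (\int[leb d]_x (\1_(cube (tau o) (h o)) x)%:E = (h o ^+ d)%:E)%E.
Proof.
have mc : measurable (cube (tau o) (h o)) by exact: measurable_cube.
by rewrite integral_indic// setIT; exact: leb_cube.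
Qed.

Let integrable_cube o : (leb d).-integrable setT (EFin \o \1_(cube (tau o) (h o))).
Proof.
have mc : measurable (cube (tau o) (h o)) by exact: measurable_cube.
apply/integrableP; split; first by apply/measurable_EFinP; exact: measurable_indic.
rewrite (eq_integral (fun x => (\1_(cube (tau o) (h o)) x)%:E)); last first.
  by move=> x _ /=; rewrite ger0_norm// indicE.
by rewrite integral_cube ltry.
Qed.

Let integrable_on_cube o (f : 'rV[R]_d -> R) (M : R) : measurable_fun setT f ->
  (forall x, `|f x| <= M * \1_(cube (tau o) (h o)) x) ->
  (leb d).-integrable setT (EFin \o f).
Proof.
move=> mf fM; apply: (@le_integrable _ _ _ _ _ _ _ (EFin \o (fun x => M * \1_(cube (tau o) (h o)) x))) => //.
- exact/measurable_EFinP.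
- by move=> x _ /=; rewrite lee_fin (le_trans (fM x))// ler_norm.
rewrite (_ : EFin \o _ = fun x => (M%:E * (EFin \o \1_(cube (tau o) (h o))) x)%E).
  exact: integrableZl.
by apply/funext => x /=; rewrite EFinM.
Qed.

Lemma integrable_bump_pdf o : (leb d).-integrable setT (EFin \o bump_pdf o).
Proof.
apply: (@integrable_on_cube o _ (Z o)^-1); first exact: measurable_bump_pdf.
by move=> x; rewrite ger0_norm ?bump_pdf_ge0// bump_pdf_le.
Qed.

Definition bump_entropy o : R := entropy (bump_pdf o).

Let measurable_bump_ln o :
  measurable_fun setT (fun x => - bump_pdf o x * ln (bump_pdf o x)).
Proof.
apply: measurable_funM.
  by apply: measurableT_comp => //; exact: measurable_bump_pdf.
apply: (measurableT_comp (@measurable_ln R)); exact: measurable_bump_pdf.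
Qed.

Lemma integrable_bump_ln o :
  (leb d).-integrable setT (EFin \o (fun x => - bump_pdf o x * ln (bump_pdf o x))).
Proof.
apply: (@integrable_on_cube o _ (1 + (Z o)^-1 ^+ 2)); first exact: measurable_bump_ln.
move=> x; rewrite mulNr normrN.
have [->|b0] := eqVneq (bump_pdf o x) 0.
  by rewrite mul0r normr0 mulr_ge0 ?addr_ge0 ?exprn_ge0 ?invr_ge0 ?(ltW (Z_gt0 _)) ?indicE ?ler0n.
apply: le_trans (normr_xlnx (bump_pdf_ge0 o x)) _.
have := bump_pdf_le o x; rewrite indicE mem_set ?mulr1; last exact: bump_pdf_support.
by move=> bZ; rewrite lerD2l lerXn2r ?nnegrE ?bump_pdf_ge0 ?invr_ge0 ?(ltW (Z_gt0 _)).
Qed.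

(** For a bump g of integral Z the integrand is ln Z times the density plus (- g ln g) / Z, and 0 <=
    - g ln g <= 1 on the cube; so the excess over ln Z is at most h^d / Z. *)
Lemma bump_entropy_bound o :
  0 <= bump_entropy o - ln (Z o) <= (bump_mass R d r)^-1.
Proof.
have Rb : \int[leb d]_x bump_pdf o x = 1 by rewrite /Rintegral integral_bump_pdf.
have Rc : \int[leb d]_x (\1_(cube (tau o) (h o)) x : R) = h o ^+ d.
  by rewrite /Rintegral integral_cube.
have iZ : (leb d).-integrable setT (EFin \o (fun x => ln (Z o) * bump_pdf o x)).
  rewrite (_ : EFin \o _ = fun x => ((ln (Z o))%:E * (EFin \o bump_pdf o) x)%E).
    by apply: integrableZl => //; exact: integrable_bump_pdf.
  by apply/funext => x /=; rewrite EFinM.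
have ic : (leb d).-integrable setT (EFin \o (fun x => (Z o)^-1 * \1_(cube (tau o) (h o)) x)).
  rewrite (_ : EFin \o _ = fun x => (((Z o)^-1)%:E * (EFin \o \1_(cube (tau o) (h o))) x)%E).
    by apply: integrableZl => //; exact: integrable_cube.
  by apply/funext => x /=; rewrite EFinM.
have bound x : let y := - bump_pdf o x * ln (bump_pdf o x) in
    ln (Z o) * bump_pdf o x <= y /\
    y <= ln (Z o) * bump_pdf o x + (Z o)^-1 * \1_(cube (tau o) (h o)) x.
  move=> y; rewrite /y; have [->|b0] := eqVneq (bump_pdf o x) 0.
    by rewrite mulr0 oppr0 mul0r add0r lexx mulr_ge0 ?invr_ge0 ?(ltW (Z_gt0 _)) ?indicE ?ler0n.
  rewrite indicE mem_set ?mulr1; last exact: bump_pdf_support.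
  move: b0; rewrite /bump_pdf; set g := cube_bump _ _ _ _; rewrite mulf_eq0 negb_or => /andP[g0' _].
  have g0 : 0 < g by rewrite lt0r g0' cube_bump_ge0.
  have g1 : g <= 1 by exact: cube_bump_le1.
  rewrite ln_div ?posrE//.
  have gln : - g * ln g <= 1.
    have : ln g^-1 <= g^-1 - 1 by apply: ln_le_subr1; rewrite invr_gt0.
    rewrite lnV ?posrE// => /(ler_wpM2l (ltW g0)).
    rewrite mulrN mulrBr mulfV ?gt_eqF// mulr1 mulNr; lra.
  have gln0 : 0 <= - g * ln g by rewrite mulNr oppr_ge0 mulr_ge0_le0 ?(ltW g0) ?ln_le0.
  have Zi : 0 < (Z o)^-1 by rewrite invr_gt0.
  rewrite (_ : - (g / Z o) * (ln g - ln (Z o)) =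
    ln (Z o) * (g / Z o) + (Z o)^-1 * (- g * ln g)); last by ring.
  split; first by rewrite lerDl mulr_ge0// ltW.
  by rewrite lerD2l ler_piMr// ltW.
apply/andP; split.
  rewrite subr_ge0 -[leLHS]mulr1 -Rb -RintegralZl//; last exact: integrable_bump_pdf.
  apply: le_Rintegral => //; first exact: integrable_bump_ln.
  by move=> x _; have [] := bound x.
rewrite lerBlDr addrC.
apply: (@le_trans _ _ (ln (Z o) + (Z o)^-1 * h o ^+ d)); last first.
  rewrite lerD2l ler_pdivrMl// ler_pdivlMr ?bump_mass_gt0// mulrC.
  exact: bump_int_ge.
rewrite -{1}[ln (Z o)]mulr1 -Rb -RintegralZl//; last exact: integrable_bump_pdf.
rewrite -Rc -RintegralZl// -RintegralD//.
apply: le_Rintegral => //; first exact: integrable_bump_ln.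
  pose f1 x := ln (Z o) * bump_pdf o x.
  pose f2 x := (Z o)^-1 * \1_(cube (tau o) (h o)) x.
  rewrite (_ : EFin \o _ = (fun x => (EFin \o f1) x + (EFin \o f2) x)%E).
    exact: integrableD.
  by apply/funext => x /=; rewrite EFinD.
by move=> x _; have [] := bound x.
Qed.

Definition entropy_const : R := (bump_mass R d r)^-1 + `|ln (bump_mass R d r)|.

(** Z is comparable to h^d. Small bumps of side of order 1 / N therefore have entropy - d ln N up to
    a constant. *)
Lemma bump_entropy_scale o : `|bump_entropy o - d%:R * ln (h o)| <= entropy_const.
Proof.
have /andP[e0 e1] := bump_entropy_bound o.
have m0 := bump_mass_gt0 R d r.
have hd0 : 0 < h o ^+ d by rewrite exprn_gt0.
have l1 : ln (Z o) <= d%:R * ln (h o).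
  by rewrite mulr_natl -lnXn// ler_ln ?posrE// bump_int_le.
have l2 : ln (bump_mass R d r) + d%:R * ln (h o) <= ln (Z o).
  by rewrite mulr_natl -lnXn// -lnM ?posrE// ler_ln ?posrE ?mulr_gt0// bump_int_ge.
have := ler_norm (- ln (bump_mass R d r)); rewrite normrN => l3.
have m1 : 0 < (bump_mass R d r)^-1 by rewrite invr_gt0.
by rewrite ler_norml /entropy_const; apply/andP; split; lra.
Qed.

Section mixture.
Variable q : O -> R.
Hypothesis q_ge0 : forall o, 0 <= q o.

Definition mixture_pdf (x : 'rV[R]_d) : R := \sum_o q o * bump_pdf o x.

Lemma measurable_mixture_pdf : measurable_fun setT mixture_pdf.
Proof.
apply: measurable_sum => o; apply: measurable_funM => //.
exact: measurable_bump_pdf.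
Qed.

Lemma mixture_pdf_ge0 x : 0 <= mixture_pdf x.
Proof. by apply: sumr_ge0 => o _; rewrite mulr_ge0 ?bump_pdf_ge0. Qed.

Lemma integral_mixture_pdf A : measurable A ->
  (\int[leb d]_(x in A) (mixture_pdf x)%:E =
   \sum_o (q o)%:E * \int[leb d]_(x in A) (bump_pdf o x)%:E)%E.
Proof.
move=> mA; under eq_integral do rewrite -sumEFin.
have mb o : measurable_fun A (EFin \o bump_pdf o).
  by apply/measurable_EFinP; apply: measurable_funTS; exact: measurable_bump_pdf.
rewrite ge0_integral_sum//; last 2 first.
- move=> o; rewrite (_ : (fun x => _) = fun x => ((q o)%:E * (EFin \o bump_pdf o) x)%E).
    exact: measurable_funeM.
  by apply/funext => x /=; rewrite EFinM.
- by move=> o x _; rewrite lee_fin mulr_ge0 ?bump_pdf_ge0.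
apply: eq_bigr => o _; under eq_integral do rewrite EFinM.
rewrite ge0_integralZl_EFin//; last exact: mb.
by move=> x _; rewrite lee_fin bump_pdf_ge0.
Qed.

Hypothesis q_sum : \sum_o q o = 1.

Lemma integral_mixture_pdf1 : (\int[leb d]_x (mixture_pdf x)%:E = 1)%E.
Proof.
rewrite integral_mixture_pdf//; under eq_bigr do rewrite integral_bump_pdf mule1.
by rewrite sumEFin q_sum.
Qed.

Definition mixture_density : density R d :=
  Density measurable_mixture_pdf mixture_pdf_ge0 integral_mixture_pdf1.

Lemma law_mixture A : measurable A ->
  law mixture_density A = (\sum_o (q o)%:E * law (bump_density o) A)%E.
Proof. exact: integral_mixture_pdf. Qed.

Lemma mixture_pdfE o x : cube (tau o) (h o) x -> mixture_pdf x = q o * bump_pdf o x.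
Proof.
move=> xo; rewrite /mixture_pdf (bigD1 o)//= big1 ?addr0// => o' oo'.
have [->|b0] := eqVneq (bump_pdf o' x) 0; first by rewrite mulr0.
by rewrite (cube_disjoint xo (bump_pdf_support b0)) eqxx in oo'.
Qed.

Lemma mixture_pdf_out x : (forall o, ~ cube (tau o) (h o) x) -> mixture_pdf x = 0.
Proof.
move=> xo; rewrite /mixture_pdf big1// => o _.
have [->|b0] := eqVneq (bump_pdf o x) 0; first by rewrite mulr0.
by have := xo o (bump_pdf_support b0).
Qed.

(** On disjoint supports the chain rule is exact: the entropy of the label plus the mean entropy of
    the bumps. *)
Lemma entropy_mixture :
  entropy mixture_pdf = \sum_o (- (q o * ln (q o)) + q o * bump_entropy o).
Proof.
pose ql o := - (q o * ln (q o)).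
pose bl o x := - bump_pdf o x * ln (bump_pdf o x).
pose F o x := - (q o * ln (q o)) * bump_pdf o x +
  q o * (- bump_pdf o x * ln (bump_pdf o x)).
have FE x : - mixture_pdf x * ln (mixture_pdf x) = \sum_o F o x.
  have F0 o : bump_pdf o x = 0 -> F o x = 0.
    by rewrite /F => ->; rewrite oppr0 !mul0r !mulr0 addr0.
  have [[i xi]|xo] := pselect (exists o, cube (tau o) (h o) x); last first.
    have {}xo o : ~ cube (tau o) (h o) x by move=> H; apply: xo; exists o.
    rewrite mixture_pdf_out// oppr0 mul0r big1// => o _; apply: F0.
    by apply/eqP; apply: contra_notT (xo o); exact: bump_pdf_support.
  rewrite (mixture_pdfE xi) (bigD1 i)//= [X in _ + X]big1 ?addr0; last first.
    move=> o oi; apply: F0; apply/eqP; apply: contraNT oi => /bump_pdf_support xo.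
    by rewrite (cube_disjoint xo xi).
  have [b0|b0] := eqVneq (bump_pdf i x) 0; first by rewrite F0// b0 mulr0 oppr0 mul0r.
  rewrite /F; have [->|q0] := eqVneq (q i) 0; first by rewrite !(mul0r, oppr0, addr0).
  rewrite lnM ?posrE ?lt0r ?q0 ?b0 ?bump_pdf_ge0 ?q_ge0//; ring.
have iF o : (leb d).-integrable setT (EFin \o F o).
  have -> : EFin \o F o = (fun x => (ql o)%:E * (EFin \o bump_pdf o) x +
     (q o)%:E * (EFin \o bl o) x)%E.
    by apply/funext => x /=; rewrite -!EFinM -EFinD.
  apply: integrableD => //; apply: integrableZl => //.
    exact: integrable_bump_pdf.
  exact: integrable_bump_ln.
rewrite /entropy /Rintegral.
under eq_integral do rewrite FE -sumEFin.
rewrite integral_sum// (eq_bigr (fun o => (fine (\int[leb d]_x (F o x)%:E))%:E)); last first.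
  by move=> o _; rewrite fineK//; apply: integrable_fin_num => //; exact: iF.
rewrite sumEFin/=; apply: eq_bigr => o _.
rewrite -[LHS]/(\int[leb d]_x F o x).
rewrite RintegralD//; last 2 first.
- rewrite (_ : EFin \o _ = fun x => ((ql o)%:E * (EFin \o bump_pdf o) x)%E).
    by apply: integrableZl => //; exact: integrable_bump_pdf.
  by apply/funext => x /=; rewrite EFinM.
- rewrite (_ : EFin \o _ = fun x => ((q o)%:E * (EFin \o bl o) x)%E).
    by apply: integrableZl => //; exact: integrable_bump_ln.
  by apply/funext => x /=; rewrite EFinM.
rewrite RintegralZl//; last exact: integrable_bump_ln.
rewrite RintegralZl//; last exact: integrable_bump_pdf.
by rewrite {1}/Rintegral integral_bump_pdf mulr1.
Qed.

End mixture.
End bump_family.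

Lemma closed_unit_cube (R : realType) (d : nat) : closed (@unit_cube R d).
Proof.
rewrite (_ : @unit_cube R d = \bigcap_(i in [set: 'I_d])
    ((fun x : 'rV[R]_d => x ord0 i) @^-1` [set y | 0 <= y] `&`
     (fun x : 'rV[R]_d => x ord0 i) @^-1` [set y | y <= 1])).
  apply: closed_bigI => i _; apply: closedI.
    by apply: closed_comp => [x _|]; [exact: coord_continuous|exact: closed_ge].
  by apply: closed_comp => [x _|]; [exact: coord_continuous|exact: closed_le].
apply/seteqP; split => x xc i /=; first by move=> _; have /andP[] := xc i.
by apply/andP; have [] := xc i I.
Qed.

(** * Mixtures in the Lipschitz ball *)

Section mixture_in_ball.
Variables (R : realType) (d : nat) (s : R) (p : \bar R) (O : finType).
Hypotheses (s_gt0 : 0 < s) (p_ge1 : (1 <= p)%E).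
Variables (tau : O -> 'I_d -> R) (h : O -> R).
Hypothesis h_gt0 : forall o, 0 < h o.
Hypothesis h_le1 : forall o, h o <= 1.
Hypothesis cube_disjoint : forall o1 o2 x,
  cube (tau o1) (h o1) x -> cube (tau o2) (h o2) x -> o1 = o2.
Hypothesis tau_ge0 : forall o i, 0 <= tau o i.
Hypothesis tau_le1 : forall o i, tau o i + h o <= 1.
Variable q : O -> R.
Hypothesis q_ge0 : forall o, 0 <= q o.

Local Notation r := `|Num.ceil s|%N.
Local Notation Z o := (bump_int r (tau o) (h o)).
Local Notation mass := (bump_mass R d r).

Let order_ge : 0 <= s <= r%:R.
Proof.
rewrite (ltW s_gt0)/= natr_absz ger0_norm ?ceil_ge//.
by rewrite ceil_ge0 (lt_trans _ s_gt0)// ltrN10.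
Qed.

(** Up to a constant, the size of a derivative of order [s] of the bump: its height q / h^d times
    h^(-s). *)
Definition rescaled_mass (o : O) : R := q o * h o `^ (- (d%:R + s)).

Let height (o : O) : R := q o / Z o * h o `^ (- s).

Let Z_gt0 o : 0 < Z o. Proof. exact: bump_int_gt0. Qed.

Let height_ge0 o : 0 <= height o.
Proof. by rewrite mulr_ge0 ?powR_ge0// divr_ge0// ltW. Qed.

Let height_le o : height o <= rescaled_mass o / mass.
Proof.
rewrite /height /rescaled_mass opprD powRD; last by rewrite (gt_eqF (h_gt0 o)) implybT.
have hs := powR_ge0 (h o) (- s).
rewrite (powRN _ d%:R) powR_mulrn ?(ltW (h_gt0 o))//.
rewrite (_ : q o * (h o ^- d * h o `^ (- s)) / mass =
  q o * (mass * h o ^+ d)^-1 * h o `^ (- s)); last by rewrite invfM; ring.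
rewrite ler_wpM2r// ler_wpM2l// lef_pV2 ?posrE ?mulr_gt0 ?bump_mass_gt0 ?exprn_gt0//.
exact: bump_int_ge.
Qed.

Lemma weights_le_height B : 0 <= B -> weights_le d h p rescaled_mass B ->
  weights_le d h p height (B / mass).
Proof.
have m0 := bump_mass_gt0 R d r.
have W0 o : 0 <= rescaled_mass o by rewrite mulr_ge0 ?powR_ge0.
move=> B0; case: p p_ge1 => [p' p1| _|//] /= W; last first.
  by move=> o; rewrite (le_trans (height_le o))// ler_pM2r ?invr_gt0.
rewrite lee_fin in p1.
rewrite powRM ?invr_ge0 ?(ltW m0)//.
apply: le_trans (ler_wpM2r (powR_ge0 _ _) W).
rewrite mulr_suml; apply: ler_sum => o _.
rewrite mulrAC ler_wpM2r ?exprn_ge0 ?(ltW (h_gt0 o))//.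
rewrite -powRM ?invr_ge0 ?(ltW m0)//.
by apply: ge0_ler_powR; rewrite ?nnegrE ?divr_ge0 ?(ltW m0)//; lra.
Qed.

Let f := mixture_pdf r tau h q.

Let bump_shift o (a x : 'rV[R]_d) :
  cube_bump r (tau o) (h o) (x + a) = cube_bump r (fun i => tau o i - a ord0 i) (h o) x.
Proof.
by apply: eq_bigr => i _; rewrite mxE opprB addrA.
Qed.

Let measurable_finite_diff (e : 'rV[R]_d) : measurable_fun setT (finite_diff r e f).
Proof.
apply: measurable_sum => k; apply: measurable_funM => //.
apply: measurable_sum => o; apply: measurable_funM => //.
rewrite (_ : (fun x => _) = (fun x => cube_bump r (fun i => tau o i - ((k%:R - r%:R / 2) *: e) ord0 i) (h o) x / Z o)).
  by apply: measurable_funM => //; exact: measurable_cube_bump.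
by apply/funext => x; rewrite /bump_pdf bump_shift.
Qed.

(** As h <= 1, the factor h^(-s) in [height] is at least 1, so the same steps dominate the function
    and its differences. *)
Let f_le_steps x : `|f x| <= 1 * \sum_(k < 1) steps tau h height 0 x.
Proof.
rewrite mul1r big_ord1 ger0_norm ?mixture_pdf_ge0//.
apply: ler_sum => o _; rewrite addr0 /height -!mulrA ler_wpM2l//.
apply: le_trans (@bump_pdf_le R d r O tau h h_gt0 o x) _.
rewrite ler_wpM2l ?invr_ge0 ?(ltW (Z_gt0 o))// ler_peMl ?indicE ?ler0n//.
rewrite powRN -[leLHS]invr1 lef_pV2 ?posrE ?powR_gt0//.
by rewrite -[leRHS](powRr0 (h o)); apply: ger_powR; rewrite ?h_gt0 ?h_le1 ?(ltW s_gt0).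
Qed.

Local Notation Cd := (diff_const R d r + 2 ^+ r).

Let finite_diff_le_steps t e x : 0 < t -> enorm e <= 1 ->
  `|finite_diff r (t *: e) f x| <= Cd * t `^ s *
    \sum_(k < r.+1) steps tau h height ((k%:R - r%:R / 2) *: (t *: e)) x.
Proof.
move=> t0 e1.
have -> : finite_diff r (t *: e) f x =
    \sum_o q o / Z o * finite_diff r (t *: e) (cube_bump r (tau o) (h o)) x.
  rewrite /finite_diff /f /mixture_pdf.
  under eq_bigr do rewrite mulr_sumr.
  rewrite exchange_big; apply: eq_bigr => o _; rewrite mulr_sumr.
  by apply: eq_bigr => k _; rewrite /bump_pdf; ring.
rewrite /steps exchange_big/= mulr_sumr (le_trans (ler_norm_sum _ _ _))//.
apply: ler_sum => o _; rewrite -mulr_sumr normrM ger0_norm ?divr_ge0 ?(ltW (Z_gt0 o))//.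
rewrite (le_trans (ler_wpM2l _ (finite_diff_bump_support _ _ (h_gt0 o) t0 e1 order_ge)))//.
  by rewrite divr_ge0// ltW.
rewrite /height powRM ?invr_ge0 ?(ltW t0) ?(ltW (h_gt0 o))//.
rewrite -[(h o)^-1]powR_inv1 ?(ltW (h_gt0 o))// -powRrM mulN1r.
by rewrite le_eqVlt; apply/orP; left; apply/eqP; ring.
Qed.

Definition ball_const : R := (1 + Cd * r.+1%:R ^+ 2) / mass.

(** Both parts of the norm come from [Lnorm_le_steps], with one translate for the function and
    [r.+1] for a difference, whose factor t^s cancels the weight t^(-s). *)
Lemma mixture_in_ball (B L : R) : 0 <= B ->
  weights_le d h p rescaled_mass B -> ball_const * B <= L -> lip_ball s p L f.
Proof.
move=> B0 WB CB; have m0 := bump_mass_gt0 R d r.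
have HB := weights_le_height B0 WB.
have B'0 : 0 <= B / mass by rewrite divr_ge0// ltW.
have Cd0 : 0 <= Cd by rewrite addr_ge0 ?exprn_ge0// mulr_ge0// exprn_ge0.
split.
- exact: measurable_mixture_pdf.
- apply: (@le_trans _ _ (ball_const * B)%:E); last by rewrite lee_fin.
  have -> : ball_const * B = 1 * 1%:R ^+ 2 * (B / mass) + Cd * r.+1%:R ^+ 2 * (B / mass).
    by rewrite /ball_const; ring.
  rewrite EFinD; apply: leeD.
    apply: (@Lnorm_le_steps _ _ _ tau h h_gt0 cube_disjoint p height f 1 (B / mass) 1 (fun=> 0)) => //.
    exact: measurable_mixture_pdf.
  apply: ge_ereal_sup => _ [t /= t0 <-].
  have tp : 0 < t `^ s by rewrite powR_gt0.
  rewrite powRN -lee_pdivlMl ?invr_gt0//= invrK.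
  apply: ge_ereal_sup => _ [e /= e1 <-].
  rewrite -EFinM (_ : t `^ s * _ = Cd * t `^ s * r.+1%:R ^+ 2 * (B / mass)); last by ring.
  apply: (@Lnorm_le_steps _ _ _ tau h h_gt0 cube_disjoint p height _ (Cd * t `^ s) (B / mass) r.+1
    (fun k : 'I_r.+1 => (k%:R - r%:R / 2) *: (t *: e))) => //.
  + by rewrite mulr_ge0// ltW.
  + by move=> x; exact: finite_diff_le_steps.
- have -> := (closure_id _).1 (@closed_unit_cube R d).
  apply: closureS => x /= fx.
  have [[i xi]|xo] := pselect (exists o, cube (tau o) (h o) x).
    move=> k; have /andP[x0 x1] := xi k.
    rewrite (le_trans (tau_ge0 i k) (ltW x0))/=.
    by rewrite (le_trans (ltW x1)).
  by move: fx; rewrite /f mixture_pdf_out ?eqxx// => o H; apply: xo; exists o.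
Qed.

End mixture_in_ball.

(** * The grid of bumps *)

Section grid.
Variables (R : realType) (d N : nat).
Hypotheses (d_gt0 : (0 < d)%N) (N_gt0 : (0 < N)%N).

Local Notation I := {ffun 'I_d -> 'I_N}.

(* A grid of [N ^ d] small cubes in [0, 1/2]^d, and one large cube in
   [1/2, 1]^d that carries the remaining mass. *)
Definition grid_corner (o : option I) (i : 'I_d) : R :=
  if o is Some k then (k i)%:R / (2 * N%:R) else 2^-1.

Definition grid_side (o : option I) : R :=
  if o is Some _ then (2 * N%:R)^-1 else 2^-1.

Let N0 : 0 < N%:R :> R. Proof. by rewrite ltr0n. Qed.
Let N2 : 0 < 2 * N%:R :> R. Proof. by rewrite mulr_gt0. Qed.

Lemma grid_side_gt0 o : 0 < grid_side o.
Proof. by case: o => [k|] /=; rewrite invr_gt0. Qed.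

Lemma grid_side_le1 o : grid_side o <= 1.
Proof.
case: o => [k|] /=; last lra.
rewrite invf_le1//; have : 1 <= N%:R :> R by rewrite ler1n.
lra.
Qed.

Lemma grid_corner_ge0 o i : 0 <= grid_corner o i.
Proof. by case: o => [k|] /=; rewrite ?divr_ge0 ?invr_ge0 ?(ltW N2). Qed.

Let grid_corner_half k i : grid_corner (Some k) i + grid_side (Some k) <= 2^-1.
Proof.
rewrite /= -[X in _ + X]mul1r -mulrDl natr1 ler_pdivrMr// mulKf// ler_nat.
exact: ltn_ord.
Qed.

Lemma grid_corner_le1 o i : grid_corner o i + grid_side o <= 1.
Proof.
case: o => [k|]; last by rewrite /=; lra.
by rewrite (le_trans (grid_corner_half _ _))//; lra.
Qed.

Lemma grid_disjoint o1 o2 (x : 'rV[R]_d) :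
  cube (grid_corner o1) (grid_side o1) x ->
  cube (grid_corner o2) (grid_side o2) x -> o1 = o2.
Proof.
have H k : cube (grid_corner (Some k)) (grid_side (Some k)) x ->
    cube (grid_corner None) (grid_side None) x -> False.
  move=> /(_ (Ordinal d_gt0))/andP[_ h1] /(_ (Ordinal d_gt0))/andP[h2 _].
  have := lt_le_trans h1 (grid_corner_half k _).
  by rewrite /= in h2; rewrite ltNge (ltW h2).
case: o1 o2 => [k1|] [k2|] //; last 2 first.
- by move=> /H /[apply].
- by move=> h1 /H; case.
move=> h1 h2; congr Some; apply/ffunP => i; apply/val_inj.
have /andP[a1 b1] := h1 i; have /andP[a2 b2] := h2 i.
have lt k1' k2' : grid_corner (Some k1') i < grid_corner (Some k2') i + grid_side (Some k2') ->
    (k1' i <= k2' i)%N.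
  by rewrite /= -[X in _ + X]mul1r -mulrDl natr1 ltr_pM2r ?invr_gt0// ltr_nat.
apply/eqP; rewrite eqn_leq; apply/andP; split; apply: lt.
  exact: lt_trans b2.
exact: lt_trans b1.
Qed.

Variables (s : R) (p : \bar R) (q : option I -> R) (G : R).
Hypotheses (s_gt0 : 0 < s) (p_ge1 : (1 <= p)%E) (G_ge0 : 0 <= G).
Hypothesis q_ge0 : forall o, 0 <= q o.
Hypothesis q_sum : \sum_o q o = 1.
Hypothesis q_le : (forall i, q (Some i) <= G) \/
  exists2 m : nat, (p <= m%:R%:E)%E & \sum_i q (Some i) ^+ m <= (N ^ d)%:R * G ^+ m.

(** With y = q / G, the inequality y^r <= 1 + y^m for r <= m does the work of the power mean
    inequality, at the price of a factor 2. *)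
Lemma sum_powR_le (r : R) : p = r%:E ->
  \sum_i q (Some i) `^ r <= 2 * (N ^ d)%:R * G `^ r.
Proof.
move=> pr; have r1 : 1 <= r by rewrite -lee_fin -pr.
have r0 : 0 < r by lra.
have cI : #|{ffun 'I_d -> 'I_N}| = (N ^ d)%N by rewrite card_ffun !card_ord.
have Nd0 : 0 <= (N ^ d)%:R * G `^ r by rewrite mulr_ge0 ?powR_ge0.
case: q_le => [qG|[m]].
  apply: (@le_trans _ _ ((N ^ d)%:R * G `^ r)); last by lra.
  rewrite -cI mulr_natl -sumr_const; apply: ler_sum => i _.
  by apply: ge0_ler_powR; rewrite ?nnegrE ?(ltW r0).
rewrite pr lee_fin => rm qm.
have m0 : (0 < m)%N by rewrite -(ltr0n R); lra.
(* For G = 0 the moment bound forces all small masses to vanish. *)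
have [G0|Gn0] := eqVneq G 0.
  have q0 i : q (Some i) = 0.
    move: qm; rewrite G0 expr0n eqn0Ngt m0 mulr0 => qm.
    have /eqP : \sum_i q (Some i) ^+ m = 0.
      by apply/eqP; rewrite eq_le qm sumr_ge0// => j _; rewrite exprn_ge0.
    rewrite psumr_eq0 => [/allP/(_ i (mem_index_enum _))|j _]; last by rewrite exprn_ge0.
    by rewrite expf_eq0 m0/= => /eqP.
  rewrite big1 ?mulr_ge0 ?powR_ge0// => i _.
  by rewrite q0 powR0// gt_eqF.
have {Gn0}G0 : 0 < G by rewrite lt0r Gn0.
have H i : q (Some i) `^ r <= G `^ r * (1 + q (Some i) ^+ m / G ^+ m).
  have -> : q (Some i) `^ r = G `^ r * (q (Some i) / G) `^ r.
    by rewrite -powRM ?divr_ge0// mulrCA mulfV ?mulr1// gt_eqF.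
  rewrite ler_wpM2l ?powR_ge0// -expr_div_n.
  set y := _ / _; have y0 : 0 <= y by rewrite divr_ge0.
  have [y1|y1] := leP y 1.
    apply: (@le_trans _ _ 1); last by rewrite lerDl exprn_ge0.
    have [->|yn0] := eqVneq y 0; first by rewrite powR0// gt_eqF.
    by rewrite -[leRHS](powRr0 y); apply: ger_powR; rewrite ?(ltW r0) ?y1 ?lt0r ?yn0 ?y0.
  apply: (@le_trans _ _ (y ^+ m)); last by rewrite lerDr.
  by rewrite -powR_mulrn//; apply: ler_powR => //; exact: ltW.
apply: le_trans (ler_sum _ (fun i _ => H i)) _.
rewrite -mulr_sumr big_split/= sumr_const -mulr_suml cI.
rewrite [leRHS]mulrC ler_wpM2l ?powR_ge0//.
have : (\sum_i q (Some i) ^+ m) / G ^+ m <= (N ^ d)%:R.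
  by rewrite ler_pdivrMr ?exprn_gt0.
rewrite -mulr_natl mulr1; lra.
Qed.

Definition corner_scale : R := 2 `^ (d%:R + s).
(** The term 1 is the large bump, of mass at most 1 and fixed side; the term N^(d + s) G stands for
    the small bumps. *)
Definition grid_bound : R := 2 * corner_scale * (1 + N%:R `^ (d%:R + s) * G).

Let q_le1 o : q o <= 1.
Proof. by rewrite -q_sum (bigD1 o)//= lerDl sumr_ge0. Qed.

Lemma weights_le_grid :
  weights_le d grid_side p (rescaled_mass d s grid_side q) grid_bound.
Proof.
have T0 : 0 < corner_scale by rewrite powR_gt0.
set X := N%:R `^ (d%:R + s).
have X0 : 0 <= X by exact: powR_ge0.
have XG : 0 <= X * G by rewrite mulr_ge0.
have WN : rescaled_mass d s grid_side q None = q None * corner_scale.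
  by rewrite /rescaled_mass /= -powR_inv1// -powRrM mulN1r opprK.
have WS i : rescaled_mass d s grid_side q (Some i) = q (Some i) * (corner_scale * X).
  rewrite /rescaled_mass /= -powR_inv1 ?(ltW N2)// -powRrM mulN1r opprK.
  by rewrite powRM// ltW.
rewrite /weights_le; case: p p_ge1 q_le sum_powR_le => [r r1 _ H| _ [qG|[m]]//|//]; last first.
  move=> _ [i|]; rewrite ?WN ?WS /grid_bound -/X.
    rewrite (_ : q (Some i) * _ = corner_scale * (X * q (Some i))); last by ring.
    rewrite (mulrC 2) -mulrA ler_wpM2l ?(ltW T0)//.
    by have := ler_wpM2l X0 (qG i); lra.
  have := ler_piMl (ltW T0) (q_le1 None).
  by have := mulr_ge0 (ltW T0) XG; lra.
rewrite lee_fin in r1; have r0 : 0 < r by lra.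
rewrite sum_option WN; under eq_bigr do rewrite WS.
have {}H := H r erefl.
rewrite [X in _ + X](eq_bigr (fun i => corner_scale `^ r * X `^ r * (2 * N%:R)^-1 ^+ d * q (Some i) `^ r)); last first.
  by move=> i _ /=; rewrite powRM ?mulr_ge0 ?(ltW T0)// powRM ?(ltW T0)// [RHS]mulrC !mulrA.
rewrite -mulr_sumr /=.
have one : 1 <= (1 + X * G) `^ r.
  by rewrite -[leLHS](powRr0 (1 + X * G)); apply: ler_powR; lra.
have XGr : (X * G) `^ r <= (1 + X * G) `^ r.
  by apply: ge0_ler_powR; rewrite ?nnegrE ?(ltW r0)//; lra.
apply: (@le_trans _ _ (corner_scale `^ r * (1 + X * G) `^ r + corner_scale `^ r * (1 + X * G) `^ r)).
  apply: lerD.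
    rewrite powRM ?(ltW T0)// (mulrC (q None `^ r)) -mulrA ler_wpM2l ?powR_ge0//.
    rewrite (le_trans _ one)//.
    have q1 : q None `^ r <= 1.
      have : q None `^ r <= 1 `^ r by apply: ge0_ler_powR; rewrite ?nnegrE ?(ltW r0) ?q_le1.
      by rewrite powR1.
    by rewrite mulr_ile1 ?powR_ge0 ?exprn_ge0 ?exprn_ile1//; lra.
  rewrite -!mulrA ler_wpM2l ?powR_ge0//.
  apply: le_trans XGr; rewrite powRM// ler_wpM2l ?powR_ge0//.
  apply: (@le_trans _ _ ((2 * N%:R)^-1 ^+ d * (2 * (N ^ d)%:R * G `^ r))).
    by rewrite ler_wpM2l ?exprn_ge0 ?invr_ge0 ?(ltW N2).
  rewrite invfM exprMn natrX.
  rewrite (_ : _ * _ = 2^-1 ^+ d * 2 * (N%:R^-1 ^+ d * N%:R ^+ d) * G `^ r); last by ring.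
  rewrite -exprMn mulVf ?gt_eqF// expr1n mulr1 ler_piMl ?powR_ge0//.
  (* The volumes bring 2^(-d), which absorbs the factor 2 of [sum_powR_le] because d >= 1. *)
  case: d d_gt0 => // d' _; rewrite exprSr -mulrA mulVf// mulr1 exprn_ile1//; lra.
have -> : grid_bound = 2 * (corner_scale * (1 + X * G)) by rewrite /grid_bound -/X; ring.
rewrite powRM ?mulr_ge0 ?(ltW T0) ?addr_ge0// powRM ?(ltW T0) ?addr_ge0//.
rewrite -mulr2n -[leLHS]mulr_natl ler_wpM2r ?mulr_ge0 ?powR_ge0//.
by apply: le1r_powR => //; rewrite ler1n.
Qed.

End grid.

Section grid_model.
Variables (R : realType) (d : nat) (s : R) (p : \bar R).
Hypotheses (d_gt0 : (0 < d)%N) (s_gt0 : 0 < s) (p_ge1 : (1 <= p)%E).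

Local Notation r := `|Num.ceil s|%N.

(** The interface between analysis and statistics: from here on only the masses, the numbers [eta]
    and the laws [Q] enter, and the constants [Ce] and [Cl] are uniform in [N]. *)
Lemma bump_model : exists Ce Cl : R, 0 < Cl /\ forall N : nat, (0 < N)%N ->
  exists (eta : option {ffun 'I_d -> 'I_N} -> R)
    (Q : option {ffun 'I_d -> 'I_N} -> probability 'rV[R]_d R),
  [/\ `|eta None| <= Ce, forall i, `|eta (Some i) + d%:R * ln N%:R| <= Ce &
  forall q : option {ffun 'I_d -> 'I_N} -> R,
    (forall o, 0 <= q o) -> \sum_o q o = 1 ->
    exists f : density R d,
    [/\ entropy f = \sum_o (- (q o * ln (q o)) + q o * eta o),
        forall A, measurable A -> law f A = (\sum_o (q o)%:E * Q o A)%E &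
        forall G L : R, 0 <= G ->
          (forall i, q (Some i) <= G) \/
          (exists2 m : nat, (p <= m%:R%:E)%E &
             \sum_i q (Some i) ^+ m <= (N ^ d)%:R * G ^+ m) ->
          Cl * (1 + N%:R `^ (d%:R + s) * G) <= L -> lip_ball s p L f]].
Proof.
pose Ce := entropy_const R d r + d%:R * ln 2.
have m0 := bump_mass_gt0 R d r.
have C0 : 0 < ball_const d s.
  by rewrite divr_gt0// ltr_wpDr// mulr_ge0// addr_ge0 ?exprn_ge0//.
have l2 : 0 <= ln 2 :> R by rewrite ln_ge0// ler1n.
exists Ce, (ball_const d s * (2 * corner_scale d s)); split.
  by rewrite mulr_gt0// mulr_gt0// powR_gt0.
move=> N N0.
pose tau := @grid_corner R d N; pose h := @grid_side R d N.
have h0 := @grid_side_gt0 R d N N0; have h1 := @grid_side_le1 R d N N0.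
have dis := @grid_disjoint R d N d_gt0 N0.
have N0' : 0 < N%:R :> R by rewrite ltr0n.
exists (bump_entropy r tau h), (fun o => law (bump_density r tau h0 o)).
split.
- have := bump_entropy_scale r tau h0 None; rewrite -/h /= lnV ?posrE// mulrN opprK => H.
  have := ler_normB (bump_entropy r tau h None + d%:R * ln 2) (d%:R * ln 2).
  by rewrite addrK (ger0_norm (mulr_ge0 _ l2))// /Ce; lra.
- move=> i; have := bump_entropy_scale r tau h0 (Some i).
  rewrite -/h /= lnV ?posrE ?mulr_gt0// mulrN opprK lnM ?posrE// mulrDr => H.
  have := ler_normB (bump_entropy r tau h (Some i) + (d%:R * ln 2 + d%:R * ln N%:R)) (d%:R * ln 2).
  rewrite (ger0_norm (mulr_ge0 _ l2))// /Ce => /le_trans H2.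
  rewrite (_ : bump_entropy r tau h (Some i) + d%:R * ln N%:R = bump_entropy r tau h (Some i) + (d%:R * ln 2 + d%:R * ln N%:R) - d%:R * ln 2); last by ring.
  by apply: H2; lra.
move=> q q0 q1; exists (mixture_density r tau h0 q0 q1); split.
- exact: entropy_mixture.
- by move=> A mA; exact: law_mixture.
move=> G L G0 qG CL; apply: (@mixture_in_ball R d s p _ s_gt0 p_ge1 tau h h0 h1 dis _ _ _ _ (grid_bound d N s G)).
- exact: grid_corner_ge0.
- exact: grid_corner_le1.
- by [].
- by rewrite !mulr_ge0 ?powR_ge0// addr_ge0// mulr_ge0 ?powR_ge0.
- exact: weights_le_grid.
by rewrite /grid_bound mulrA.
Qed.

End grid_model.

(** * Lower bounds on the risk *)

Section le_cam.
Variables (R : realType) (d n : nat) (s : R) (p : \bar R) (L : R).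

(** Markov's inequality for the squared error. *)
Lemma mse_ge (Hhat : n.-tuple 'rV[R]_d -> R) (f : density R d) (a : R)
    (A : set (n.-tuple 'rV[R]_d)) :
  measurable_fun setT Hhat -> measurable A -> 0 <= a ->
  (forall X, A X -> a <= `|Hhat X - entropy f|) ->
  ((a ^+ 2)%:E * iid (law f) n A <= mse Hhat f)%E.
Proof.
move=> mH mA a0 aA; rewrite /mse unlock.
have -> : ((a ^+ 2)%:E * iid (law f) n A = \int[iid (law f) n]_X ((a ^+ 2) * \1_A X)%:E)%E.
  under eq_integral do rewrite EFinM.
  rewrite ge0_integralZl_EFin ?sqr_ge0//; last by apply/measurable_EFinP; exact: measurable_indic.
  by rewrite integral_indic// setIT.
apply: ge0_le_integral => //.
- by move=> X _; rewrite lee_fin mulr_ge0 ?sqr_ge0.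
- by apply/measurable_EFinP; apply: measurable_funM => //; exact: measurable_indic.
- by apply/measurable_EFinP; apply: measurable_funX; apply: measurable_funB.
move=> X _; rewrite lee_fin indicE; have [XA|_] := boolP (X \in A); last first.
  by rewrite mulr0 sqr_ge0.
rewrite mulr1 -[leRHS]real_normK ?num_real// lerXn2r ?nnegrE//.
by apply: aA; exact: set_mem.
Qed.

Variables (O W : finType) (Q : O -> probability 'rV[R]_d R).
Variables (q : W -> O -> R) (G0 G1 : pred W) (w0 w1 : W -> R) (m a : R).

Definition realizes (f : density R d) (x : W) : Prop :=
  [/\ lip_ball s p L f, forall o, 0 <= q x o &
      forall A, measurable A -> law f A = (\sum_o (q x o)%:E * Q o A)%E].

(** The estimator yields the test that asks whether [Hhat] lies below [m]; where it errs, the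
    squared error is at least a^2. Averaging gives a^2 / 2 <= 2 rho for the worst risk rho. The
    weights sum to at most 1 rather than to 1 because atypical draws are discarded. *)
Lemma le_cam : 0 <= a ->
  (forall x, 0 <= w0 x) -> (forall x, 0 <= w1 x) ->
  \sum_(x | G0 x) w0 x <= 1 -> \sum_(x | G1 x) w1 x <= 1 ->
  (forall x, G0 x -> exists2 f, realizes f x & m + a <= entropy f) ->
  (forall x, G1 x -> exists2 f, realizes f x & entropy f <= m - a) ->
  (forall kappa : {ffun 'I_n -> O} -> R, (forall c, 0 <= kappa c <= 1) ->
    2^-1 <= \sum_(x | G0 x) w0 x * pexp (fun=> q x) kappa +
            \sum_(x | G1 x) w1 x * (1 - pexp (fun=> q x) kappa)) ->
  ((a ^+ 2 / 4)%:E <= minimax_mse d n s p L)%E.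
Proof.
move=> a0 w00 w10 w0s w1s H0 H1 test.
apply: le_ereal_inf_tmp => _ [Hhat mH <-]; set rho := ereal_sup _.
have rho_ge f : lip_ball s p L (pdf f) -> (mse Hhat f <= rho)%E.
  by move=> Lf; apply: ereal_sup_ubound; exists f.
pose A := Hhat @^-1` `]-oo, m[%classic.
have mA : measurable A by rewrite -[A]setTI; exact: mH.
have mAC : measurable (~` A) by exact: measurableC.
pose kappa (c : {ffun 'I_n -> O}) := fine (independent_law Q c A).
have k01 c : 0 <= kappa c <= 1 by have [] := independent_law_fin Q c mA.
have {test} := test _ k01.
case E : rho => [rh| |]; last 2 first.
- by rewrite leey.
(* A risk is nonnegative, so a supremum equal to -oo leaves both families empty, and the test
   hypothesis would read 1/2 <= 0. *)
- move=> t; exfalso.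
  have nG0 x : G0 x -> False.
    move=> /H0[f [Lf _ _] _]; have := rho_ge f Lf; rewrite E leeNy_eq => /eqP F.
    have : (0 <= mse Hhat f)%E.
      by rewrite /mse unlock; apply: integral_ge0 => X _; rewrite lee_fin sqr_ge0.
    by rewrite F.
  have nG1 x : G1 x -> False.
    move=> /H1[f [Lf _ _] _]; have := rho_ge f Lf; rewrite E leeNy_eq => /eqP F.
    have : (0 <= mse Hhat f)%E.
      by rewrite /mse unlock; apply: integral_ge0 => X _; rewrite lee_fin sqr_ge0.
    by rewrite F.
  by move: t; rewrite !big1 ?addr0; [lra|move=> x /nG1|move=> x /nG0].
have B0 x : G0 x -> a ^+ 2 * pexp (fun=> q x) kappa <= rh.
  move=> /H0[f [Lf q0 lf] Hf]; have := rho_ge f Lf; rewrite E -lee_fin; apply: le_trans.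
  rewrite EFinM -(iid_mixture q0 lf mA).
  apply: mse_ge => // X; rewrite /A/= in_itv/= => HX.
  by rewrite ler_normr; apply/orP; right; lra.
have B1 x : G1 x -> a ^+ 2 * (1 - pexp (fun=> q x) kappa) <= rh.
  move=> /H1[f [Lf q0 lf] Hf]; have := rho_ge f Lf; rewrite E -lee_fin; apply: le_trans.
  rewrite EFinM EFinB -(iid_mixture q0 lf mA) -probability_setC//.
  apply: mse_ge => // X; rewrite /A/= in_itv/= => /negP; rewrite -leNgt => HX.
  by rewrite ler_normr; apply/orP; left; lra.
have rh0 : 0 <= rh -> a ^+ 2 / 2 <= rh + rh -> a ^+ 2 / 4 <= rh by lra.
move=> t; rewrite lee_fin.
have S0 : a ^+ 2 * \sum_(x | G0 x) w0 x * pexp (fun=> q x) kappa <= rh * \sum_(x | G0 x) w0 x.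
  rewrite !mulr_sumr; apply: ler_sum => x Gx; rewrite mulrCA [leRHS]mulrC.
  by rewrite ler_wpM2l// B0.
have S1 : a ^+ 2 * \sum_(x | G1 x) w1 x * (1 - pexp (fun=> q x) kappa) <= rh * \sum_(x | G1 x) w1 x.
  rewrite !mulr_sumr; apply: ler_sum => x Gx; rewrite mulrCA [leRHS]mulrC.
  by rewrite ler_wpM2l// B1.
have s00 : 0 <= \sum_(x | G0 x) w0 x by exact: sumr_ge0.
have s10 : 0 <= \sum_(x | G1 x) w1 x by exact: sumr_ge0.
have rhp : 0 <= rh.
  rewrite leNgt; apply/negP => rn.
  have n0 x : G0 x -> False.
    move=> /H0[f [Lf _ _] _]; have := rho_ge f Lf; rewrite E.
    rewrite leNgt (lt_le_trans (_ : _ < 0%:E)%E) ?lte_fin//.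
    by rewrite /mse unlock; apply: integral_ge0 => X _; rewrite lee_fin sqr_ge0.
  have n1 x : G1 x -> False.
    move=> /H1[f [Lf _ _] _]; have := rho_ge f Lf; rewrite E.
    rewrite leNgt (lt_le_trans (_ : _ < 0%:E)%E) ?lte_fin//.
    by rewrite /mse unlock; apply: integral_ge0 => X _; rewrite lee_fin sqr_ge0.
  by move: t; rewrite !big1 ?addr0; [lra|move=> x /n1|move=> x /n0].
have R0 := ler_wpM2l rhp w0s; have R1 := ler_wpM2l rhp w1s.
have T := ler_wpM2l (sqr_ge0 a) t; rewrite mulrDr in T.
apply: rh0 => //; lra.
Qed.

End le_cam.

Lemma xlnx_lipschitz (R : realType) (x y : R) : 2^-1 <= x <= 1 -> 2^-1 <= y <= 1 ->
  `|x * ln x - y * ln y| <= 3 * `|x - y|.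
Proof.
suff H (v w : R) : 2^-1 <= v -> v <= w -> w <= 1 ->
    `|v * ln v - w * ln w| <= 3 * `|v - w|.
  move=> /andP[x0 x1] /andP[y0 y1]; have [xy|yx] := leP x y; first exact: H.
  by rewrite distrC (distrC x); apply: H => //; exact: ltW.
move=> v0 vw w1; have vp : 0 < v by lra.
have wp : 0 < w by lra.
rewrite (distrC v) [`|w - v|]ger0_norm ?subr_ge0//.
have lw : ln w <= 0 by exact: ln_le0.
have lw1 : - 1 <= ln w.
  have := @ln_le_subr1 R w^-1; rewrite invr_gt0 lnV ?posrE// => /(_ wp).
  have : w^-1 <= 2 by rewrite invf_ple ?posrE//; lra.
  lra.
have lwv : ln w - ln v <= (w - v) / v.
  rewrite -ln_div ?posrE// (le_trans (ln_le_subr1 _)) ?divr_gt0//.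
  by rewrite mulrBl mulfV ?gt_eqF.
have lvw : 0 <= ln w - ln v by rewrite subr_ge0 ler_ln ?posrE.
have vl : v * (ln w - ln v) <= w - v.
  by have := ler_wpM2l (ltW vp) lwv; rewrite mulrCA mulfV ?gt_eqF// mulr1.
have vl0 : 0 <= v * (ln w - ln v) by rewrite mulr_ge0// ltW.
have wl0 : 0 <= (w - v) * - ln w by rewrite mulr_ge0; lra.
have wl : (w - v) * - ln w <= (w - v) * 1 by rewrite ler_wpM2l; lra.
rewrite (_ : v * ln v - w * ln w = (w - v) * - ln w - v * (ln w - ln v)); last by ring.
by rewrite ler_norml; apply/andP; split; lra.
Qed.

Lemma xlnx_sqr_le (R : realType) (y : R) : 0 <= y -> (y * ln y) ^+ 2 <= 2 + 2 * y ^+ 4.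
Proof.
move=> y0; have : `|y * ln y| <= 1 + y ^+ 2 by exact: normr_xlnx.
move=> H; rewrite -real_normK ?num_real//.
apply: (@le_trans _ _ ((1 + y ^+ 2) ^+ 2)).
  by rewrite lerXn2r ?nnegrE// addr_ge0// sqr_ge0.
have := sqr_ge0 (1 - y ^+ 2); rewrite !expr2 -[y ^+ 4]/(y * (y * (y * y))).
by lra.
Qed.

Lemma sum_le_moment (R : realType) (I J : finType) (P : pred I) (u : J -> R) (m : nat)
    (w : {ffun I -> J}) : (forall j, 0 <= u j) -> (0 < m)%N ->
  \sum_(i | P i) u (w i) <= #|I|%:R + \sum_(i | P i) u (w i) ^+ m.
Proof.
move=> u0 m0; apply: (@le_trans _ _ (\sum_(i | P i) (1 + u (w i) ^+ m))).
  apply: ler_sum => i _; have [h|h] := leP (u (w i)) 1.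
    by rewrite (le_trans h)// lerDl exprn_ge0.
  by rewrite -[leLHS]add0r lerD// -[leLHS]expr1 ler_weXn2l// ltW.
by rewrite big_split/= sumr_const lerD2r ler_nat max_card.
Qed.

Lemma matched_bound_ge1 (R : realType) (J : finType) (u nu0 nu1 : J -> R) (K q : nat)
    (C gap : R) : matched_pair u nu0 nu1 K q C gap -> 1 <= C.
Proof.
move=> matched; have := matched_nu0_bound matched (leq0n q); rewrite (eq_bigr nu0).
  by rewrite (matched_nu0_sum matched).
by move=> j _; rewrite expr0 mulr1.
Qed.

(** * The nonparametric term *)

Section fuzzy_lower_bound.
Variables (R : realType) (d n : nat) (s : R) (p : \bar R) (L : R).
Variables (I J : finType) (u nu0 nu1 : J -> R) (K qm m : nat) (C gap : R).
Variables (eta : option I -> R) (Q : option I -> probability 'rV[R]_d R).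
Variables (a Lam Ce : R).
Hypothesis matched : matched_pair u nu0 nu1 K qm C gap.
Hypotheses (m_gt0 : (0 < m)%N) (m_le : (m * 2 <= qm)%N) (qm_ge4 : (4 <= qm)%N).
Hypotheses (K_gt1 : (1 < K)%N) (gap_gt0 : 0 < gap) (a_gt0 : 0 < a).

Local Notation S := (#|I|%:R : R).
Local Notation T := (5 * C * S).

Hypothesis room1 : a * ((1 + 5 * C) * S + K%:R ^+ 2) <= 1.
Hypothesis room2 : a * ((1 + 5 * C) * S) <= 2^-1.
Hypothesis eta_None : `|eta None| <= Ce.
Hypothesis eta_Some : forall i, `|eta (Some i) - ln a| <= Lam.
Hypothesis S_large : 8 * 16 * 16 * C / gap ^+ 2 * (Lam ^+ 2 + 4 + (3 + Ce) ^+ 2) <= S.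
Hypothesis tail_small :
  S * (2 * \sum_(D : {set 'I_n} | (K <= #|D|)%N) (2 * (a * K%:R ^+ 2)) ^+ #|D|) <= 16^-1.

Local Notation good := (tame (fun j => u j ^+ m) T).
Local Notation mass := (masses u a).

Hypothesis model : forall w : {ffun I -> J}, good w ->
  exists f : density R d, [/\ lip_ball s p L f,
    entropy f = \sum_o (- (mass w o * ln (mass w o)) + mass w o * eta o) &
    forall A, measurable A -> law f A = (\sum_o (mass w o)%:E * Q o A)%E].

Let u_ge0 := matched_ge0 matched.

Let C_ge1 : 1 <= C. Proof. exact: matched_bound_ge1 matched. Qed.

Let Ce_ge0 : 0 <= Ce. Proof. exact: le_trans eta_None. Qed.

Let S_gt0 : 0 < S.
Proof.
apply: lt_le_trans S_large; apply: mulr_gt0; last first.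
  by have := sqr_ge0 Lam; have := sqr_ge0 (3 + Ce); lra.
by apply: divr_gt0; [have := C_ge1; lra|exact: exprn_gt0].
Qed.

Let S_ge1 : 1 <= S.
Proof. by move: S_gt0; rewrite ltr0n ler1n. Qed.

Section prior.
Variable nu : J -> R.
Hypothesis nuE : nu = nu0 \/ nu = nu1.

Let nu_ge0 j : 0 <= nu j.
Proof.
by case: nuE => ->; [exact: matched_nu0_ge0 matched _|exact: matched_nu1_ge0 matched _].
Qed.

Let nu_sum : \sum_j nu j = 1.
Proof.
by case: nuE => ->; [exact: matched_nu0_sum matched|exact: matched_nu1_sum matched].
Qed.

Let nu_bound k : (k <= qm)%N -> \sum_j nu j * u j ^+ k <= C.
Proof.
by case: nuE => ->; [exact: matched_nu0_bound matched _|exact: matched_nu1_bound matched _].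
Qed.

Lemma prior_moment k : (k <= qm)%N -> \sum_j nu j * u j ^+ k <= C.
Proof. exact: nu_bound. Qed.

Definition cell_entropy (i : I) (y : J) : R :=
  - (a * u y * ln (a * u y)) + a * u y * eta (Some i).

(** The cell entropy is a ((eta - ln a) u - u ln u). Its square is controlled by the moments of
    order 2 and 4, hence the condition on [qm]. *)
Lemma cell_entropy_sqr i :
  \sum_y nu y * cell_entropy i y ^+ 2 <= 2 * a ^+ 2 * C * (Lam ^+ 2 + 4).
Proof.
have H y : cell_entropy i y ^+ 2 <= 2 * a ^+ 2 * (Lam ^+ 2 * u y ^+ 2 + (2 + 2 * u y ^+ 4)).
  have -> : cell_entropy i y = a * ((eta (Some i) - ln a) * u y - u y * ln (u y)).
    rewrite /cell_entropy; have [->|un0] := eqVneq (u y) 0; first by rewrite !(mulr0, mul0r); ring.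
    have up : 0 < u y by rewrite lt0r un0 u_ge0.
    by rewrite lnM ?posrE//; ring.
  have x0 := xlnx_sqr_le (u_ge0 y).
  have e0 : (eta (Some i) - ln a) ^+ 2 <= Lam ^+ 2.
    by rewrite -real_normK ?num_real// lerXn2r ?nnegrE ?(le_trans _ (eta_Some i)).
  have := ler_wpM2r (sqr_ge0 (u y)) e0; move: x0.
  set e := eta _ - _; set l := u y * ln _ => x0 H0.
  rewrite [leLHS]exprMn (_ : 2 * a ^+ 2 * _ =
    a ^+ 2 * (2 * (Lam ^+ 2 * u y ^+ 2 + (2 + 2 * u y ^+ 4)))); last by ring.
  rewrite ler_wpM2l ?sqr_ge0//.
  have := sqr_ge0 (e * u y + l).
  move: H0 x0; lra.
apply: le_trans (ler_sum _ (fun y _ => ler_wpM2l (nu_ge0 y) (H y))) _.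
rewrite (eq_bigr (fun y => 2 * a ^+ 2 * (Lam ^+ 2 * (nu y * u y ^+ 2) + 2 * nu y + 2 * (nu y * u y ^+ 4)))); last by move=> y _; ring.
rewrite -mulr_sumr -[leRHS]mulrA ler_wpM2l ?mulr_ge0 ?sqr_ge0 ?(ltW a_gt0)//.
rewrite !big_split/= -!mulr_sumr nu_sum.
have M2 : \sum_y nu y * u y ^+ 2 <= C by apply: nu_bound; apply: leq_trans qm_ge4.
have M4 : \sum_y nu y * u y ^+ 4 <= C by exact: nu_bound.
have := ler_wpM2l (sqr_ge0 Lam) M2; have := C_ge1; lra.
Qed.

Let S_over : 0 < S * a * gap. Proof. by rewrite !mulr_gt0. Qed.

Definition entropy_off (w : {ffun I -> J}) : bool :=
  (S * a * gap / 8 <= `|\sum_i cell_entropy i (w i) - \sum_i \sum_y nu y * cell_entropy i y|).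

Definition mean_mass : R := \sum_(i : I) \sum_y nu y * (a * u y).

(** The entropy of the large bump is (3 + Ce)-Lipschitz in its mass on [1/2, 1]; this threshold
    therefore keeps it within S a gap / 8. *)
Definition mass_off (w : {ffun I -> J}) : bool :=
  (S * a * gap / 8 / (3 + Ce) <= `|\sum_i a * u (w i) - mean_mass|).

(** The variance of the sum is at most 2 S a^2 C (Lam^2 + 4); the constants in [S_large] are made
    for the quotient 1/16. *)
Lemma prob_entropy_off : pprob (fun=> nu) entropy_off <= 16^-1.
Proof.
have t0 : 0 < S * a * gap / 8 by rewrite divr_gt0.
apply: le_trans (@pprob_chebyshev_mean _ _ _ (fun=> nu) (fun=> nu_sum) (fun=> nu_ge0)
  cell_entropy _ _ entropy_off cell_entropy_sqr t0 (fun w h => h)) _.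
rewrite ler_pdivrMr ?exprn_gt0 ?divr_gt0//.
have B : 8 * 16 * 16 * C * (Lam ^+ 2 + 4) <= S * gap ^+ 2.
  move: S_large; rewrite mulrAC ler_pdivrMr ?exprn_gt0//; apply: le_trans.
  rewrite ler_wpM2l ?mulr_ge0//; first by have := C_ge1; lra.
  by rewrite lerDl sqr_ge0.
have P : 0 <= S * a ^+ 2 / (8 * 8 * 16) by rewrite divr_ge0 ?mulr_ge0 ?(ltW S_gt0) ?(ltW a_gt0).
have := ler_wpM2l P B.
rewrite !exprMn -[8^-1 ^+ 2]/(8^-1 * 8^-1).
move: (S) (a ^+ 2) (gap ^+ 2) (Lam ^+ 2) => S' A G L'; rewrite !expr2; lra.
Qed.

Lemma prob_mass_off : pprob (fun=> nu) mass_off <= 16^-1.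
Proof.
have C3 : 0 < 3 + Ce by have := Ce_ge0; lra.
have t0 : 0 < S * a * gap / 8 / (3 + Ce) by rewrite !divr_gt0.
have v0 (i : I) : \sum_y nu y * (a * u y) ^+ 2 <= a ^+ 2 * C.
  rewrite (eq_bigr (fun y => a ^+ 2 * (nu y * u y ^+ 2))); last by move=> y _; ring.
  by rewrite -mulr_sumr ler_wpM2l ?sqr_ge0//; apply: nu_bound; apply: leq_trans qm_ge4.
apply: le_trans (@pprob_chebyshev_mean _ _ _ (fun=> nu) (fun=> nu_sum) (fun=> nu_ge0)
  (fun _ y => a * u y) (a ^+ 2 * C) _ mass_off v0 t0 (fun w h => h)) _.
clear v0; rewrite ler_pdivrMr ?exprn_gt0 ?divr_gt0//.
have B : 8 * 16 * 16 * C * (3 + Ce) ^+ 2 <= S * gap ^+ 2.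
  move: S_large; rewrite mulrAC ler_pdivrMr ?exprn_gt0//; apply: le_trans.
  rewrite ler_wpM2l ?mulr_ge0//; first by have := C_ge1; lra.
  by rewrite lerDr; have := sqr_ge0 Lam; lra.
have SG : 0 <= S * gap ^+ 2 by rewrite mulr_ge0 ?sqr_ge0.
have {}B : (8 * 8 * 16) * C * (3 + Ce) ^+ 2 <= S * gap ^+ 2.
  have := sqr_ge0 (3 + Ce); have := C_ge1 => c1 c2.
  have : 0 <= C * (3 + Ce) ^+ 2 by rewrite mulr_ge0//; lra.
  by move: B; lra.
rewrite (_ : 16^-1 * _ = S * a ^+ 2 * (S * gap ^+ 2 / ((8 * 8 * 16) * (3 + Ce) ^+ 2))); last first.
  by field; rewrite gt_eqF.
rewrite [leLHS]mulrA ler_wpM2l ?mulr_ge0 ?(ltW a_gt0)//.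
by rewrite ler_pdivlMr ?mulr_gt0 ?exprn_gt0//; move: B; lra.
Qed.

End prior.

(** The mean of the sum of u^m is at most C S and [T] leaves a deviation of 4 C S, so the
    probability is at most C S / (4 C S)^2. The order 1 / S matters, as [mixture_prob_close] pays it
    once per cell. *)
Let cheb_tame (rho : I -> J -> R) : (forall i, rho i = nu0 \/ rho i = nu1) ->
  pprob rho (predC good) <= (16 * C * S)^-1.
Proof.
move=> rho01.
have r0 i y : 0 <= rho i y.
  by case: (rho01 i) => ->; [exact: matched_nu0_ge0 matched _|exact: matched_nu1_ge0 matched _].
have r1 i : \sum_y rho i y = 1.
  by case: (rho01 i) => ->; [exact: matched_nu0_sum matched|exact: matched_nu1_sum matched].
have C0 : 0 < C by have := C_ge1; lra.
have t0 : 0 < 4 * C * S by rewrite !mulr_gt0.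
have v0 i : \sum_y rho i y * (u y ^+ m) ^+ 2 <= C.
  under eq_bigr do rewrite -exprM; exact: prior_moment (rho01 i) _ _.
have off (w : {ffun I -> J}) : predC good w -> 4 * C * S <=
    `|\sum_i u (w i) ^+ m - \sum_i \sum_y rho i y * u y ^+ m|.
  rewrite /= /tame -ltNge => H.
  have M : \sum_i \sum_y rho i y * u y ^+ m <= C * S.
    rewrite mulr_natr -sumr_const; apply: ler_sum => i _.
    by apply: prior_moment (rho01 i) _ _; rewrite (leq_trans _ m_le)// leq_pmulr.
  by rewrite ler_normr; apply/orP; left; lra.
have := @pprob_chebyshev_mean _ _ _ rho r1 r0 (fun _ y => u y ^+ m) C _
  (predC good) v0 t0 off.
move/le_trans; apply.
rewrite ler_pdivrMr ?exprn_gt0 ?mulr_gt0// ler_pdivlMl ?mulr_gt0//.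
by rewrite le_eqVlt; apply/orP; left; apply/eqP; ring.
Qed.

Let tame_mass (w : {ffun I -> J}) : good w -> \sum_i u (w i) <= (1 + 5 * C) * S.
Proof.
move=> gw; apply: le_trans (sum_le_moment _ _ u_ge0 m_gt0) _.
by rewrite mulrDl mul1r lerD2l.
Qed.

Let room t (w : {ffun I -> J}) : \sum_(i | i != t) u (w i) ^+ m <= T ->
  a * (\sum_(i | i != t) u (w i) + K%:R ^+ 2) <= 1.
Proof.
move=> h; apply: le_trans room1; rewrite ler_wpM2l ?(ltW a_gt0)// lerD2r.
apply: le_trans (sum_le_moment _ _ u_ge0 m_gt0) _.
by rewrite mulrDl mul1r lerD2l.
Qed.

(** First moments agree since K > 1; the large bump thus has the same central entropy under both
    priors. *)
Let mean_mass_eq : mean_mass nu0 = mean_mass nu1.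
Proof.
apply: eq_bigr => i _.
have := matched_moment matched K_gt1.
under eq_bigr do rewrite expr1; under [RHS]eq_bigr do rewrite expr1.
move=> E; under eq_bigr do rewrite mulrCA; under [RHS]eq_bigr do rewrite mulrCA.
by rewrite -!mulr_sumr E.
Qed.

Let mean_mass_le nu : nu = nu0 \/ nu = nu1 -> mean_mass nu <= 2^-1.
Proof.
move=> nuE; apply: le_trans room2; rewrite /mean_mass.
rewrite (_ : a * _ = \sum_(i : I) (a * (1 + 5 * C))); last first.
  by rewrite sumr_const -[RHS]mulr_natr mulrA.
apply: ler_sum => i _; under eq_bigr do rewrite mulrCA.
rewrite -mulr_sumr ler_wpM2l ?(ltW a_gt0)//.
have := prior_moment nuE (leq_trans (isT : 1 <= 4)%N qm_ge4).
by under eq_bigr do rewrite expr1; have := C_ge1; lra.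
Qed.

Let mean_mass_ge0 nu : nu = nu0 \/ nu = nu1 -> 0 <= mean_mass nu.
Proof.
move=> nuE; apply: sumr_ge0 => i _; apply: sumr_ge0 => y _.
rewrite mulr_ge0 ?mulr_ge0 ?u_ge0 ?(ltW a_gt0)//.
by case: nuE => ->; [exact: matched_nu0_ge0 matched _|exact: matched_nu1_ge0 matched _].
Qed.

Let rest_entropy (x : R) := - ((1 - x) * ln (1 - x)) + (1 - x) * eta None.

Let center nu := \sum_i \sum_y nu y * cell_entropy i y + rest_entropy (mean_mass nu).

Let good_entropy nu : nu = nu0 \/ nu = nu1 -> forall w,
  [&& good w, ~~ entropy_off nu w & ~~ mass_off nu w] ->
  exists2 f, realizes s p L Q mass f w & `|entropy f - center nu| <= S * a * gap / 4.
Proof.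
move=> nuE w /and3P[gw ew mw]; have [f [Lf Ef lf]] := model gw.
have Mw0 : 0 <= \sum_i a * u (w i).
  by apply: sumr_ge0 => i _; rewrite mulr_ge0 ?u_ge0// ltW.
have Mw : \sum_i a * u (w i) <= 2^-1.
  rewrite -mulr_sumr; apply: le_trans room2; rewrite ler_wpM2l ?(ltW a_gt0)//.
  exact: tame_mass.
exists f.
  split => // -[i|] /=; first by rewrite mulr_ge0 ?u_ge0// ltW.
  by rewrite mulr_sumr; lra.
rewrite Ef sum_option /center.
have -> : - (mass w None * ln (mass w None)) + mass w None * eta None = rest_entropy (\sum_i a * u (w i)).
  by rewrite /= mulr_sumr.
set X := \sum_i a * u (w i) in Mw0 Mw *.
have C3 : 0 < 3 + Ce by have := Ce_ge0; lra.
have M0 := mean_mass_ge0 nuE; have M1 := mean_mass_le nuE.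
have HJ : `|rest_entropy X - rest_entropy (mean_mass nu)| <= S * a * gap / 8.
  move: mw; rewrite /mass_off -ltNge -/X ltr_pdivlMr// => mw.
  apply: le_trans (ltW mw); rewrite /rest_entropy.
  set x := 1 - X; set y := 1 - mean_mass nu.
  rewrite (_ : _ - _ = - (x * ln x - y * ln y) + (x - y) * eta None); last by ring.
  have -> : `|X - mean_mass nu| = `|x - y|.
    by rewrite -normrN; congr (`|_|); rewrite /x /y; ring.
  rewrite (le_trans (ler_normD _ _))// normrN normrM mulrDr; apply: lerD.
    rewrite mulrC [leRHS]mulrC mulrC; apply: xlnx_lipschitz; rewrite /x /y; apply/andP; split; lra.
  by rewrite ler_wpM2l.
have HE : `|\sum_i cell_entropy i (w i) - \sum_i \sum_y nu y * cell_entropy i y| <= S * a * gap / 8.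
  by move: ew; rewrite /entropy_off -ltNge => /ltW.
rewrite (_ : _ + _ - _ = (rest_entropy X - rest_entropy (mean_mass nu)) +
  (\sum_i cell_entropy i (w i) - \sum_i \sum_y nu y * cell_entropy i y)); last by rewrite /cell_entropy /=; ring.
by rewrite (le_trans (ler_normD _ _))//; lra.
Qed.

(** Only u ln u separates the priors, since the part of [cell_entropy] linear in [u] has equal
    means. The sign of - u ln u makes [nu1] the prior of larger entropy. *)
Let center_gap : center nu0 + S * a * gap <= center nu1.
Proof.
rewrite /center mean_mass_eq addrAC lerD2r -lerBrDl -sumrB.
rewrite (_ : S * a * gap = \sum_(i : I) a * gap); last first.
  by rewrite sumr_const -[RHS]mulr_natl mulrA.
apply: ler_sum => i _; rewrite -sumrB.
apply: (@le_trans _ _ (a * \sum_y (nu0 y - nu1 y) * (u y * ln (u y)) + (eta (Some i) - ln a) * a *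
   (\sum_y nu1 y * u y ^+ 1 - \sum_y nu0 y * u y ^+ 1))).
  rewrite (matched_moment matched K_gt1) subrr mulr0 addr0 ler_wpM2l ?(ltW a_gt0)//.
  exact: matched_gap matched.
rewrite le_eqVlt; apply/orP; left; apply/eqP.
rewrite -sumrB !mulr_sumr -big_split; apply: eq_bigr => y _ /=.
rewrite /cell_entropy expr1; have [->|un0] := eqVneq (u y) 0; first by rewrite !(mulr0, mul0r); ring.
have up : 0 < u y by rewrite lt0r un0 u_ge0.
    by rewrite lnM ?posrE//; ring.
Qed.

(** Good draws have entropy within S a gap / 4 of the center, and the centers are S a gap apart;
    this leaves S a gap / 4 on either side of the midpoint for [le_cam]. *)
Lemma fuzzy_lower_bound :
  (((S * a * gap) ^+ 2 / 64)%:E <= minimax_mse d n s p L)%E.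
Proof.
have -> : (S * a * gap) ^+ 2 / 64 = (S * a * gap / 4) ^+ 2 / 4 by field.
have Sag : 0 < S * a * gap by rewrite !mulr_gt0.
pose G (nu : J -> R) (w : {ffun I -> J}) := [&& good w, ~~ entropy_off nu w & ~~ mass_off nu w].
pose W (nu : J -> R) (w : {ffun I -> J}) : R := \prod_i nu (w i).
have n0 : forall j, 0 <= nu0 j := matched_nu0_ge0 matched.
have n1 : forall j, 0 <= nu1 j := matched_nu1_ge0 matched.
have s0 := matched_nu0_sum matched; have s1 := matched_nu1_sum matched.
have W0 (nu : J -> R) : (forall j, 0 <= nu j) -> forall w, 0 <= W nu w.
  by move=> h w; exact: prodr_ge0.
have sumW (nu : J -> R) (A : pred {ffun I -> J}) (F : {ffun I -> J} -> R) :
    \sum_(w | A w) W nu w * F w = pexp (fun=> nu) (fun w => (A w)%:R * F w).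
  rewrite big_mkcond; apply: eq_bigr => w _.
  by case: (A w); rewrite ?mul1r// mul0r mulr0.
have sumW1 (nu : J -> R) (A : pred {ffun I -> J}) : \sum_(w | A w) W nu w = pprob (fun=> nu) A.
  transitivity (\sum_(w | A w) W nu w * 1); first by apply: eq_bigr => w _; rewrite mulr1.
  by rewrite sumW; apply: eq_pexp => w; rewrite mulr1.
have le1 (nu : J -> R) (A : pred {ffun I -> J}) : (forall j, 0 <= nu j) -> \sum_j nu j = 1 ->
    pprob (fun=> nu) A <= 1.
  move=> h h1; rewrite -[leRHS](@pexp1 R I J (fun=> nu) (fun=> h1)).
  by apply: ler_pexp => // w; case: (A w).
have badG (nu : J -> R) : nu = nu0 \/ nu = nu1 -> (forall j, 0 <= nu j) -> \sum_j nu j = 1 ->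
    pprob (fun=> nu) (predC (G nu)) <= 3 / 16.
  move=> nuE h h1.
  apply: (@le_trans _ _ (pprob (fun=> nu) (predU (predC good) (predU (entropy_off nu) (mass_off nu))))).
    apply: pprob_le => // w /=; rewrite /G !negb_and !negbK.
    by move=> /orP[->//|/orP[->|->]]; rewrite ?orbT.
  apply: le_trans (pprobU _ _ _) _ => //.
  apply: le_trans (lerD (lexx _) (pprobU _ _ _)) _ => //.
  have := cheb_tame (rho := fun=> nu) (fun=> nuE).
  have := prob_entropy_off nuE; have := prob_mass_off nuE => p1 p2 p3.
  have : (16 * C * S)^-1 <= 16^-1.
    rewrite lef_pV2 ?posrE ?mulr_gt0//; [|by have := C_ge1; lra].
    by have := C_ge1; have := S_ge1; nra.
  by lra.
apply: (@le_cam _ d n s p L _ _ Q mass (G nu1) (G nu0) (W nu1) (W nu0)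
   ((center nu0 + center nu1) / 2)).
- by rewrite divr_ge0// ltW.
- exact: W0.
- exact: W0.
- by rewrite sumW1 le1.
- by rewrite sumW1 le1.
- move=> w /(good_entropy (or_intror erefl))[f rf Ef]; exists f => //.
  by move: Ef center_gap; rewrite ler_norml => /andP[]; lra.
- move=> w /(good_entropy (or_introl erefl))[f rf Ef]; exists f => //.
  by move: Ef center_gap; rewrite ler_norml => /andP[]; lra.
move=> kappa k01; rewrite !sumW.
have M01 w : good w -> 0 <= pexp (fun=> mass w) kappa <= 1.
  move=> gw; have [t|no] := pickP (fun _ : I => true).
    move=> _; exact: (mixture_prob_tame matched k01 (ltW a_gt0) (fun j => exprn_ge0 m (u_ge0 j)) room t gw).
  by move: S_gt0; rewrite (eq_card0 no) ltxx.
have TV := mixture_prob_close matched k01 (ltW a_gt0) (fun j => exprn_ge0 m (u_ge0 j)) room cheb_tame.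
set TM := tame_mixture _ _ _ _ _ in TV.
(* The exchanges cost 1/16 by [tail_small] and 1/16 by [cheb_tame], over all cells. *)
have {}TV : `|pexp (fun=> nu0) TM - pexp (fun=> nu1) TM| <= 8^-1.
  apply: le_trans TV _; rewrite mulrDr.
  have : S * (16 * C * S)^-1 <= 16^-1.
    rewrite invfM mulrCA mulfV ?gt_eqF// mulr1 lef_pV2 ?posrE ?mulr_gt0//; have := C_ge1; lra.
  by move: tail_small; lra.
have b1 := badG nu1 (or_intror erefl) n1 s1; have b0 := badG nu0 (or_introl erefl) n0 s0.
have E1 : pexp (fun=> nu1) TM - pprob (fun=> nu1) (predC (G nu1)) <=
    pexp (fun=> nu1) (fun w => (G nu1 w)%:R * pexp (fun=> mass w) kappa).
  rewrite -pexpB; apply: ler_pexp => // w; rewrite /TM /tame_mixture /mixture_prob /=.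
  have := M01 w; rewrite /G; case: (good w) => /=; last by rewrite !mul0r sub0r oppr_le0.
  move=> /(_ isT)/andP[m0 m1]; case: (_ && _); rewrite /= !mul1r ?subr0// mul0r.
  by rewrite subr_le0.
have E0 : 1 - pprob (fun=> nu0) (predC (G nu0)) - pexp (fun=> nu0) TM <=
    pexp (fun=> nu0) (fun w => (G nu0 w)%:R * (1 - pexp (fun=> mass w) kappa)).
  rewrite -[X in X - _ - _ <= _](@pexp1 R I J (fun=> nu0) (fun=> s0)).
  rewrite -!pexpB; apply: ler_pexp => // w; rewrite /TM /tame_mixture /mixture_prob /=.
  have := M01 w; rewrite /G; case: (good w) => /=; last by rewrite !mul0r subr0 subrr.
  move=> /(_ isT)/andP[m0 m1]; case: (_ && _); rewrite /=.
    by rewrite !mul1r mulr0n subr0.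
  by rewrite mul1r mul0r subrr sub0r oppr_le0.
(* Each prior loses 3/16 to its three bad events, and the budget is met exactly: 1 - 3/16 - 3/16 -
   1/8 = 1/2. *)
by move: TV; rewrite ler_norml => /andP[]; move: b0 b1 E0 E1; lra.
Qed.

End fuzzy_lower_bound.

(** * The parametric term *)

Section coin.
Variables (R : realType) (I : finType) (i0 : I) (n : nat).

Definition coin (e : R) (o : option I) : R :=
  if o is Some i then if i == i0 then 2^-1 + e else 0 else 2^-1 - e.

Lemma sum_coin (F : option I -> R) :
  (forall i, i != i0 -> F (Some i) = 0) -> \sum_o F o = F None + F (Some i0).
Proof.
by move=> F0; rewrite sum_option (bigD1 i0)//= [X in _ + (_ + X)]big1 ?addr0.
Qed.

Lemma coin_sum (e : R) : \sum_o coin e o = 1.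
Proof.
rewrite sum_coin => [|i ii]; rewrite /= ?eqxx ?(negbTE ii)//; lra.
Qed.

(** The second moment of the likelihood ratio of [n] draws, that is, 1 plus a chi-squared
    divergence. *)
Lemma coin_likelihood (g : R) :
  \prod_(l < n) \sum_o coin 0 o * (if o is Some _ then 1 + g else 1 - g) ^+ 2 = (1 + g ^+ 2) ^+ n.
Proof.
rewrite prodr_const card_ord; congr (_ ^+ n).
by rewrite sum_coin => [|i ii]; rewrite /= ?eqxx ?(negbTE ii) ?mul0r//; field.
Qed.

(** The likelihood ratio has second moment at most exp (1/16) <= 16/15, so its variance is at most
    1/15, and 1/15 + 1/4 <= 1/2. *)
Lemma coin_close (e : R) (kappa : {ffun 'I_n -> option I} -> R) :
  (forall c, 0 <= kappa c <= 1) -> e ^+ 2 * 64 * n%:R <= 1 ->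
  pexp (fun=> coin e) kappa - pexp (fun=> coin 0) kappa <= 2^-1.
Proof.
move=> k01 en.
pose g (o : option I) : R := if o is Some _ then 1 + 2 * e else 1 - 2 * e.
have coinE o : coin e o = coin 0 o * g o.
  by case: o => [i|] /=; [case: eqP => _|]; rewrite /g; lra.
pose X (c : {ffun 'I_n -> option I}) := \prod_l g (c l).
have c0 (i : 'I_n) o : 0 <= coin 0 o by case: o => [j|] /=; [case: eqP|]; lra.
have EX F : pexp (fun=> coin e) F = pexp (fun=> coin 0) (fun c => X c * F c).
  apply: eq_bigr => c _; rewrite mulrA; congr (_ * _); rewrite -big_split.
  by apply: eq_bigr => l _; exact: coinE.
have s1 (e' : R) : pexp (fun=> coin e') (fun _ : {ffun 'I_n -> option I} => 1) = 1.
  by apply: pexp1 => _; exact: coin_sum.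
have X1 : pexp (fun=> coin 0) X = 1.
  rewrite -[RHS](s1 e) EX; apply: eq_pexp => c; by rewrite mulr1.
have X2 : pexp (fun=> coin 0) (fun c => X c ^+ 2) <= 16 / 15.
  have -> : pexp (fun=> coin 0) (fun c => X c ^+ 2) = (1 + (2 * e) ^+ 2) ^+ n.
    rewrite -(coin_likelihood (2 * e)) -pexp_prod; apply: eq_pexp => c.
    by rewrite /X -prodrXl.
  apply: (@le_trans _ _ (expR ((2 * e) ^+ 2) ^+ n)).
    apply: lerXn2r; rewrite ?nnegrE ?expR_ge0//; last exact: expR_ge1Dx.
    by rewrite addr_ge0 ?sqr_ge0.
  rewrite -expRM_natl.
  set x := n%:R * _; have x0 : x <= 16^-1 by rewrite /x exprMn; move: en; lra.
  have := expR_ge1Dx (- x); rewrite expRN => h.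
  have xp := expR_gt0 x; have : (1 - x) * expR x <= 1.
    by rewrite -ler_pdivlMr// mul1r.
  by nra.
rewrite EX -pexpB.
(* [|x| <= x ^ 2 + 1/4] plays the role of the Cauchy-Schwarz inequality. *)
apply: (@le_trans _ _ (pexp (fun=> coin 0) (fun c => X c ^+ 2 - 2 * X c + 1 + 4^-1))).
  apply: ler_pexp => // c; have /andP[k0 k1] := k01 c.
  rewrite -[X in _ - X]mul1r -mulrBl.
  apply: (@le_trans _ _ (`|X c - 1|)).
    rewrite (le_trans (ler_norm _))// normrM (ger0_norm k0) ler_piMr//.
  have := sqr_ge0 (`|X c - 1| - 2^-1); have := real_normK (num_real (X c - 1)).
  by rewrite !expr2; lra.
have -> : pexp (fun=> coin 0) (fun c => X c ^+ 2 - 2 * X c + 1 + 4^-1) =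
    pexp (fun=> coin 0) (fun c => X c ^+ 2) - 2 * pexp (fun=> coin 0) X +
    (1 + 4^-1) * pexp (fun=> coin 0) (fun _ : {ffun 'I_n -> option I} => 1).
  by rewrite -!pexpZ -pexpB -pexpD; apply: eq_pexp => c; ring.
by rewrite X1 s1; lra.
Qed.

End coin.

Section two_point.
Variables (R : realType) (d n : nat) (s : R) (p : \bar R) (L : R).
Variables (I : finType) (i0 : I) (eta : option I -> R).
Variables (Q : option I -> probability 'rV[R]_d R) (D : R).
Hypotheses (n_gt0 : (0 < n)%N) (D_ge0 : 0 <= D) (D_le : D <= eta None - eta (Some i0)).
Hypothesis model : forall q : option I -> R, (forall o, 0 <= q o) -> \sum_o q o = 1 ->
  exists f : density R d, [/\ lip_ball s p L f,
    entropy f = \sum_o (- (q o * ln (q o)) + q o * eta o) &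
    forall A, measurable A -> law f A = (\sum_o (q o)%:E * Q o A)%E].


Lemma coin_entropy (e : R) : 0 <= e -> e <= 8^-1 ->
  - ((2^-1 + e) * ln (2^-1 + e)) - (2^-1 - e) * ln (2^-1 - e) <= ln 2.
Proof.
move=> e0 e8; have x0 : 0 < 2^-1 + e by lra.
have y0 : 0 < 2^-1 - e by lra.
(* The tangent at 1/2 of the concave function - z ln z. *)
have U (z : R) : 0 < z -> - (z * ln z) <= 2^-1 - z + z * ln 2.
  move=> z0; have := @ln_le_subr1 R (2 * z)^-1; rewrite invr_gt0 mulr_gt0//.
  rewrite lnV ?posrE ?mulr_gt0// lnM ?posrE// => /(_ isT) h.
  have := ler_wpM2l (ltW z0) h; rewrite mulrBr mulr1 invfM mulrCA mulfV ?gt_eqF//; lra.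
by have := U _ x0; have := U _ y0; lra.
Qed.

(** Moving [e] from the large bump to the small one cannot raise the label entropy above ln 2, and
    lowers the mean bump entropy by at least e D: the two entropies lie on either side of [mid], at
    distance at least e D / 2. The value of [e] is the largest that [coin_close] accepts. *)
Lemma two_point_lower_bound :
  (((D / (32 * Num.sqrt n%:R)) ^+ 2)%:E <= minimax_mse d n s p L)%E.
Proof.
have n0 : 0 < Num.sqrt n%:R :> R by rewrite sqrtr_gt0 ltr0n.
have n1 : 1 <= Num.sqrt n%:R :> R by rewrite -[leLHS]sqrtr1 ler_sqrt ?ler1n ?ltr0n.
pose e : R := (8 * Num.sqrt n%:R)^-1.
have e0 : 0 < e by rewrite invr_gt0 mulr_gt0.
have e8 : e <= 8^-1 by rewrite lef_pV2 ?posrE ?mulr_gt0//; lra.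
have en : e ^+ 2 * 64 * n%:R <= 1.
  rewrite -(sqr_sqrtr (ler0n R n)) /e le_eqVlt; apply/orP; left; apply/eqP; field.
  by rewrite gt_eqF.
have -> : (D / (32 * Num.sqrt n%:R)) ^+ 2 = (e * D / 2) ^+ 2 / 4.
  by rewrite /e; field; rewrite gt_eqF.
have coin_ge0 (x : R) o : 0 <= x <= 8^-1 -> 0 <= coin i0 x o.
  by move=> /andP[x0 x1]; case: o => [i|] /=; [case: eqP => _|]; lra.
pose q (b : bool) := coin i0 (if b then 0 else e).
have q0 b o : 0 <= q b o by apply: coin_ge0; case: b; apply/andP; split; lra.
pose mid : R := ln 2 + (eta (Some i0) + eta None) / 2 - e * D / 2.
have realize b : exists2 f, realizes s p L Q q f b &
    entropy f = q b None * (eta None - ln (q b None)) +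
      q b (Some i0) * (eta (Some i0) - ln (q b (Some i0))).
  have [f [Lf Ef lf]] := model (q0 b) (coin_sum i0 _).
  exists f => //; rewrite Ef (sum_coin (i0 := i0)) => [|i ii]; first by ring.
  by rewrite /q /= (negbTE ii) !mul0r oppr0 addr0.
apply: (@le_cam _ d n s p L _ _ Q q id negb (fun=> 1) (fun=> 1) mid) => //.
- by rewrite divr_ge0 ?mulr_ge0 ?(ltW e0).
- by rewrite big_mkcond big_bool/= addr0.
- by rewrite big_mkcond big_bool/= add0r.
- move=> [] // _; have [f Rf Ef] := realize true; exists f => //.
  rewrite Ef /q /mid /= eqxx addr0 subr0 lnV ?posrE//; lra.
- move=> [] // _; have [f Rf Ef] := realize false; exists f => //.
  have := coin_entropy (ltW e0) e8; have := ler_wpM2l (ltW e0) D_le.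
  by rewrite Ef /q /mid /= eqxx; lra.
move=> kappa k01; rewrite big_mkcond big_bool [X in _ + X]big_mkcond big_bool/=.
have := coin_close i0 k01 en; rewrite /q !mul1r addr0 add0r; lra.
Qed.

End two_point.

(** * Choice of the parameters *)

Lemma ln_affine_le (R : realType) (A B e : R) : 0 < A -> 0 < e ->
  exists X0 : R, forall X, X0 <= X -> 0 < X -> A * ln X + B <= e * X.
Proof.
(* The logarithm lies below its tangent at [t], and A / t = e / 2 leaves half of e X for the
   constants. *)
move=> A0 e0; pose t := 2 * A / e.
have t0 : 0 < t by rewrite divr_gt0// mulr_gt0.
exists (2 * (A * ln t + B) / e) => X; rewrite ler_pdivrMr// => XB X0.
have : ln (X / t) <= X / t - 1 by apply: ln_le_subr1; rewrite divr_gt0.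
rewrite ln_div ?posrE// => h.
have := ler_wpM2l (ltW A0) h.
have -> : A * (X / t - 1) = e * X / 2 - A by rewrite /t; field; rewrite !gt_eqF.
by lra.
Qed.

(** [N] is the integer part of Y = W^(1 / (s + d)); since Y >= 1, it is at least Y / 2. *)
Lemma grid_size (R : realType) (d : nat) (s W : R) : (0 < d)%N -> 0 < s -> 1 <= W ->
  exists2 N : nat, (0 < N)%N &
  [/\ N%:R `^ (d%:R + s) <= W, (N ^ d)%:R <= W `^ (d%:R / (s + d%:R)) &
      2^-1 ^+ d * W `^ (d%:R / (s + d%:R)) <= (N ^ d)%:R].
Proof.
move=> d0 s0 W1; have W0 : 0 < W by lra.
have D0 : 0 < d%:R :> R by rewrite ltr0n.
have sd0 : 0 < s + d%:R by rewrite addr_gt0.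
pose Y := W `^ (s + d%:R)^-1.
have Y1 : 1 <= Y.
  by rewrite -(powRr0 W) ler_powR// invr_ge0 ltW.
have Y0 : 0 <= Y by lra.
have YW : Y `^ (d%:R + s) = W.
  by rewrite -powRrM (addrC d%:R) mulVf ?gt_eqF// powRr1// ltW.
have Yd : W `^ (d%:R / (s + d%:R)) = Y ^+ d.
  by rewrite -powR_mulrn// -powRrM mulrC.
have /andP[NY YN] := truncn_itv Y0.
have N0 : (0 < Num.truncn Y)%N by rewrite truncn_gt0.
exists (Num.truncn Y) => //; split.
- by rewrite -[leRHS]YW; apply: ge0_ler_powR; rewrite ?nnegrE ?addr_ge0 ?(ltW s0).
- by rewrite Yd natrX lerXn2r// nnegrE.
rewrite Yd natrX -exprMn lerXn2r ?nnegrE ?mulr_ge0//.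
have : 1 <= (Num.truncn Y)%:R :> R by rewrite ler1n.
by move: YN; rewrite -natr1; lra.
Qed.

(** Masses are at most 1, so N^(d + s) can be of order L / (2 Cl). Then d ln N is d / (s + d) times
    ln L up to constants, and [L0] is such that half of it survives the total loss [B]. *)
Lemma parametric_lower_bound (R : realType) (d : nat) (s : R) (p : \bar R) :
  (0 < d)%N -> 0 < s -> (1 <= p)%E ->
  exists L0 c0 : R, 1 < L0 /\ 0 < c0 /\ forall (n : nat) (L : R), (0 < n)%N -> L0 <= L ->
    (((c0 * (n%:R `^ (- 2^-1) * ln L)) ^+ 2)%:E <= minimax_mse d n s p L)%E.
Proof.
move=> d0 s0 p1; have [Ce [Cl [Cl0 model]]] := bump_model d0 s0 p1.
have D0 : 0 < d%:R :> R by rewrite ltr0n.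
have sd0 : 0 < s + d%:R by rewrite addr_gt0.
pose e := d%:R / (s + d%:R); have e0 : 0 < e by rewrite divr_gt0.
pose B := e * ln (2 * Cl) + d%:R * ln 2 + 2 * Ce.
pose L0 := expR (2 * `|B| / e + 1) + 2 * Cl.
have B0 : 0 <= 2 * `|B| / e by rewrite divr_ge0 ?(ltW e0) ?mulr_ge0.
exists L0, (e / 2 / 32); split; [|split].
- have : 1 < expR (2 * `|B| / e + 1) by rewrite expR_gt1; lra.
  by rewrite /L0; lra.
- by rewrite !divr_gt0.
move=> n L n0 LL; have Lp : 0 < L.
  by have := expR_gt0 (2 * `|B| / e + 1); move: LL; rewrite /L0; lra.
have LCl : 2 * Cl <= L by have := expR_gt0 (2 * `|B| / e + 1); move: LL; rewrite /L0; lra.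
have lnL : 2 * `|B| / e <= ln L.
  rewrite -[leLHS]expRK ler_ln ?posrE ?expR_gt0//; apply: le_trans LL.
  rewrite /L0 (@le_trans _ _ (expR (2 * `|B| / e + 1)))//; last lra.
  by rewrite ler_expR; lra.
pose W := L / (2 * Cl).
have W1 : 1 <= W by rewrite ler_pdivlMr ?mulr_gt0// mul1r.
have W0 : 0 < W by lra.
have [N N0 [NW _ Nl]] := grid_size d0 s0 W1.
have [eta [Q [eN eS fam]]] := model N N0.
pose i0 : {ffun 'I_d -> 'I_N} := [ffun=> Ordinal N0].
have Nr : 0 < N%:R :> R by rewrite ltr0n.
have lnN : e * ln W - d%:R * ln 2 <= d%:R * ln N%:R.
  have : ln (2^-1 ^+ d * W `^ e) <= ln ((N ^ d)%:R : R).
    rewrite ler_ln ?posrE ?mulr_gt0 ?exprn_gt0 ?powR_gt0//.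
    by rewrite ltr0n expn_gt0 N0.
  rewrite lnM ?posrE ?exprn_gt0 ?powR_gt0// ln_powR natrX !lnXn//.
  rewrite lnV ?posrE// -[ln N%:R *+ d]mulr_natl -[(- ln 2) *+ d]mulr_natl; lra.
have sep : e / 2 * ln L <= eta None - eta (Some i0).
  have := eS i0; move: eN; rewrite !ler_norml => /andP[u1 u2] /andP[u3 u4].
  have : B <= e / 2 * ln L.
    move: lnL; rewrite ler_pdivrMr//; have := ler_norm B; lra.
  move: lnN; rewrite /W ln_div ?posrE ?mulr_gt0//; rewrite /B; lra.
have lnL0 : 0 <= ln L by rewrite (le_trans B0).
have H := @two_point_lower_bound R d n s p L _ i0 eta Q (e / 2 * ln L) n0 _ sep.
have -> : e / 2 / 32 * (n%:R `^ (- 2^-1) * ln L) = e / 2 * ln L / (32 * Num.sqrt n%:R).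
  have t0 : Num.sqrt n%:R != 0 :> R by rewrite gt_eqF// sqrtr_gt0 ltr0n.
  by rewrite powRN powR12_sqrt//; field.
apply: H; first by rewrite mulr_ge0// divr_ge0// (ltW e0).
move=> q q0 q1; have [f [Ef lf Lf]] := fam q q0 q1; exists f; split => //.
apply: (Lf 1) => //.
  left => i; rewrite -q1 (bigD1 (Some i))//= lerDl sumr_ge0//.
rewrite mulr1; have := ler_wpM2l (ltW Cl0) NW.
have -> : Cl * W = L / 2 by rewrite /W; field; rewrite gt_eqF.
by lra.
Qed.

(** The choice of [a] makes n z e^2 equal to [K], so [sum_exp_card_ge] at theta = e^2 gives e^(- 2
    K) e^K = e^(- K) <= n^(-3). Two powers of n pay for [S] and the last one, as n >= 32, for the
    constants. *)
Lemma fuzzy_tail (R : realType) (n K : nat) (S : R) : (32 <= n)%N -> (0 < K)%N ->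
  0 <= S -> S <= n%:R ^+ 2 -> 3 * ln n%:R <= K%:R :> R ->
  S * (2 * \sum_(D : {set 'I_n} | (K <= #|D|)%N)
    (2 * (expR (- 2) / 2 / (n%:R * K%:R) * K%:R ^+ 2)) ^+ #|D|) <= 16^-1.
Proof.
move=> n32 K0 S0 Sn XK.
have n0 : 0 < n%:R :> R by rewrite ltr0n (leq_trans _ n32).
have k0 : 0 < K%:R :> R by rewrite ltr0n.
set z := 2 * (_ / _ / _ * _); have zE : z = expR (- 2) * K%:R / n%:R.
  rewrite /z; move: (expR (- 2)) => t; by field; rewrite !gt_eqF.
have z0 : 0 <= z by rewrite zE divr_ge0 ?mulr_ge0 ?expR_ge0 ?ler0n.
have th1 : 1 <= expR 2 :> R by rewrite -expR0 ler_expR.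
have T : \sum_(D : {set 'I_n} | (K <= #|D|)%N) z ^+ #|D| <= n%:R ^- 3.
  apply: le_trans (sum_exp_card_ge n K z0 th1) _.
  have -> : n%:R * (z * expR 2) = K%:R :> R.
    rewrite zE expRN; have : expR 2 != 0 :> R by rewrite gt_eqF ?expR_gt0.
    by move: (expR 2) => t t0; field; rewrite t0 gt_eqF.
  have nE : n%:R = expR (ln n%:R) :> R by rewrite lnK ?posrE.
  rewrite {1}nE -!expRM_natl -!expRN -expRD ler_expR; lra.
have -> : 16^-1 = n%:R ^+ 2 * (2 * n%:R ^- 3) + (16^-1 - 2 / n%:R) :> R.
  by field; rewrite gt_eqF.
have : 2 / n%:R <= 16^-1 :> R.
  by rewrite ler_pdivrMr//; move: n32; rewrite -(ler_nat R); lra.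
have := ler_pM S0 _ Sn (ler_wpM2l (ler0n R 2) T).
rewrite mulr_ge0 ?sumr_ge0// => [/(_ isT)|D _]; last exact: exprn_ge0.
by lra.
Qed.

(** For g = K^2 each small mass is at most a K^2. For g = 5 C the event [tame] is itself the moment
    bound, since 5 C <= (5 C)^m. *)
Lemma tame_masses_model (R : realType) (d : nat) (s : R) (p : \bar R) (N K q m : nat)
    (J : finType) (u nu0 nu1 : J -> R) (C gap a g L Cl : R)
    (eta : option {ffun 'I_d -> 'I_N} -> R)
    (Q : option {ffun 'I_d -> 'I_N} -> probability 'rV[R]_d R)
    (w : {ffun {ffun 'I_d -> 'I_N} -> J}) :
  matched_pair u nu0 nu1 K q C gap -> (0 < m)%N -> 0 < a ->
  a * ((1 + 5 * C) * (N ^ d)%:R) <= 1 ->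
  (g = K%:R ^+ 2 \/ (p <= m%:R%:E)%E /\ g = 5 * C) ->
  Cl * (1 + N%:R `^ (d%:R + s) * (a * g)) <= L ->
  (forall q : option {ffun 'I_d -> 'I_N} -> R,
    (forall o, 0 <= q o) -> \sum_o q o = 1 ->
    exists f : density R d,
    [/\ entropy f = \sum_o (- (q o * ln (q o)) + q o * eta o),
        forall A, measurable A -> law f A = (\sum_o (q o)%:E * Q o A)%E &
        forall G L : R, 0 <= G ->
          (forall i, q (Some i) <= G) \/
          (exists2 m : nat, (p <= m%:R%:E)%E &
             \sum_i q (Some i) ^+ m <= (N ^ d)%:R * G ^+ m) ->
          Cl * (1 + N%:R `^ (d%:R + s) * G) <= L -> lip_ball s p L f]) ->
  tame (fun j => u j ^+ m) (5 * C * #|{ffun 'I_d -> 'I_N}|%:R) w ->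
  exists f : density R d, [/\ lip_ball s p L f,
    entropy f = \sum_o (- (masses u a w o * ln (masses u a w o)) + masses u a w o * eta o) &
    forall A, measurable A -> law f A = (\sum_o (masses u a w o)%:E * Q o A)%E].
Proof.
move=> matched m0 a0 room gE CL fam tw; have u0 := matched_ge0 matched.
have C1 := matched_bound_ge1 matched.
have cI : #|{ffun 'I_d -> 'I_N}| = (N ^ d)%N by rewrite card_ffun !card_ord.
have mass : a * \sum_i u (w i) <= 1.
  apply: le_trans room; rewrite ler_wpM2l ?(ltW a0)//.
  apply: le_trans (sum_le_moment _ _ u0 m0) _.
  by rewrite cI mulrDl mul1r lerD2l -cI.
have q0 o : 0 <= masses u a w o.
  case: o => [i|] /=; first by rewrite mulr_ge0// ltW.
  by rewrite subr_ge0.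
have [f [Ef lf Lf]] := fam _ q0 (masses_sum u a w).
have g0 : 0 <= g by case: gE => [->|[_ ->]]; [rewrite exprn_ge0|lra].
exists f; split => //; apply: (Lf (a * g)) => //; first by rewrite mulr_ge0// ltW.
case: gE => [->|[pm gE]].
  by left => i /=; rewrite ler_wpM2l ?(ltW a0)//; exact: matched_le matched _.
right; exists m => //=; under eq_bigr do rewrite exprMn.
rewrite -mulr_sumr [(a * g) ^+ m]exprMn [leRHS]mulrCA ler_wpM2l ?exprn_ge0 ?(ltW a0)//.
apply: le_trans tw _; rewrite cI mulrC ler_wpM2l// gE -[leLHS]expr1 ler_weXn2l//; lra.
Qed.

(** The range of [L] forces [n] to be large, since ln (n ln n) <= 2 ln n; for n <= 1 the upper end
    of the range is 0. *)
Lemma sample_size_large (R : realType) (s D X0 L : R) (n : nat) : 0 < s -> 0 < D ->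
  expR (2 * s * X0 / D) <= L -> L <= (n%:R * ln n%:R) `^ (s / D) ->
  (1 < n)%N /\ X0 <= ln n%:R.
Proof.
move=> s0 D0 XL LX; have L0 : 0 < L by apply: lt_le_trans XL; exact: expR_gt0.
have sD : 0 < s / D by rewrite divr_gt0.
have n1 : (1 < n)%N.
  rewrite ltnNge; apply/negP => n1; have : n%:R * ln n%:R = 0 :> R.
    by move: n1; case: n {LX} => [|[|]] // _; rewrite ?mul0r// ln1 mulr0.
  by move=> E; move: LX; rewrite E powR0 ?gt_eqF// leNgt L0.
split => //; have n0 : 0 < n%:R :> R by rewrite ltr0n ltnW.
have X : 0 < ln n%:R :> R by rewrite ln_gt0// ltr1n.
have : ln L <= s / D * (2 * ln n%:R).
  apply: (@le_trans _ _ (ln ((n%:R * ln n%:R) `^ (s / D)))).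
    by rewrite ler_ln ?posrE// powR_gt0// mulr_gt0.
  rewrite ln_powR ler_wpM2l ?(ltW sD)// lnM ?posrE//.
  have := ln_le_subr1 X; lra.
have : 2 * s * X0 / D <= ln L by rewrite -[leLHS]expRK ler_ln ?posrE ?expR_gt0.
have -> : 2 * s * X0 / D = s / D * (2 * X0) by ring.
by move=> h1 h2; have := le_trans h1 h2; rewrite ler_pM2l// ler_pM2l.
Qed.

(** [X] stands for ln n, so exp X / X is n / ln n. After taking logarithms, each claim compares ln X
    with a linear function of X. *)
Lemma exists_threshold (R : realType) (A B : R) (e : R) : 0 < e -> 0 < A -> 0 < B ->
  exists X0 : R, forall X, X0 <= X ->
  [/\ 1 <= X, 4 * X <= expR X, 32 <= expR X, 1 <= A * (expR X / X) &
      B * X ^+ 2 <= (A * (expR X / X)) `^ e].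
Proof.
move=> e0 A0 B0; have [X1 h1] := ln_affine_le (ln 4) (ltr01 : 0 < 1 :> R) ltr01.
have [X2 h2] := ln_affine_le (- ln A) (ltr01 : 0 < 1 :> R) ltr01.
have A2 : 0 < 2 + e by lra.
have [X3 h3] := ln_affine_le (ln B - e * ln A) A2 e0.
exists (`|X1| + `|X2| + `|X3| + 1 + ln 32) => X XX.
have l32 : 0 <= ln 32 :> R by rewrite ln_ge0// ler1n.
have n1 := normr_ge0 X1; have n2 := normr_ge0 X2; have n3 := normr_ge0 X3.
have m1 := ler_norm X1; have m2 := ler_norm X2; have m3 := ler_norm X3.
have XX1 : 1 <= X by lra.
have X0 : 0 < X by lra.
have {}h1 := h1 X _ X0; have {}h2 := h2 X _ X0; have {}h3 := h3 X _ X0.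
have AX : 0 < A * (expR X / X) by rewrite mulr_gt0// divr_gt0// expR_gt0.
have lAX : ln (A * (expR X / X)) = ln A + X - ln X.
  by rewrite lnM ?posrE ?divr_gt0 ?expR_gt0// ln_div ?posrE ?expR_gt0// expRK addrA.
have lnle (x y : R) : 0 < x -> 0 < y -> ln x <= ln y -> x <= y.
  by move=> x0 y0; rewrite ler_ln.
split => //.
- apply: lnle; rewrite ?mulr_gt0 ?expR_gt0//.
  rewrite expRK lnM ?posrE//; lra.
- by apply: lnle; rewrite ?expR_gt0// expRK; lra.
- by apply: lnle; rewrite ?ln1 ?lAX//; lra.
apply: lnle; rewrite ?mulr_gt0 ?exprn_gt0 ?powR_gt0// ln_powR lAX.
rewrite lnM ?posrE ?exprn_gt0// lnXn// -[_ *+ 2]mulr_natl; lra.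
Qed.

(** c1 L n K / g is the budget for N^(d + s). It grows with n / ln n; it keeps the number of cells
    below a multiple of n K, hence of 1 / a, which is where the upper bound on [L] enters; and its
    power is n K times the announced rate. *)
Lemma mass_scale (R : realType) (s D c1 C n X K L g : R) :
  0 < s -> 0 < D -> 0 < c1 -> 1 <= C -> 0 < n -> 1 <= X -> X <= K -> K <= 4 * X ->
  1 <= L -> L <= (n * X) `^ (s / D) -> 1 <= g -> g <= 5 * C * K ^+ 2 ->
  [/\ c1 / (20 * C) * (n / X) <= c1 * L * (n * K) / g,
      (c1 * L * (n * K) / g) `^ (D / (s + D)) <= c1 `^ (D / (s + D)) * (n * K) &
      (c1 * L * (n * K) / g) `^ (D / (s + D)) = c1 `^ (D / (s + D)) * (n * K) *
        (L `^ (D / (s + D)) * g `^ (- (D / (s + D))) * (n * K) `^ (- (s / (s + D))))].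
Proof.
move=> s0 D0 c0 C1 n0 X1 XK K4 L1 LX g1 gK.
have X0 : 0 < X by lra.
have K0 : 0 < K by lra.
have g0 : 0 < g by lra.
have L0 : 0 < L by lra.
have C0 : 0 < C by lra.
have sD : 0 < s + D by lra.
have M0 : 0 < n * K by rewrite mulr_gt0.
have e0 : 0 < D / (s + D) by rewrite divr_gt0.
split.
- rewrite [leRHS](_ : _ = c1 / (20 * C) * (20 * C * L * (n * K) / g)); last first.
    by field; rewrite !gt_eqF.
  rewrite ler_wpM2l ?divr_ge0 ?mulr_ge0 ?(ltW c0) ?(ltW C0)//.
  rewrite ler_pdivrMr// mulrAC ler_pdivlMr//.
  have h1 : n * g <= n * (5 * C * K ^+ 2) by rewrite ler_wpM2l// ltW.
  have h2 : 5 * C * (n * K) * K <= 5 * C * (n * K) * (4 * X).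
    by rewrite ler_wpM2l// !mulr_ge0// ltW.
  have h3 : 20 * C * X * (n * K) * 1 <= 20 * C * X * (n * K) * L.
    by rewrite ler_wpM2l// !mulr_ge0// ltW.
  by apply: le_trans h1 _; lra.
- rewrite -[X in _ <= _ * X](powRr1 (ltW M0)) -[X in _ <= _ * _ `^ X](_ : (s / D + 1) * (D / (s + D)) = 1); last first.
    by field; rewrite !gt_eqF.
  rewrite [X in _ <= _ * X]powRrM -powRM ?powR_ge0 ?(ltW c0)//.
  apply: ge0_ler_powR; rewrite ?nnegrE ?(ltW e0) ?divr_ge0 ?mulr_ge0 ?powR_ge0 ?(ltW c0) ?(ltW L0) ?(ltW n0) ?(ltW K0) ?(ltW g0)//.
  rewrite powRD ?(gt_eqF M0) ?implybT// powRr1 ?(ltW M0)// ler_pdivrMr//.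
  have LM : L <= (n * K) `^ (s / D).
    apply: le_trans LX _; apply: ge0_ler_powR; rewrite ?nnegrE ?divr_ge0 ?mulr_ge0 ?(ltW s0) ?(ltW D0) ?(ltW n0) ?(ltW K0) ?(ltW X0)//.
    by rewrite ler_wpM2l// ltW.
  have h : c1 * L * (n * K) <= c1 * (n * K) * (n * K) `^ (s / D).
    by rewrite mulrAC ler_wpM2l// mulr_ge0// ltW.
  apply: le_trans h _; rewrite [leRHS](_ : _ = c1 * (n * K) * (n * K) `^ (s / D) * g); last by ring.
  by rewrite ler_peMr// !mulr_ge0 ?powR_ge0// ltW.
rewrite powRM ?invr_ge0 ?mulr_ge0 ?(ltW c0) ?(ltW L0) ?(ltW n0) ?(ltW K0) ?(ltW g0)//.
rewrite powRM ?mulr_ge0 ?(ltW c0) ?(ltW L0) ?(ltW n0) ?(ltW K0)// powRM ?(ltW c0) ?(ltW L0)//.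
rewrite -[g^-1]powR_inv1 ?(ltW g0)// -powRrM mulN1r.
have -> : (n * K) `^ (D / (s + D)) = n * K * (n * K) `^ (- (s / (s + D))).
  rewrite -[X in _ = X * _](powRr1 (ltW M0)) -powRD ?(gt_eqF M0) ?implybT//.
  by congr (_ `^ _); field; rewrite gt_eqF.
by ring.
Qed.

(* The masses are bounded by [a * g], either uniformly, with [g = K ^ 2], or in
   the mean of order [m], with [g = 5 * C]. *)
Lemma fuzzy_rate (R : realType) (d : nat) (s : R) (p : \bar R) (m : nat) :
  (0 < d)%N -> 0 < s -> (1 <= p)%E -> (0 < m)%N ->
  exists C L0 c0 : R, 1 <= C /\ 1 < L0 /\ 0 < c0 /\ forall (n : nat) (L : R),
  L0 <= L -> L <= (n%:R * ln n%:R) `^ (s / d%:R) ->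
  exists K : nat, [/\ (0 < n)%N, 1 <= ln n%:R :> R, (0 < K)%N, K%:R <= 4 * ln n%:R :> R &
    forall g : R, g = K%:R ^+ 2 \/ (p <= m%:R%:E)%E /\ g = 5 * C ->
    (((c0 * (L `^ (d%:R / (s + d%:R)) * g `^ (- (d%:R / (s + d%:R))) *
       (n%:R * K%:R) `^ (- (s / (s + d%:R))))) ^+ 2)%:E <= minimax_mse d n s p L)%E].
Proof.
move=> d0 s0 p1 m0; have [Ce [Cl [Cl0 model]]] := bump_model d0 s0 p1.
pose qm := maxn (m * 2) 4.
have [C [gap [gap0 pairs]]] := exists_matched_pair R qm.
have C1 : 1 <= C by have [J [u [nu0 [nu1 /matched_bound_ge1]]]] := pairs 1%N isT.
have Ce0 : 0 <= Ce by have [eta [Q [eN _ _]]] := model 1%N isT; rewrite (le_trans _ eN).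
have D0 : 0 < d%:R :> R by rewrite ltr0n.
have sd0 : 0 < s + d%:R by rewrite addr_gt0.
have C0 : 0 < C by lra.
pose e := d%:R / (s + d%:R); have e0 : 0 < e by rewrite divr_gt0.
pose al : R := expR (- 2) / 2; have al0 : 0 < al by rewrite divr_gt0 ?expR_gt0.
have al1 : al <= 2^-1.
  by rewrite /al -[leRHS]mul1r ler_wpM2r// -expR0 ler_expR; lra.
pose z : R := (2 * (1 + 5 * C))^-1.
have z0 : 0 < z by rewrite invr_gt0 mulr_gt0//; lra.
(* The first term keeps the small bumps within half of the Lipschitz budget; the second keeps the
   total mass of the cells at most 1/4. *)
pose c1 := Num.min (2 * Cl * al)^-1 (z `^ e^-1).
have c10 : 0 < c1 by rewrite lt_min invr_gt0 !mulr_gt0//= powR_gt0.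
have c1z : c1 `^ e <= z.
  have -> : z = (z `^ e^-1) `^ e by rewrite -powRrM mulVf ?gt_eqF// powRr1// ltW.
  apply: ge0_ler_powR; rewrite ?nnegrE ?(ltW e0) ?(ltW c10) ?powR_ge0//.
  by rewrite ge_min lexx orbT.
pose A := c1 / (20 * C).
have A0 : 0 < A by rewrite divr_gt0// mulr_gt0.
pose C3 := 8 * 16 * 16 * C / gap ^+ 2.
pose C4 := (Ce + 5) ^+ 2 + 4 + (3 + Ce) ^+ 2.
have C30 : 0 < C3 by rewrite divr_gt0 ?mulr_gt0 ?exprn_gt0.
have C40 : 0 < C4 by have := sqr_ge0 (Ce + 5); have := sqr_ge0 (3 + Ce); rewrite /C4; lra.
(* The number of cells must exceed a variance bound of order (ln n)^2, coming from [Lam]; 2^d is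
   lost in rounding [N]. *)
pose B := 2 ^+ d * (C3 * C4).
have B0 : 0 < B by rewrite mulr_gt0 ?exprn_gt0// mulr_gt0.
have [X0 large] := exists_threshold e0 A0 B0.
(* The exponential makes n large, [2 * Cl] leaves half of [L] for the large bump, and 1 makes [L0]
   exceed 1. *)
pose L0 := expR (2 * s * X0 / d%:R) + 2 * Cl + 1.
pose c0 := 2^-1 ^+ d * al * gap * c1 `^ e / 8.
have h0 : 0 < expR (2 * s * X0 / d%:R) by exact: expR_gt0.
have c00 : 0 < c0 by rewrite divr_gt0// !mulr_gt0 ?exprn_gt0 ?powR_gt0.
exists C, L0, c0; split => //; split; first by rewrite /L0; lra.
split => //.
move=> n L LL LX.
have [n1 XX] : (1 < n)%N /\ X0 <= ln n%:R.
  by apply: sample_size_large LX => //; move: LL; rewrite /L0; lra.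
have n0 : 0 < n%:R :> R by rewrite ltr0n ltnW.
have [] := large _ XX; rewrite lnK ?posrE//.
set X := ln n%:R in LX XX *; move=> X1 Xn n32 AX BX.
have LCl : 2 * Cl <= L by move: LL; rewrite /L0; clear -h0; lra.
have L1 : 1 <= L by move: LL; rewrite /L0; clear -h0 Cl0; lra.
have X3 : 0 <= 3 * X by clear -X1; lra.
have /andP[K3 K3'] := truncn_itv X3.
(* Above 3 ln n, as [fuzzy_tail] requires, and at most 4 ln n because ln n >= 1. *)
pose K := (Num.truncn (3 * X)).+1.
have XK : 3 * X <= K%:R by exact: ltW.
have KE : K%:R = (Num.truncn (3 * X))%:R + 1 :> R by rewrite natr1.
have K4 : K%:R <= 4 * X by clear -KE K3 X1; lra.
have K1 : (1 < K)%N by rewrite -(ltr1n R); clear -XK X1; lra.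
exists K; split => //; first exact: ltnW.
move=> g gE.
have k0 : 0 < K%:R :> R by clear -XK X1; lra.
have k1 : 1 <= K%:R :> R by clear -XK X1; lra.
have kk : K%:R <= K%:R ^+ 2 :> R by rewrite expr2 ler_peMr// ltW.
have g1 : 1 <= g by case: gE => [->|[_ ->]]; clear -k1 kk C1; lra.
have gK : g <= 5 * C * K%:R ^+ 2.
  have : K%:R ^+ 2 <= C * K%:R ^+ 2 by rewrite ler_peMl// exprn_ge0// ltW.
  have : C <= C * K%:R ^+ 2 by rewrite ler_peMr ?(ltW C0)// (le_trans k1).
  by case: gE => [->|[_ ->]]; clear -k1 kk C1; lra.
have XK1 : X <= K%:R by clear -XK X1; lra.
have [WA We WE] := mass_scale s0 D0 c10 C1 n0 X1 XK1 K4 L1 LX g1 gK.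
rewrite -/e in We WE *.
set M := n%:R * K%:R in WA We WE *.
set W := c1 * L * M / g in WA We WE.
have W1 : 1 <= W by exact: le_trans WA.
have BW : B * X ^+ 2 <= W `^ e.
  apply: le_trans BX _; apply: ge0_ler_powR; rewrite ?nnegrE ?(ltW e0)//; clear -W1 WA AX; lra.
have M0 : 0 < M by rewrite mulr_gt0.
have Mn : M <= n%:R ^+ 2 by rewrite expr2 ler_wpM2l//; clear -K4 Xn; lra.
have [N N0 [NW Nu Nl]] := grid_size d0 s0 W1.
rewrite -/e in Nu Nl.
pose a := al / M; have a0 : 0 < a by rewrite divr_gt0.
pose I := {ffun 'I_d -> 'I_N}.
have cI : #|{ffun 'I_d -> 'I_N}| = (N ^ d)%N by rewrite card_ffun !card_ord.
set S : R := (N ^ d)%:R in Nu Nl.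
have S0 : 0 <= S by [].
have SzM : S <= z * M by apply: le_trans Nu (le_trans We _); rewrite ler_wpM2r// ltW.
have z1 : z <= 1 by rewrite invf_le1 ?mulr_gt0//; clear -C1; lra.
have SM : S <= M by apply: le_trans SzM _; rewrite ler_piMl// ltW.
have aS : a * ((1 + 5 * C) * S) <= 4^-1.
  have : a * ((1 + 5 * C) * S) <= a * ((1 + 5 * C) * (z * M)).
    by rewrite ler_wpM2l ?(ltW a0)// ler_wpM2l//; clear -C1; lra.
  have -> : a * ((1 + 5 * C) * (z * M)) = al / 2.
    by rewrite /a /z; clear -M0 C1; field; rewrite !gt_eqF//; lra.
  clear -al1; lra.
have aK : a * K%:R ^+ 2 <= 2^-1.
  have -> : a * K%:R ^+ 2 = al * (K%:R / n%:R) by rewrite /a /M; field; rewrite !gt_eqF.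
  apply: le_trans al1; rewrite ler_piMr ?(ltW al0)// ler_pdivrMr//; clear -K4 Xn; lra.
have [J [u [nu0 [nu1 matched]]]] := pairs K (ltnW K1).
have [eta [Q [eN eS fam]]] := model N N0.
(* [eta (Some i)] is - d ln N up to [Ce], and ln a is - 2 - ln 2 - ln (n K); both d ln N and ln (n
   K) lie between 0 and 2 ln n. *)
pose Lam := Ce + 2 * X + 3.
have lnal : ln al = - 2 - ln 2.
  by rewrite /al ln_div ?posrE ?expR_gt0// expRK.
have ln20 : 0 <= ln 2 :> R by rewrite ln_ge0// ler1n.
have ln21 : ln 2 <= 1 :> R.
  have := @ln_le_subr1 R 2; rewrite ltr0n => /(_ isT); clear; lra.
have lnM2 : ln M <= 2 * X.
  rewrite mulr_natl -lnXn// ler_ln ?posrE ?exprn_gt0//.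
have Np : 0 < N%:R :> R by rewrite ltr0n.
have lnS0 : 0 <= d%:R * ln N%:R :> R by rewrite mulr_ge0// ln_ge0// ler1n.
have lnS1 : d%:R * ln N%:R <= ln M.
  rewrite mulr_natl -lnXn// ler_ln ?posrE ?exprn_gt0//.
  by rewrite -natrX.
have eL i : `|eta (Some i) - ln a| <= Lam.
  have := eS i; rewrite !ler_norml ln_div ?posrE// lnal /Lam => /andP[e1 e2].
  by clear -lnS0 lnS1 ln20 ln21 e1 e2 X1 Ce0 lnM2; apply/andP; split; lra.
have SL : C3 * (Lam ^+ 2 + 4 + (3 + Ce) ^+ 2) <= S.
  apply: le_trans Nl; rewrite -(ler_pM2l (exprn_gt0 d (ltr0Sn R 1))) [leRHS]mulrA -exprMn mulfV// expr1n mul1r.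
  apply: le_trans BW; rewrite /B -mulrA -[C3 * C4 * _]mulrA ler_pM2l ?exprn_gt0// (ler_pM2l C30).
  have : Lam ^+ 2 <= (Ce + 5) ^+ 2 * X ^+ 2.
    rewrite -exprMn lerXn2r ?nnegrE /Lam//; clear -X1 Ce0; nra.
  have X21 : 1 <= X ^+ 2 by rewrite exprn_ege1.
  have := ler_wpM2l (sqr_ge0 (3 + Ce)) X21; move: X21; rewrite /C4; clear; lra.
have fz := @fuzzy_lower_bound R d n s p L I J u nu0 nu1 K qm m C gap eta Q a Lam Ce matched
  m0 (leq_maxl _ _) (leq_maxr _ _) K1 gap0 a0.
rewrite cI -/S in fz.
have Sag : 2^-1 ^+ d * W `^ e * a * gap <= S * a * gap.
  by rewrite ler_wpM2r ?(ltW gap0)// ler_wpM2r ?(ltW a0).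
have goal : (c0 * (L `^ e * g `^ (- e) * M `^ (- (s / (s + d%:R))))) ^+ 2 <= (S * a * gap) ^+ 2 / 64.
  have -> : (S * a * gap) ^+ 2 / 64 = (S * a * gap / 8) ^+ 2 by field.
  apply: lerXn2r; rewrite ?nnegrE.
  - by apply: mulr_ge0; [exact: ltW|rewrite !mulr_ge0 ?powR_ge0].
  - by apply: divr_ge0 => //; apply: mulr_ge0; [apply: mulr_ge0 => //|]; exact: ltW.
  rewrite ler_pdivlMr//; apply: le_trans Sag; rewrite WE /c0 /a.
  rewrite le_eqVlt; apply/orP; left; apply/eqP; field.
  by rewrite gt_eqF.
apply: le_trans (fz _ _ eN eL SL _ _).
- by rewrite lee_fin.
- by rewrite mulrDr; clear -aS aK; lra.
- by clear -aS; lra.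
- apply: fuzzy_tail; rewrite ?(ltnW K1) ?(le_trans SM)//; by rewrite -(ler_nat R).
move=> w gw; apply: (tame_masses_model matched m0 a0 _ gE _ fam); last by rewrite cI.
  by rewrite -/S; clear -aS; lra.
have : Cl * (N%:R `^ (d%:R + s) * (a * g)) <= L / 2.
  have h := ler_wpM2l (mulr_ge0 (ltW Cl0) (mulr_ge0 (ltW a0) (le_trans ler01 g1))) NW.
  rewrite (_ : Cl * _ = Cl * (a * g) * N%:R `^ (d%:R + s)); last by ring.
  apply: le_trans h _; have -> : Cl * (a * g) * W = L / 2 * (c1 * (2 * Cl * al)).
    by rewrite /W /a; field; rewrite (gt_eqF M0) (gt_eqF (lt_le_trans ltr01 g1)).
  rewrite ler_piMr//; first by clear -L1; lra.
  by rewrite -ler_pdivlMr ?mulr_gt0// div1r ge_min lexx.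
move: LCl; clear; lra.
Qed.

Lemma ler_powRN (R : realType) (a b r : R) : 0 < a -> a <= b -> 0 <= r ->
  b `^ (- r) <= a `^ (- r).
Proof.
move=> a0 ab r0; have b0 : 0 < b by exact: lt_le_trans ab.
rewrite !powRN lef_pV2 ?posrE ?powR_gt0//.
by apply: ge0_ler_powR; rewrite ?nnegrE ?(ltW a0) ?(ltW b0).
Qed.

(** The larger of two lower bounds is at least half of their sum. *)
Lemma minimax_rmse_ge (R : realType) (d n : nat) (s : R) (p : \bar R) (L c1 c2 x y : R) :
  0 <= c1 -> 0 <= c2 -> 0 <= x -> 0 <= y ->
  (((c1 * x) ^+ 2)%:E <= minimax_mse d n s p L)%E ->
  (((c2 * y) ^+ 2)%:E <= minimax_mse d n s p L)%E ->
  ((Num.min c1 c2 / 2 * (x + y))%:E <= minimax_rmse d n s p L)%E.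
Proof.
move=> c10 c20 x0 y0 h1 h2.
have root (z : R) : 0 <= z -> ((z ^+ 2)%:E <= minimax_mse d n s p L)%E ->
    (z%:E <= minimax_rmse d n s p L)%E.
  move=> z0 h; rewrite -[z]ger0_norm// -sqrtr_sqr -/(sqrte (z ^+ 2)%:E) lee_sqrt//.
  by apply: le_trans h; rewrite lee_fin sqr_ge0.
have m1 : Num.min c1 c2 * x <= c1 * x by rewrite ler_wpM2r// ge_min lexx.
have m2 : Num.min c1 c2 * y <= c2 * y by rewrite ler_wpM2r// ge_min lexx orbT.
have [xy|xy] := leP (c1 * x) (c2 * y).
  apply: le_trans (root _ (mulr_ge0 c20 y0) h2); rewrite lee_fin.
  by rewrite mulrDr; lra.
apply: le_trans (root _ (mulr_ge0 c10 x0) h1); rewrite lee_fin.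
by rewrite mulrDr; lra.
Qed.

Unset Implicit Arguments.
Set Strict Implicit.
Set Printing Implicit Defensive.

Theorem theorem7 (R : realType) (d : nat) (s : R) (p : \bar R)
    (hd : (0 < d)%N) (hs : 0 < s) (hp : (1 <= p)%E) :
  exists L0 c0 : R, 1 < L0 /\ 0 < c0 /\
  forall (n : nat) (L : R),
    L0 <= L -> L <= (n%:R * ln n%:R) `^ (s / d%:R) ->
    ((p < +oo)%E ->
      ((c0 * ((n%:R * ln n%:R) `^ (- (s / (s + d%:R)))
                * L `^ (d%:R / (s + d%:R))
              + n%:R `^ (- 2^-1) * ln L))%:E
       <= minimax_rmse d n s p L)%E) /\
    (p = +oo%E ->
      ((c0 * (n%:R `^ (- (s / (s + d%:R)))
                * ln n%:R `^ (- ((s + 2 * d%:R) / (s + d%:R)))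
                * L `^ (d%:R / (s + d%:R))
              + n%:R `^ (- 2^-1) * ln L))%:E
       <= minimax_rmse d n s p L)%E).
Proof.
have D0 : 0 < d%:R :> R by rewrite ltr0n.
have sd0 : 0 < s + d%:R by rewrite addr_gt0.
have e0 : 0 <= d%:R / (s + d%:R) by rewrite divr_ge0 ?(ltW D0) ?(ltW sd0).
have e0' : 0 <= s / (s + d%:R) by rewrite divr_ge0 ?(ltW hs) ?(ltW sd0).
(* For finite p an integer order above p gives access to the moment form of the Lipschitz bound; for
   p = oo the order only serves to cut off the draws, and 1 will do. *)
have [m m0 pm] : exists2 m : nat, (0 < m)%N & (p < +oo -> p <= m%:R%:E)%E.
  case: p hp => [r| |]//= r1; last by exists 1%N.
  exists (Num.truncn r).+1 => // _; rewrite lee_fin.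
  by have /andP[_ /ltW] := truncn_itv (le_trans ler01 r1).
have [C [L1 [c1 [C1 [L11 [c10 fuzzy]]]]]] := fuzzy_rate hd hs hp m0.
have [L2 [c2 [L21 [c20 para]]]] := parametric_lower_bound hd hs hp.
set e := d%:R / _ in e0 fuzzy *; set e' := s / (s + d%:R) in e0' fuzzy *.
(* K <= 4 ln n gives 4^(- s / (s + d)) in both constants; [g] is 5 C in [k1] and at most 16 (ln n)^2
   in [k2]. *)
pose k1 := c1 * (5 * C) `^ (- e) * 4 `^ (- e').
pose k2 := c1 * 16 `^ (- e) * 4 `^ (- e').
have k10 : 0 < k1 by rewrite !mulr_gt0 ?powR_gt0//; lra.
have k20 : 0 < k2 by rewrite !mulr_gt0 ?powR_gt0.
exists (Num.max L1 L2), (Num.min (Num.min k1 k2) c2 / 2); split.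
  by rewrite lt_max L11.
split; first by rewrite divr_gt0// !lt_min k10 k20.
move=> n L; rewrite ge_max => /andP[LL1 LL2] LX.
have [K [n0 X1 K0 K4 fz]] := fuzzy n L LL1 LX.
have par := para n L n0 LL2.
have L0 : 1 <= L by apply: le_trans LL1; exact: ltW.
have nr0 : 0 < n%:R :> R by rewrite ltr0n.
have kr0 : 0 < K%:R :> R by rewrite ltr0n.
set X := ln n%:R in X1 K4 LX *; have X0 : 0 < X by lra.
have M4 : 4 `^ (- e') * (n%:R * X) `^ (- e') <= (n%:R * K%:R) `^ (- e').
  rewrite -powRM ?mulr_ge0 ?(ltW nr0) ?(ltW X0)//.
  apply: ler_powRN; rewrite ?mulr_gt0//.
  by rewrite mulrCA ler_wpM2l// ltW.
have par0 : 0 <= n%:R `^ (- 2^-1) * ln L by rewrite mulr_ge0 ?powR_ge0 ?ln_ge0.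
have combine k x : 0 <= k -> Num.min k1 k2 <= k -> 0 <= x ->
    (((k * x) ^+ 2)%:E <= minimax_mse d n s p L)%E ->
    ((Num.min (Num.min k1 k2) c2 / 2 * (x + n%:R `^ (- 2^-1) * ln L))%:E <=
      minimax_rmse d n s p L)%E.
  move=> k0 kk x0 hx; apply: le_trans (minimax_rmse_ge k0 (ltW c20) x0 par0 hx par).
  rewrite lee_fin ler_wpM2r ?addr_ge0// ler_wpM2r ?invr_ge0//.
  by rewrite le_min ge_min kk/= ge_min lexx orbT.
split => [poo|poo].
  apply: (combine k1); rewrite ?(ltW k10) ?ge_min ?lexx ?mulr_ge0 ?powR_ge0//.
  apply: le_trans (fz (5 * C) (or_intror (conj (pm poo) erefl))); rewrite lee_fin.
  apply: lerXn2r; rewrite ?nnegrE ?mulr_ge0 ?powR_ge0 ?(ltW c10) ?(ltW k10)//.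
  rewrite /k1 [leLHS](_ : _ = c1 * (L `^ e * (5 * C) `^ (- e) * (4 `^ (- e') * (n%:R * X) `^ (- e')))); last by ring.
  by rewrite ler_wpM2l ?(ltW c10)// ler_wpM2l ?mulr_ge0 ?powR_ge0.
apply: (combine k2); rewrite ?(ltW k20) ?ge_min ?lexx ?orbT ?mulr_ge0 ?powR_ge0//.
apply: le_trans (fz (K%:R ^+ 2) (or_introl erefl)); rewrite lee_fin.
apply: lerXn2r; rewrite ?nnegrE ?mulr_ge0 ?powR_ge0 ?(ltW c10) ?(ltW k20)//.
have G16 : 16 `^ (- e) * (X ^+ 2) `^ (- e) <= (K%:R ^+ 2) `^ (- e).
  rewrite -powRM ?exprn_ge0 ?(ltW X0)//.
  apply: ler_powRN; rewrite ?exprn_gt0//.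
  rewrite [leRHS](_ : _ = (4 * X) ^+ 2); last by ring.
  by rewrite lerXn2r ?nnegrE ?mulr_ge0 ?(ltW kr0) ?(ltW X0).
(* The exponent of ln n for p = oo is 2 d / (s + d), from g = K^2, plus s / (s + d), from n K. *)
have XE : X `^ (- ((s + 2 * d%:R) / (s + d%:R))) = (X ^+ 2) `^ (- e) * X `^ (- e').
  rewrite -[X ^+ 2]powR_mulrn ?(ltW X0)// -powRrM -powRD ?(gt_eqF X0) ?implybT//.
  by congr (_ `^ _); rewrite /e /e'; field; rewrite gt_eqF.
rewrite XE /k2.
rewrite [leLHS](_ : _ = c1 * (L `^ e * (16 `^ (- e) * (X ^+ 2) `^ (- e)) *
  (4 `^ (- e') * (n%:R `^ (- e') * X `^ (- e'))))); last by ring.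
rewrite -[n%:R `^ _ * X `^ _]powRM ?(ltW nr0) ?(ltW X0)//.
rewrite ler_wpM2l ?(ltW c10)// ler_pM ?mulr_ge0 ?powR_ge0//.
by rewrite ler_wpM2l ?powR_ge0.
Qed.
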